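(* Let $A$ be a $1$-closed formula of $L(\mathrm{PA}^2)$ and $\Gamma=(A_0,\ldots,A_{n-1})$ a $1$-closed sequent of $L(\mathrm{PA}^2)$. Let $\theta$ be an environment for $A$ and $\rho$ a $[\![A]\!]$-assignment. Then: (1) $\rho([\![A]\!])$ is a determined game; (2) if $\rho$ and $\theta$ correspond, then $[A]_\theta=\mathrm{true}$ if and only if $[\![A]\!]_\rho=\mathsf P$; (3) $[\![A]\!]$ is a valid parametric game if and only if $A$ is a valid second order formula; (4) if $\Gamma$ is valid, then there is a primitive recursive $\mathsf P$-winning strategy for the set-theoretical game $[\![\Gamma]\!]$.
   Context: Games. Players $\mathsf P$, $\mathsf O$ with $\mathsf P^\bot=\mathsf O$, $\mathsf O^\bot=\mathsf P$. $M$ is a countable set of moves containing primitive recursive injective constructors $\mathrm{DROP}(n),\mathrm{EM}(n,m),\mathrm{STOP}(n),\mathrm{JUST}(n,m),\mathrm{nth}(n)$ ($n,m\in\mathbb N$) with disjoint ranges covering $M$ ($M$ is coded in $\mathbb N$). $\mathrm{Par}$ is a countable set with a fixed-point-free involution $a\mapsto a^\bot$; $J\subseteq\mathrm{Par}$ is self-dual if $J^\bot=J$. A tree support is a set of finite lists over $M$ containing the empty list $\langle\rangle$ and closed under prefixes; $T_\infty$ = infinite sequences with all finite prefixes in $T$. A parametric game $G$: tree support $|G|$ with an enumeration of children, $\mathrm{turn}_G$: non-leaves $\to\{\mathsf P,\mathsf O\}$, $\mathrm{win}_G$: leaves $\to\{\mathsf P,\mathsf O\}\cup\mathrm{Par}$,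 and a partition $(G_{\mathsf P},G_{\mathsf O})$ of $|G|_\infty$. $\mathrm{FV}(G)$ = smallest self-dual set containing the parameters labelling leaves; $G$ is set-theoretical if $\mathrm{FV}(G)=\emptyset$. A $J$-assignment is $\rho:J\to\{\mathsf P,\mathsf O\}$ ($J$ self-dual) with $\rho(a^\bot)=\rho(a)^\bot$, extended by $\rho(g)=g$; a $G$-assignment has $J\supseteq\mathrm{FV}(G)$, and $\rho(G)$ is $G$ with $\mathrm{win}_G$ replaced by $\rho\circ\mathrm{win}_G$. $G^\bot$ applies $^\bot$ to all values of $\mathrm{turn}_G,\mathrm{win}_G$ and swaps $G_{\mathsf P},G_{\mathsf O}$; $G_x$ is the subgame at $x$; $\mathrm{END}(x)$ is the one-position game whose root leaf is labelled $x$; atomic means $|G|=\{\langle\rangle\}$. Strategies $\sigma:G$ are tree supports $\sigma\subseteq|G|$; $\sigma$ is $g$-winning if: every non-leaf $p\in\sigma$ with $\mathrm{turn}(p)=g^\bot$ has all its one-step extensions in $|G|$ inside $\sigma$; every non-leaf $p\in\sigma$ with $\mathrm{turn}(p)=g$ has some one-step extension in $\sigma$; every leaf of $|G|$ in $\sigma$ has winner $g$; every infinite branch of $\sigma$ lies in $G_g$. $G$ is determined if some player has a winning strategy. A strategy is primitive recursive if it is a primitive recursive set of lists. $\bigvee_{j\in K}H_j$ ($K\subseteq M$): positions $\langle\rangle$ and $j@x$, $j\in K$, $x\in|H_j|$; if $K=\emptyset$ the root is a leaf won by $\mathsf O$, else $\mathsf P$ moves at the root; all other data is inherited from $H_j$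 (infinite $j@x$ is won by $g$ iff $x\in(H_j)_g$). $\bigwedge_{j\in K}H_j=(\bigvee_{j\in K}H_j^\bot)^\bot$. $\forall I.(G_0,\ldots,G_{n-1})$ ($I$ self-dual, $\mathrm{FV}(\Gamma)=\bigcup\mathrm{FV}(G_i)$): the root has local positions $G_0,\ldots,G_{n-1}$. At a position $p=\langle\mathrm{JUST}(i_0,n),m_0,\ldots,\mathrm{JUST}(i_{k-1},n+k-1),m_{k-1}\rangle$ with local positions $G_0,\ldots,G_{n+k-1}$, $\mathsf P$ moves, and $p@m$ is a position iff: $m=\mathrm{DROP}(n+k)$ (leaf won by $\mathsf O$); or $m=\mathrm{EM}(i,j)$, $i,j<n+k$, $G_i=\mathrm{END}(a)$, $G_j=\mathrm{END}(a^\bot)$, $a\in I$ (leaf won by $\mathsf P$); or $m=\mathrm{STOP}(i)$, $i<n+k$, $G_i=\mathrm{END}(x)$, $x\in\{\mathsf P,\mathsf O\}\cup(\mathrm{FV}(\Gamma)\setminus I)$ (leaf labelled $x$); or $m=\mathrm{JUST}(i_k,n+k)$ with $G_{i_k}$ not atomic, $i_k<n+k$. Then the first player of $G_{i_k}$ moves some $m_k$ with $\langle m_k\rangle\in|G_{i_k}|$, the new local position is $G_{n+k}=(G_{i_k})_{\langle m_k\rangle}$, and $i_k\vdash_{m_k}n+k$. For a list $q=\langle m_0,m_1,\ldots\rangle$ (finite or infinite), $q\prec_i p$ if there is a chain $i=j_0<j_1<\cdots$ of the same length with $j_s\vdash_{m_s}j_{s+1}$ in $p$. An infinite play $p$ is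 won by $\mathsf P$ iff for some $i<n$ some infinite $q\prec_i p$ lies in $(G_i)_{\mathsf P}$; otherwise by $\mathsf O$. $\mathrm{FV}(\forall I.\Gamma)=\mathrm{FV}(\Gamma)\setminus I$. Language $L(\mathrm{PA}^2)$: terms from variables over $\mathbb N$, constants $c_n$ ($n\in\mathbb N$) and a function symbol for each primitive recursive function; for each primitive recursive predicate $\psi:\mathbb N^k\to\{\mathrm{true},\mathrm{false}\}$ symbols $p,p^\bot$ for $\psi$ and its complement; for each $k$ infinitely many $k$-ary predicate variables $X$ and their negations $X^\bot$. Atomic formulas: $s(t_1,\ldots,t_k)$ with $s\in\{p,p^\bot,X,X^\bot\}$. Formulas: atomic, $A\wedge B$, $A\vee B$, $\forall x.A$, $\exists x.A$, $\forall^2X.A$, $\exists^2X.A$. $A^\bot$ swaps $X/X^\bot$, $p/p^\bot$, $\wedge/\vee$, $\forall/\exists$, $\forall^2/\exists^2$; disjunctive formulas are $A\vee B,\exists x.A,\exists^2X.A$. $A$ is $1$-closed if it has no free first-order variables. An environment $\theta$ for $A$ maps free first-order variables to $\mathbb N$ and free $k$-ary predicate variables $X$ to maps $\mathbb N^k\to\{\mathrm{true},\mathrm{false}\}$, with $\theta(X^\bot)$ the complement; $[A]_\theta$ is the standard truth value, second-order quantifiers ranging over all maps $\mathbb N^k\to\{\mathrm{true},\mathrm{false}\}$. $A$ is valid if $[A]_\theta=\mathrm{true}$ for all environments $\theta$; a sequent $(A_0,\ldots,A_{n-1})$ is valid if for every environment $\theta$ some $[A_i]_\theta=\mathrm{true}$.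 Game interpretation. $\mathrm{Par}$ is the set of formulas $X(c_{h_1},\ldots,c_{h_k})$, $X^\bot(c_{h_1},\ldots,c_{h_k})$ with involution $X(\vec c_h)\leftrightarrow X^\bot(\vec c_h)$; $\mathrm{Var}(X)=\{X(\vec c_h),X^\bot(\vec c_h):\vec h\in\mathbb N^k\}$, and $\mathrm{Var}$ of a set of variables is the union. For $1$-closed $A$: $[\![X(\vec t)]\!]=\mathrm{END}(X(\vec c_h))$ and $[\![X^\bot(\vec t)]\!]=\mathrm{END}(X^\bot(\vec c_h))$ with $\vec h$ the values of the closed terms $\vec t$; $[\![p(\vec t)]\!]$, $[\![p^\bot(\vec t)]\!]$ is $\mathrm{END}(\mathsf P)$ if the closed atomic formula is true, $\mathrm{END}(\mathsf O)$ otherwise; $[\![A_1\wedge A_2]\!]=\bigwedge_{j\in\{\mathrm{nth}(1),\mathrm{nth}(2)\}}H_j$ with $H_{\mathrm{nth}(i)}=[\![A_i]\!]$; $[\![\forall x.B]\!]=\bigwedge_{j\in\mathrm{nth}(\mathbb N)}H_j$ with $H_{\mathrm{nth}(m)}=[\![B[c_m/x]]\!]$; $[\![\forall^2X.B]\!]=\forall\mathrm{Var}(X).([\![B]\!])$; for disjunctive $A$, $[\![A]\!]=[\![A^\bot]\!]^\bot$. For a sequent, $[\![\Gamma]\!]=\forall\mathrm{Var}(\mathrm{FV}_2(\Gamma)).([\![A_0]\!],\ldots,[\![A_{n-1}]\!])$, $\mathrm{FV}_2(\Gamma)$ the free predicate variables of $\Gamma$ (with their negations). If $\rho([\![A]\!])$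 is determined, $[\![A]\!]_\rho$ denotes its winner. $[\![A]\!]$ is a valid parametric game if $[\![A]\!]_\rho=\mathsf P$ for every $[\![A]\!]$-assignment $\rho$. $\rho$ and $\theta$ correspond if for every free $k$-ary predicate variable $X$ of $A$ and $\vec h\in\mathbb N^k$: $\rho(X(\vec c_h))=\mathsf P$ iff $\theta(X)(\vec h)=\mathrm{true}$. *)

(* Defs.v *)
From Stdlib Require List.
From mathcomp Require Import all_boot.
From mathcomp Require Import boolp classical_sets.

Set Implicit Arguments.
Unset Strict Implicit.
Unset Printing Implicit Defensive.

Local Open Scope classical_set_scope.

Inductive primrec : forall k, (k.-tuple nat -> nat) -> Prop :=
| primrec_zero k : @primrec k (fun _ => 0)
| primrec_succ : @primrec 1 (fun v => (thead v).+1)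
| primrec_proj k (i : 'I_k) : @primrec k (fun v => tnth v i)
| primrec_comp k l (f : l.-tuple nat -> nat) (g : 'I_l -> k.-tuple nat -> nat) :
    primrec f -> (forall i, primrec (g i)) ->
    @primrec k (fun v => f [tuple g i v | i < l])
| primrec_rec k (f : k.-tuple nat -> nat) (g : k.+2.-tuple nat -> nat) :
    primrec f -> primrec g ->
    @primrec k.+1 (fun v =>
      nat_rect (fun _ => nat) (f [tuple of behead v])
        (fun n r => g [tuple of n :: r :: behead v]) (thead v))
| primrec_ext k (f g : k.-tuple nat -> nat) : f =1 g -> primrec f -> primrec g.

Inductive player := Proponent | Opponent.

Definition pdual (g : player) : player :=
  if g is Proponent then Opponent else Proponent.

Inductive move :=
| DROP of nat
| EM of nat & nat
| STOP of nat
| JUST of nat & nat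
| NTH of nat.

(* Cantor pairing, a bijection; the codes of moves and of lists of moves are
   bijections onto the naturals as well. *)
Definition cpair (n m : nat) : nat := 'C((n + m).+1, 2) + m.

Definition move_tag (m : move) : nat :=
  match m with
  | DROP _ => 0 | EM _ _ => 1 | STOP _ => 2 | JUST _ _ => 3 | NTH _ => 4
  end.

Definition move_arg (m : move) : nat :=
  match m with
  | DROP n | STOP n | NTH n => n
  | EM n k | JUST n k => cpair n k
  end.

Definition code_move (m : move) : nat := move_arg m * 5 + move_tag m.

Fixpoint code_list (p : seq move) : nat :=
  if p is m :: p' then (cpair (code_move m) (code_list p')).+1 else 0.

Lemma cpair_inj n m n' m' : cpair n m = cpair n' m' -> n = n' /\ m = m'.
Proof.
have lt_cpair a b c d : a + b < c + d -> cpair a b < cpair c d.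
  move=> h; rewrite /cpair.
  have h1 : 'C((a + b).+2, 2) <= 'C((c + d).+1, 2) by apply: leq_bin2l.
  apply: leq_trans (leq_addr d _); apply: leq_trans h1.
  by rewrite [X in _ <= X]binS bin1 -addnS leq_add2l ltnS leq_addl.
move=> e; have [h|h|h] := ltngtP (n + m) (n' + m').
- by have := lt_cpair _ _ _ _ h; rewrite e ltnn.
- by have := lt_cpair _ _ _ _ h; rewrite e ltnn.
- have em : m = m' by move: e; rewrite /cpair h => /addnI.
  by split=> //; move: h; rewrite em => /addIn.
Qed.

Lemma code_move_inj : injective code_move.
Proof.
have tag5 m : move_tag m < 5 by case: m.
move=> m m' e; have et : move_tag m = move_tag m'.
  by have := congr1 (modn^~ 5) e; rewrite /code_move !modnMDl !modn_small.
have ea : move_arg m = move_arg m'.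
  by move: e; rewrite /code_move et => /addIn /eqP; rewrite eqn_mul2r => /eqP.
case: m m' et ea {e} => [a|a b|a|a b|a] [c|c d|c|c d|c] //= _;
  by [move=> -> | case/cpair_inj => -> ->].
Qed.

Lemma code_list_inj : injective code_list.
Proof.
elim=> [|m p IH] [|m' p'] //= [] /cpair_inj [em ep].
by rewrite (code_move_inj em) (IH _ ep).
Qed.

Definition primrec_set (S : seq move -> Prop) : Prop :=
  exists chi : nat -> bool,
    @primrec 1 (fun v => chi (thead v)) /\
    forall p, S p <-> chi (code_list p).

(* [Par true k X h] is the closed atomic formula X(c_h) and [Par false k X h]
   its negation, X being the predicate variable of arity k and index X. *)
Inductive par := Par (s : bool) (k X : nat) (h : k.-tuple nat).

Definition pardual (a : par) : par :=
  let: Par s k X h := a in @Par (~~ s) k X h.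

Definition selfdual (J : set par) : Prop := forall a, J (pardual a) <-> J a.

Inductive label := Won of player | Open of par.

Definition ldual (x : label) : label :=
  match x with Won g => Won (pdual g) | Open a => Open (pardual a) end.

Record tree := Tree {
  tmem :> seq move -> Prop;
  tree_nil : tmem [::];
  tree_prefix : forall p q, tmem (p ++ q) -> tmem p }.

Definition branch (T : tree) : set (nat -> move) :=
  [set b | forall n, T (mkseq b n)].

(* [turn] is meaningful on non-leaves, [win] on leaves and [iwin] on infinite
   branches only; [iwin] presents the partition of the infinite branches.
   Moves being coded by naturals, the children of every node come with the
   enumeration induced by [code_move]. *)
Record game := Game {
  supp : tree;
  turn : seq move -> player;
  win : seq move -> label;
  iwin : (nat -> move) -> player }.

Definition leaf (G : game) : set (seq move) :=
  [set p | supp G p /\ forall m, ~ supp G (rcons p m)].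

Definition inf_won (G : game) (g : player) : set (nat -> move) :=
  [set b | branch (supp G) b /\ iwin G b = g].

Definition atomic (G : game) : Prop := forall p, supp G p <-> p = [::].

(* Equality of games, disregarding the meaningless values. *)
Definition game_eq (G H : game) : Prop :=
  [/\ forall p, supp G p <-> supp H p,
      forall p, supp G p -> ~ leaf G p -> turn G p = turn H p,
      forall p, leaf G p -> win G p = win H p &
      forall b, branch (supp G) b -> iwin G b = iwin H b].

Definition FV (G : game) : set par :=
  [set a | forall J : set par, selfdual J ->
     (forall p b, leaf G p -> win G p = Open b -> J b) -> J a].

Definition set_theoretical (G : game) : Prop := FV G = set0.

Record assignment := Assignment {
  adom : set par;
  aval : par -> player;
  adom_selfdual : selfdual adom;
  aval_dual : forall a, adom a -> aval (pardual a) = pdual (aval a) }.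

Definition assignment_for (rho : assignment) (G : game) : Prop :=
  FV G `<=` adom rho.

Definition alabel (rho : assignment) (x : label) : player :=
  match x with Won g => g | Open a => aval rho a end.

Definition instance (rho : assignment) (G : game) : game :=
  Game (supp G) (turn G) (fun p => Won (alabel rho (win G p))) (iwin G).

Definition gdual (G : game) : game :=
  Game (supp G) (fun p => pdual (turn G p)) (fun p => ldual (win G p))
       (fun b => pdual (iwin G b)).

(* Only used for x in |G|; the first disjunct is then redundant. *)
Lemma subtree_prefix (T : tree) x p q :
  (p ++ q = [::] \/ T (x ++ (p ++ q))) -> (p = [::] \/ T (x ++ p)).
Proof.
case=> [|h]; first by case: p => [_|//]; left.
by right; apply: (@tree_prefix T _ q); rewrite -catA.
Qed.

Definition subtree (T : tree) (x : seq move) : tree :=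
  @Tree [set p | p = [::] \/ T (x ++ p)] (or_introl erefl)
        (@subtree_prefix T x).

Definition icat (x : seq move) (b : nat -> move) : nat -> move :=
  fun n => if n < size x then nth (DROP 0) x n else b (n - size x).

Definition subgame (G : game) (x : seq move) : game :=
  Game (subtree (supp G) x) (fun p => turn G (x ++ p)) (fun p => win G (x ++ p))
       (fun b => iwin G (icat x b)).

Lemma tree1_prefix (p q : seq move) : p ++ q = [::] -> p = [::].
Proof. by case: p. Qed.

Definition tree1 : tree := @Tree [set p | p = [::]] erefl tree1_prefix.

Definition END (x : label) : game :=
  Game tree1 (fun _ => Proponent) (fun _ => x) (fun _ => Opponent).

Definition winning (g : player) (G : game) (sigma : tree) : Prop :=
  [/\ forall p, sigma p -> supp G p,
      forall p, sigma p -> ~ leaf G p -> turn G p = pdual g ->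
        forall m, supp G (rcons p m) -> sigma (rcons p m),
      forall p, sigma p -> ~ leaf G p -> turn G p = g ->
        exists m, sigma (rcons p m),
      forall p, sigma p -> leaf G p -> win G p = Won g &
      forall b, branch sigma b -> inf_won G g b].

Definition winner (G : game) (g : player) : Prop :=
  exists sigma : tree, winning g G sigma.

Definition determined (G : game) : Prop := exists g, winner G g.

Definition valid_game (G : game) : Prop :=
  forall rho, assignment_for rho G -> winner (instance rho G) Proponent.

Definition vee_mem (K : set move) (H : move -> game) : set (seq move) :=
  [set p | if p is j :: x then K j /\ supp (H j) x else True].

Lemma vee_prefix K H p q : vee_mem K H (p ++ q) -> vee_mem K H p.
Proof. by case: p => //= j x [Kj /tree_prefix]. Qed.

Definition bigvee (K : set move) (H : move -> game) : game :=
  Game (@Tree (vee_mem K H) I (@vee_prefix K H))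
       (fun p => if p is j :: x then turn (H j) x else Proponent)
       (fun p => if p is j :: x then win (H j) x else Won Opponent)
       (fun b => iwin (H (b 0)) (fun n => b n.+1)).

Definition bigwedge (K : set move) (H : move -> game) : game :=
  gdual (bigvee K (fun j => gdual (H j))).

Definition FVs (L : seq game) : set par :=
  [set a | List.Exists (fun G => FV G a) L].

Definition local (L : seq game) (i : nat) : game := nth (END (Won Opponent)) L i.

(* In the three functions below, L is the current list of local positions: after
   [JUST i _] and a move m it is extended with the subgame of its i-th element
   at m. F is the set of free parameters of the initial list. *)
Fixpoint forall_mem (I F : set par) (L : seq game) (p : seq move) : Prop :=
  match p with
  | [::] => True
  | DROP d :: p' => p' = [::] /\ d = size L
  | EM i j :: p' => p' = [::] /\ [/\ i < size L, j < size L &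
      exists a, [/\ I a, game_eq (local L i) (END (Open a)) &
                    game_eq (local L j) (END (Open (pardual a)))]]
  | STOP i :: p' => p' = [::] /\ (i < size L /\
      exists x, game_eq (local L i) (END x) /\
                match x with Won _ => True | Open a => F a /\ ~ I a end)
  | JUST i d :: p' =>
      [/\ i < size L, d = size L, ~ atomic (local L i) &
          if p' is m :: p'' then
            supp (local L i) [:: m] /\
            forall_mem I F (rcons L (subgame (local L i) [:: m])) p''
          else True]
  | NTH _ :: _ => False
  end.

Fixpoint forall_turn (L : seq game) (p : seq move) : player :=
  match p with
  | [:: JUST i _] => turn (local L i) [::]
  | JUST i _ :: m :: p' => forall_turn (rcons L (subgame (local L i) [:: m])) p'
  | _ => Proponent
  end.

Fixpoint forall_win (L : seq game) (p : seq move) : label :=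
  match p with
  | EM _ _ :: _ => Won Proponent
  | STOP i :: _ => win (local L i) [::]
  | JUST i _ :: m :: p' => forall_win (rcons L (subgame (local L i) [:: m])) p'
  | _ => Won Opponent
  end.

(* The relation i |-_m j in the infinite play p, for n initial games. *)
Definition justifies (n : nat) (p : nat -> move) (i : nat) (m : move) (j : nat) :=
  exists k, [/\ j = n + k, p (2 * k) = JUST i j & p (2 * k + 1) = m].

(* The infinite sequence q satisfies q -<_i p. *)
Definition thread (n : nat) (p : nat -> move) (i : nat) (q : nat -> move) : Prop :=
  exists j : nat -> nat, j 0 = i /\
    forall s, j s < j s.+1 /\ justifies n p (j s) (q s) (j s.+1).

Definition forall_iwin (L : seq game) (p : nat -> move) : player :=
  if `[< exists i, i < size L /\
           exists q, thread (size L) p i q /\ inf_won (local L i) Proponent q >]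
  then Proponent else Opponent.

Lemma forall_prefix I F L p q : forall_mem I F L (p ++ q) -> forall_mem I F L p.
Proof.
have [n] := ubnP (size p); elim: n p L => // n IH [|m p] L //= hn.
case: m => [d|i j|i|i d|k] /=.
- by case=> /tree1_prefix ->.
- by case=> /tree1_prefix ->.
- by case=> /tree1_prefix ->.
- case: p hn => [|m p] hn //=; first by case.
  case=> h1 h2 h3 [h4 /IH h5]; split=> //; split=> //.
  by apply: h5; exact: ltnW hn.
- by [].
Qed.

Definition forall_game (I : set par) (L : seq game) : game :=
  Game (@Tree (forall_mem I (FVs L) L) Logic.I (@forall_prefix I (FVs L) L))
       (forall_turn L) (forall_win L) (forall_iwin L).

Record prfun (k : nat) := PrFun {
  prf :> k.-tuple nat -> nat; prfP : primrec prf }.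

Record prpred (k : nat) := PrPred {
  prp :> k.-tuple nat -> bool; prpP : primrec (fun v => nat_of_bool (prp v)) }.

Inductive term :=
| TVar of nat
| TConst of nat
| TFun k of prfun k & ('I_k -> term).

(* The boolean of an atomic formula is [false] for the negated symbols. *)
Inductive formula :=
| FPred (s : bool) k of prpred k & ('I_k -> term)
| FVar (s : bool) (k X : nat) of ('I_k -> term)
| And of formula & formula
| Or of formula & formula
| All of nat & formula
| Ex of nat & formula
| All2 (k X : nat) of formula
| Ex2 (k X : nat) of formula.

Fixpoint neg (A : formula) : formula :=
  match A with
  | FPred s k p ts => FPred (~~ s) p ts
  | FVar s k X ts => FVar (~~ s) X ts
  | And A B => Or (neg A) (neg B)
  | Or A B => And (neg A) (neg B)
  | All x A => Ex x (neg A)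
  | Ex x A => All x (neg A)
  | All2 k X A => Ex2 k X (neg A)
  | Ex2 k X A => All2 k X (neg A)
  end.

Definition disjunctive (A : formula) : bool :=
  match A with Or _ _ | Ex _ _ | Ex2 _ _ _ => true | _ => false end.

Fixpoint tfree (x : nat) (t : term) : Prop :=
  match t with
  | TVar y => y = x
  | TConst _ => False
  | TFun k f ts => exists i, tfree x (ts i)
  end.

Fixpoint free1 (x : nat) (A : formula) : Prop :=
  match A with
  | FPred _ _ _ ts => exists i, tfree x (ts i)
  | FVar _ _ _ ts => exists i, tfree x (ts i)
  | And A B | Or A B => free1 x A \/ free1 x B
  | All y A | Ex y A => y <> x /\ free1 x A
  | All2 _ _ A | Ex2 _ _ A => free1 x A
  end.

Definition closed1 (A : formula) : Prop := forall x, ~ free1 x A.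

Fixpoint free2 (k X : nat) (A : formula) : Prop :=
  match A with
  | FPred _ _ _ _ => False
  | FVar _ k' X' _ => k' = k /\ X' = X
  | And A B | Or A B => free2 k X A \/ free2 k X B
  | All _ A | Ex _ A => free2 k X A
  | All2 k' X' A | Ex2 k' X' A => ~ (k' = k /\ X' = X) /\ free2 k X A
  end.

Fixpoint tsubst (x n : nat) (t : term) : term :=
  match t with
  | TVar y => if y == x then TConst n else TVar y
  | TConst m => TConst m
  | TFun k f ts => TFun f (fun i => tsubst x n (ts i))
  end.

(* A[c_n/x] *)
Fixpoint subst (x n : nat) (A : formula) : formula :=
  match A with
  | FPred s k p ts => FPred s p (fun i => tsubst x n (ts i))
  | FVar s k X ts => FVar s X (fun i => tsubst x n (ts i))
  | And A B => And (subst x n A) (subst x n B)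
  | Or A B => Or (subst x n A) (subst x n B)
  | All y A => All y (if y == x then A else subst x n A)
  | Ex y A => Ex y (if y == x then A else subst x n A)
  | All2 k X A => All2 k X (subst x n A)
  | Ex2 k X A => Ex2 k X (subst x n A)
  end.

Fixpoint teval (e : nat -> nat) (t : term) : nat :=
  match t with
  | TVar x => e x
  | TConst n => n
  | TFun k f ts => f [tuple teval e (ts i) | i < k]
  end.

(* Environments are total; the values outside the free variables of a formula
   do not matter. *)
Record env := Env {
  env1 : nat -> nat;
  env2 : forall k, nat -> k.-tuple nat -> bool }.

Definition upd1 (th : env) (x n : nat) : env :=
  Env (fun y => if y == x then n else env1 th y) (env2 th).

Definition upd2 (th : env) (k X : nat) (Z : k.-tuple nat -> bool) : env :=
  Env (env1 th) (fun k' X' h =>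
    match @eqP _ k' k with
    | ReflectT e => if X' == X then Z (tcast e h) else env2 th X' h
    | ReflectF _ => env2 th X' h
    end).

Lemma env2_upd2 th k X Z : @env2 (@upd2 th k X Z) k X = Z.
Proof.
apply: funext => h /=; case: eqP => // e.
by rewrite eqxx (eq_irrelevance e erefl) tcast_id.
Qed.

Lemma env2_upd2_neq th k X Z k' X' :
  ~ (k' = k /\ X' = X) -> @env2 (@upd2 th k X Z) k' X' = @env2 th k' X'.
Proof.
move=> ne; apply: funext => h /=; case: eqP => // e.
by case: eqP => // eX; case: ne.
Qed.

Fixpoint truth (th : env) (A : formula) : bool :=
  match A with
  | FPred s k p ts =>
      let v := p [tuple teval (env1 th) (ts i) | i < k] in if s then v else ~~ v
  | FVar s k X ts =>
      let v := env2 th X [tuple teval (env1 th) (ts i) | i < k] in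
      if s then v else ~~ v
  | And A B => truth th A && truth th B
  | Or A B => truth th A || truth th B
  | All x A => `[< forall n, truth (upd1 th x n) A >]
  | Ex x A => `[< exists n, truth (upd1 th x n) A >]
  | All2 k X A => `[< forall Z : k.-tuple nat -> bool, truth (upd2 th X Z) A >]
  | Ex2 k X A => `[< exists Z : k.-tuple nat -> bool, truth (upd2 th X Z) A >]
  end.

Definition valid (A : formula) : Prop := forall th, truth th A = true.

Definition valid_sequent (Gamma : seq formula) : Prop :=
  forall th, List.Exists (fun A => truth th A = true) Gamma.

Definition VarSet (V : nat -> nat -> Prop) : set par :=
  [set a | let: Par _ k X _ := a in V k X].

Definition VarOf (k X : nat) : set par := VarSet (fun k' X' => k' = k /\ X' = X).

Lemma VarSet_selfdual V : selfdual (VarSet V).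
Proof. by case. Qed.

(* The value of a closed term: the environment is irrelevant. *)
Definition cval (t : term) : nat := teval (fun _ => 0) t.

Definition and_game (G1 G2 : game) : game :=
  bigwedge [set j | j = NTH 1 \/ j = NTH 2]
    (fun j => if j is NTH 1 then G1 else G2).

Definition all_game (H : nat -> game) : game :=
  bigwedge [set j | exists m, j = NTH m]
    (fun j => if j is NTH m then H m else END (Won Opponent)).

Fixpoint height (A : formula) : nat :=
  match A with
  | FPred _ _ _ _ | FVar _ _ _ _ => 1
  | And A B | Or A B => (maxn (height A) (height B)).+1
  | All _ A | Ex _ A | All2 _ _ A | Ex2 _ _ A => (height A).+1
  end.

(* Recursion on a bound n of the height of A, since substitution and negation
   are not structural; the defining equations are the lemmas [interp_*]. *)
Fixpoint interp_rec (n : nat) (A : formula) : game :=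
  if n is n'.+1 then
    match A with
    | FPred s k p ts =>
        let v := p [tuple cval (ts i) | i < k] in
        END (Won (if (if s then v else ~~ v) then Proponent else Opponent))
    | FVar s k X ts => END (Open (Par s X [tuple cval (ts i) | i < k]))
    | And B C => and_game (interp_rec n' B) (interp_rec n' C)
    | All x B => all_game (fun m => interp_rec n' (subst x m B))
    | All2 k X B => forall_game (VarOf k X) [:: interp_rec n' B]
    | Or B C => gdual (and_game (interp_rec n' (neg B)) (interp_rec n' (neg C)))
    | Ex x B => gdual (all_game (fun m => interp_rec n' (subst x m (neg B))))
    | Ex2 k X B => gdual (forall_game (VarOf k X) [:: interp_rec n' (neg B)])
    end
  else END (Won Opponent).

Definition interp (A : formula) : game := interp_rec (height A) A.

Lemma height_neg A : height (neg A) = height A.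
Proof. by elim: A => //= [A -> B ->|A -> B ->|x A ->|x A ->|k X A ->|k X A ->]. Qed.

Lemma height_subst x n A : height (subst x n A) = height A.
Proof.
elim: A => //= [A -> B ->|A -> B ->|y A IH|y A IH|k X A ->|k X A ->] //;
  by case: ifP => // _; rewrite IH.
Qed.

Lemma interp_recE n A : height A <= n -> interp_rec n A = interp A.
Proof.
suff H m k B : height B <= m -> height B <= k -> interp_rec m B = interp_rec k B.
  by move=> h; apply: H.
elim: m k B => [|m IH] [|k] [s l p ts|s l X ts|B C|B C|x B|x B|l X B|l X B] //=;
  rewrite !ltnS ?geq_max.
- move=> /andP[b1 c1] /andP[b2 c2].
  by rewrite (IH k B) // (IH k C).
- move=> /andP[b1 c1] /andP[b2 c2].
  by rewrite (IH k (neg B)) ?height_neg // (IH k (neg C)) ?height_neg.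
- move=> h1 h2; congr all_game; apply: funext => i.
  by apply: IH; rewrite height_subst.
- move=> h1 h2; congr (gdual (all_game _)); apply: funext => i.
  by apply: IH; rewrite height_subst height_neg.
- by move=> h1 h2; rewrite (IH k B).
- by move=> h1 h2; rewrite (IH k (neg B)) ?height_neg.
Qed.

Lemma interp_FPred s k (p : prpred k) ts :
  interp (FPred s p ts) =
  END (Won (if truth (Env (fun _ => 0) (fun _ _ _ => false)) (FPred s p ts)
            then Proponent else Opponent)).
Proof. by []. Qed.

Lemma interp_FVar s k X (ts : 'I_k -> term) :
  interp (FVar s X ts) = END (Open (Par s X [tuple cval (ts i) | i < k])).
Proof. by []. Qed.

Lemma interp_And A B : interp (And A B) = and_game (interp A) (interp B).
Proof. by rewrite /interp /= !interp_recE ?leq_maxl ?leq_maxr. Qed.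

Lemma interp_All x A :
  interp (All x A) = all_game (fun m => interp (subst x m A)).
Proof.
by congr all_game; apply: funext => m; apply: interp_recE; rewrite height_subst.
Qed.

Lemma interp_All2 k X A :
  interp (All2 k X A) = forall_game (VarOf k X) [:: interp A].
Proof. by []. Qed.

Lemma interp_disjunctive A : disjunctive A -> interp A = gdual (interp (neg A)).
Proof. by case: A => // *; rewrite /interp /= ?height_neg. Qed.

Definition interp_sequent (Gamma : seq formula) : game :=
  forall_game (VarSet (fun k X => List.Exists (free2 k X) Gamma))
              [seq interp A | A <- Gamma].

(* When rho is undefined at an instance of X, nothing is required there. *)
Definition correspond (A : formula) (rho : assignment) (th : env) : Prop :=
  forall k X (h : k.-tuple nat), free2 k X A -> adom rho (Par true X h) ->
    (aval rho (Par true X h) = Proponent <-> env2 th X h = true).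

(* Main.v *)
(* A position of an interpreted formula is classified by a status (illegal, leaf
   with its label, or non-leaf with the player on turn and a legal move). The
   status of a position of a game [forall_game I L] is computed by a fold that
   remembers, for each local position, the initial game it comes from and its
   history there.

   If every valuation agreeing with v off I makes P win some initial game, P wins
   [forall_game I L] under v by a fair strategy: win at once by STOP or EM when
   possible, otherwise at stage k = <i, c> explore the i-th local position,
   trying its child with code c. In a lost play every parameter of I labelling a
   local leaf can be made false without contradiction, and the explored positions
   contain a winning strategy for O in every initial game. Conversely winning
   strategies for O in all initial games combine into one for O in [forall_game I L].
   By induction on the formula, truth coincides with the existence of a winning
   strategy for P, which gives determinacy.

   The fair strategy never looks at a valuation when all parameters are in I, and
   the statuses of the instances of a fixed formula are primitive recursive in the
   position and in the values of the first order variables; hence so is the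
   strategy. *)
Require Import Defs.
From Stdlib Require List.
From mathcomp Require Import all_boot.
From mathcomp Require Import boolp classical_sets.

Set Implicit Arguments.
Unset Strict Implicit.
Unset Printing Implicit Defensive.

(** * Pairing and the basic primitive recursive functions *)

(** The premise of the quantifier case names a winning initial game for each valuation separately,
    with no effective way to choose one. The fair strategy therefore chooses nothing: it explores
    all games in parallel, and the premise is applied afterwards, to a valuation read off the lost
    play. The contradiction arises from playing two strategies for one local game against each
    other. Determinacy of infinite games is never invoked: the truth value names the winner from the
    start. A local position may be explored many times, and O may reply differently each time. A
    strategy for O extracted from one play needs coherent replies, and its branches must be threads
    of that play; so each history is assigned one canonical occurrence, computed from stage numbers.
    Primitive recursiveness has to be uniform over the infinitely many instances of a first order
    quantifier. Substitution would create a new formula for each number; instead the formula stays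
    fixed, an environment carries the numbers, and a sign replaces negation. *)

Definition primrec1 (f : nat -> nat) := @primrec 1 (fun v => f (thead v)).

Lemma primrec_comp1 k (f : nat -> nat) (g : k.-tuple nat -> nat) :
  primrec1 f -> primrec g ->
  primrec (fun v => f (g v)).
Proof.
move=> hf hg.
have := @primrec_comp k 1 (fun v => f (thead v)) (fun=> g) hf (fun=> hg).
by apply: primrec_ext => v; rewrite /thead tnth_mktuple.
Qed.

Definition primrec2 (f : nat -> nat -> nat) :=
  @primrec 2 (fun v => f (tnth v ord0) (tnth v ord_max)).

Lemma primrec_comp2 k (f : nat -> nat -> nat) (g h : k.-tuple nat -> nat) :
  primrec2 f -> primrec g -> primrec h -> primrec (fun v => f (g v) (h v)).
Proof.
move=> hf hg hh.
have := @primrec_comp k 2 _ (fun i : 'I_2 => if i == ord0 then g else h) hf.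
move=> H; have {}H : primrec (fun v => f (tnth [tuple (if i == ord0 then g else h) v | i < 2] ord0)
   (tnth [tuple (if i == ord0 then g else h) v | i < 2] ord_max)).
  by apply: H => i; case: ifP.
by apply: primrec_ext H => v; rewrite !tnth_mktuple.
Qed.

Lemma primrec1_succ : primrec1 succn.
Proof. exact: primrec_succ. Qed.

Lemma primrec_const k c : @primrec k (fun=> c).
Proof.
elim: c => [|c IH]; first exact: primrec_zero.
exact: (primrec_comp1 primrec1_succ IH).
Qed.

Lemma primrec1_const c : primrec1 (fun=> c).
Proof. exact: primrec_const. Qed.

Lemma primrec_rec2 (a : nat -> nat) (g : 3.-tuple nat -> nat) :
  primrec1 a -> primrec g ->
  primrec2 (fun n x => nat_rect (fun=> nat) (a x) (fun i r => g [tuple i; r; x]) n).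
Proof.
move=> ha hg; have := primrec_rec ha hg.
apply: primrec_ext => v; case/tupleP: v => x v; case/tupleP: v => y v.
have -> : v = [tuple] by apply: tuple0.
rewrite theadE; set l := nat_rect _ _ _ _; rewrite [tnth _ ord0]/= [tnth _ _]/=.
rewrite /l; congr nat_rect.
apply: funext => i; apply: funext => r; congr g; exact: val_inj.
Qed.

Definition tri n := 'C(n.+1, 2).

Lemma triS n : tri n.+1 = tri n + n.+1.
Proof. by rewrite /tri binS bin1. Qed.

Lemma cpairE n m : cpair n m = tri (n + m) + m.
Proof. by []. Qed.

Lemma primrec1_id : primrec1 id.
Proof. exact: primrec_proj. Qed.

Lemma primrec2_addn : primrec2 addn.
Proof.
have := primrec_rec2 primrec1_id
  (primrec_comp1 primrec1_succ (primrec_proj (inord 1 : 'I_3))).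
apply: primrec_ext => v; elim: (tnth v ord0) => //= n ->.
by rewrite (tnth_nth 0) inordK.
Qed.

Lemma primrec2_swap f : primrec2 f -> primrec2 (fun x y => f y x).
Proof.
by move=> hf; apply: primrec_comp2 hf (primrec_proj _) (primrec_proj _).
Qed.

Lemma primrec2_muln : primrec2 muln.
Proof.
have := primrec_rec2 (primrec1_const 0)
  (primrec_comp2 primrec2_addn (primrec_proj (inord 2 : 'I_3))
                               (primrec_proj (inord 1 : 'I_3))).
apply: primrec_ext => v; elim: (tnth v ord0) => //= n ->.
by rewrite !(tnth_nth 0) !inordK //= mulSn.
Qed.

Lemma primrec1_pred : primrec1 predn.
Proof.
have h := primrec_rec2 (primrec1_const 0) (primrec_proj (inord 0 : 'I_3)).
have := primrec_comp2 h primrec1_id primrec1_id.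
by apply: primrec_ext => v; case: (thead v) => //= n; rewrite (tnth_nth 0) inordK.
Qed.

Lemma primrec2_subn : primrec2 subn.
Proof.
apply: (@primrec2_swap (fun n m => m - n)).
have := primrec_rec2 primrec1_id
  (primrec_comp1 primrec1_pred (primrec_proj (inord 1 : 'I_3))).
apply: primrec_ext => v; elim: (tnth v ord0) => /= [|n ->]; first by rewrite subn0.
by rewrite (tnth_nth 0) inordK //= subnS.
Qed.

Lemma primrec2_leq : primrec2 (fun m n => m <= n).
Proof.
have := primrec_comp2 primrec2_subn (primrec_const 2 1) primrec2_subn.
by apply: primrec_ext => v; rewrite /leq; case: (tnth v ord0 - tnth v ord_max).
Qed.

Lemma primrec1_tri : primrec1 tri.
Proof.
have h := primrec_rec2 (primrec1_const 0)
  (primrec_comp2 primrec2_addn (primrec_proj (inord 1 : 'I_3))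
     (primrec_comp1 primrec1_succ (primrec_proj (inord 0 : 'I_3)))).
have := primrec_comp2 h primrec1_id primrec1_id.
apply: primrec_ext => v.
transitivity (nat_rect (fun=> nat) 0 (fun i r => r + i.+1) (thead v)); last first.
  by elim: (thead v) => //= n ->; rewrite triS.
congr nat_rect; apply: funext => i; apply: funext => r.
by rewrite !(tnth_nth 0) !inordK.
Qed.

Lemma primrec2_cpair : primrec2 cpair.
Proof.
exact: primrec_comp2 primrec2_addn (primrec_comp1 primrec1_tri primrec2_addn)
  (primrec_proj _).
Qed.

(* The antidiagonal n + m of the pair coded by c. *)
Definition diag (c : nat) : nat :=
  nat_rect (fun=> nat) 0 (fun i r => r + (tri r.+1 <= i.+1)) c.

Definition unpair1 c := diag c - (c - tri (diag c)).
Definition unpair2 c := c - tri (diag c).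

Lemma primrec1_diag : primrec1 diag.
Proof.
have hS (i : 'I_3) := primrec_comp1 primrec1_succ (primrec_proj i).
have h := primrec_rec2 (primrec1_const 0)
  (primrec_comp2 primrec2_addn (primrec_proj (inord 1 : 'I_3))
     (primrec_comp2 primrec2_leq
        (primrec_comp1 primrec1_tri (hS (inord 1))) (hS (inord 0)))).
have := primrec_comp2 h primrec1_id primrec1_id.
apply: primrec_ext => v; rewrite /diag; congr nat_rect.
apply: funext => i; apply: funext => r.
by rewrite !(tnth_nth 0) !inordK.
Qed.

Lemma primrec1_unpair1 : primrec1 unpair1.
Proof.
apply: primrec_comp2 primrec2_subn primrec1_diag _.
apply: primrec_comp2 primrec2_subn primrec1_id _.
exact: primrec_comp1 primrec1_tri primrec1_diag.
Qed.

Lemma primrec1_unpair2 : primrec1 unpair2.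
Proof.
apply: primrec_comp2 primrec2_subn primrec1_id _.
exact: primrec_comp1 primrec1_tri primrec1_diag.
Qed.

(** One increment per step suffices: consecutive triangular numbers differ by at least one, so if
    [c.+1] reaches the next one, it equals it. *)
Lemma diag_bounds c : tri (diag c) <= c < tri (diag c).+1.
Proof.
elim: c => // c; rewrite [diag c.+1]/= -/(diag c).
move: (diag c) => d /andP[h1 h2].
have [h|h] := leqP (tri d.+1) c.+1; rewrite ?addn1 ?addn0.
  have <- : tri d.+1 = c.+1 by apply/eqP; rewrite eqn_leq h.
  by rewrite leqnn (triS d.+1) -[ltnLHS]addn0 ltn_add2l.
by rewrite h andbT leqW.
Qed.

Lemma unpairK c : cpair (unpair1 c) (unpair2 c) = c.
Proof.
have /andP[h1 h2] := diag_bounds c.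
have h3 : c - tri (diag c) <= diag c.
  by rewrite leq_subLR -ltnS -addnS -triS.
by rewrite cpairE /unpair1 /unpair2 subnK // subnKC.
Qed.

Lemma unpair1K n m : unpair1 (cpair n m) = n.
Proof. by have [] := cpair_inj (unpairK (cpair n m)). Qed.

Lemma unpair2K n m : unpair2 (cpair n m) = m.
Proof. by have [] := cpair_inj (unpairK (cpair n m)). Qed.

Lemma leq_cpair_l n m : n <= cpair n m.
Proof.
rewrite cpairE; apply: (leq_trans _ (leq_addr _ _)).
elim: n => // n IH; rewrite addSn triS.
by rewrite -addn1 leq_add.
Qed.

Lemma leq_cpair_r n m : m <= cpair n m.
Proof. by rewrite cpairE leq_addl. Qed.

(** * Primitive recursion on coded data *)

Lemma primrec1_comp f g : primrec1 f -> primrec1 g -> primrec1 (fun x => f (g x)).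
Proof. exact: primrec_comp1. Qed.

Lemma primrec1_comp2 f g h : primrec2 f -> primrec1 g -> primrec1 h ->
  primrec1 (fun x => f (g x) (h x)).
Proof. exact: primrec_comp2. Qed.

(** Case analysis becomes arithmetic: [1 <= b x] is 0 or 1, and the value is a sum of two products
    of which one vanishes. *)
Lemma primrec1_if (b f g : nat -> nat) : primrec1 b -> primrec1 f -> primrec1 g ->
  primrec1 (fun x => if b x is 0 then f x else g x).
Proof.
move=> hb hf hg.
have pos : primrec1 (fun x => 1 <= b x).
  exact: primrec1_comp2 primrec2_leq (primrec1_const 1) hb.
have := primrec1_comp2 primrec2_addn (primrec1_comp2 primrec2_muln pos hg)
  (primrec1_comp2 primrec2_muln (primrec1_comp2 primrec2_subn (primrec1_const 1) pos) hf).
apply: primrec_ext => v; case: (b _) => [|n]; first by rewrite mul0n mul1n.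
by rewrite mul1n mul0n addn0.
Qed.

(** Counter and parameter are packed into one number, and so are the three arguments of the step, so
    that everything from here on is unary. *)
Lemma primrec1_rec (a g : nat -> nat) : primrec1 a -> primrec1 g ->
  primrec1 (fun x => nat_rect (fun=> nat) (a (unpair2 x))
    (fun i r => g (cpair i (cpair r (unpair2 x)))) (unpair1 x)).
Proof.
move=> ha hg.
have h := primrec_rec2 ha (primrec_comp1 hg
   (primrec_comp2 primrec2_cpair (primrec_proj (inord 0 : 'I_3))
     (primrec_comp2 primrec2_cpair (primrec_proj (inord 1 : 'I_3))
        (primrec_proj (inord 2 : 'I_3))))).
have := primrec1_comp2 h primrec1_unpair1 primrec1_unpair2.
apply: primrec_ext => v; congr nat_rect.
apply: funext => i; apply: funext => r.
by rewrite !(tnth_nth 0) !inordK.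
Qed.

Class coded (T : Type) := code : T -> nat.

#[export] Instance coded_nat : coded nat := id.
#[export] Instance coded_bool : coded bool := nat_of_bool.
#[export] Instance coded_pair S T {cS : coded S} {cT : coded T} : coded (S * T) :=
  fun x => cpair (code x.1) (code x.2).

Fixpoint code_seq T {cT : coded T} (l : seq T) : nat :=
  if l is x :: l' then (cpair (code x) (code_seq l')).+1 else 0.

#[export] Instance coded_seq T {cT : coded T} : coded (seq T) := @code_seq T cT.
#[export] Instance coded_move : coded move := code_move.

Lemma code_seq_move (p : seq move) : code p = code_list p.
Proof. by elim: p => //= m p <-. Qed.

(** The behaviour of [g] off the codes is free, so a coding need not be onto and being a code never
    has to be decided. *)
Definition pr S T {cS : coded S} {cT : coded T} (f : S -> T) : Prop :=
  exists2 g, primrec1 g & forall x, g (code x) = code (f x).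

Section Pr.
Context {S : Type} {cS : coded S}.

Lemma pr_id : pr (fun s : S => s).
Proof. by exists id; first exact: primrec1_id. Qed.

Lemma pr_const T {cT : coded T} (t : T) : pr (fun s : S => t).
Proof. by exists (fun=> code t); first exact: primrec1_const. Qed.

Lemma pr_comp T U {cT : coded T} {cU : coded U} (f : T -> U) (g : S -> T) :
  pr f -> pr g -> pr (fun s => f (g s)).
Proof.
move=> [f' hf ef] [g' hg eg]; exists (fun x => f' (g' x)).
  exact: primrec1_comp.
by move=> x; rewrite eg ef.
Qed.

Lemma pr_pair T U {cT : coded T} {cU : coded U} (f : S -> T) (g : S -> U) :
  pr f -> pr g -> pr (fun s => (f s, g s)).
Proof.
move=> [f' hf ef] [g' hg eg]; exists (fun x => cpair (f' x) (g' x)).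
  exact: primrec1_comp2 primrec2_cpair hf hg.
by move=> x; rewrite eg ef.
Qed.

Lemma pr_fst T U {cT : coded T} {cU : coded U} (f : S -> T * U) :
  pr f -> pr (fun s => (f s).1).
Proof.
move=> [f' hf ef]; exists (fun x => unpair1 (f' x)).
  exact: primrec1_comp primrec1_unpair1 hf.
by move=> x; rewrite ef unpair1K.
Qed.

Lemma pr_snd T U {cT : coded T} {cU : coded U} (f : S -> T * U) :
  pr f -> pr (fun s => (f s).2).
Proof.
move=> [f' hf ef]; exists (fun x => unpair2 (f' x)).
  exact: primrec1_comp primrec1_unpair2 hf.
by move=> x; rewrite ef unpair2K.
Qed.

Lemma pr_comp2 A B T {cA : coded A} {cB : coded B} {cT : coded T}
  (op : A -> B -> T) (f : S -> A) (g : S -> B) :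
  pr (fun y : A * B => op y.1 y.2) -> pr f -> pr g -> pr (fun s => op (f s) (g s)).
Proof. by move=> hop hf hg; exact: (pr_comp hop (pr_pair hf hg)). Qed.

Lemma pr_comp3 A B C T {cA : coded A} {cB : coded B} {cC : coded C} {cT : coded T}
  (op : A -> B -> C -> T) (f : S -> A) (g : S -> B) (h : S -> C) :
  pr (fun y : A * B * C => op y.1.1 y.1.2 y.2) -> pr f -> pr g -> pr h ->
  pr (fun s => op (f s) (g s) (h s)).
Proof. by move=> hop hf hg hh; exact: (pr_comp hop (pr_pair (pr_pair hf hg) hh)). Qed.

(** A change of type that keeps the code is free. This turns a constructor into the tuple that
    encodes it, and back. *)
Lemma pr_code T U {cT : coded T} {cU : coded U} (f : S -> T) (g : S -> U) :
  (forall s, code (f s) = code (g s)) -> pr f -> pr g.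
Proof. by move=> e [f' hf ef]; exists f' => // x; rewrite ef. Qed.

Lemma pr_ext T {cT : coded T} (f g : S -> T) : (forall s, f s = g s) -> pr f -> pr g.
Proof. by move=> e; apply: pr_code => s; rewrite e. Qed.

Lemma pr_if T {cT : coded T} (b : S -> bool) (f g : S -> T) :
  pr b -> pr f -> pr g -> pr (fun s => if b s then f s else g s).
Proof.
move=> [b' hb eb] [f' hf ef] [g' hg eg].
exists (fun x => if b' x is 0 then g' x else f' x); first exact: primrec1_if.
by move=> x; rewrite eb eg ef; case: (b x).
Qed.

Lemma pr_op2 (op : nat -> nat -> nat) (f g : S -> nat) :
  primrec2 op -> pr f -> pr g -> pr (fun s => op (f s) (g s)).
Proof.
move=> hop [f' hf ef] [g' hg eg]; exists (fun x => op (f' x) (g' x)).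
  exact: primrec1_comp2.
by move=> x; rewrite ef eg.
Qed.

Lemma pr_primrec1 (op : nat -> nat) (f : S -> nat) :
  primrec1 op -> pr f -> pr (fun s => op (f s)).
Proof.
move=> hop [f' hf ef]; exists (fun x => op (f' x)); first exact: primrec1_comp.
by move=> x; rewrite ef.
Qed.

Lemma pr_succ (f : S -> nat) : pr f -> pr (fun s => (f s).+1).
Proof. exact: pr_primrec1 primrec1_succ. Qed.

Lemma pr_subn (f g : S -> nat) : pr f -> pr g -> pr (fun s => f s - g s).
Proof. exact: pr_op2 primrec2_subn. Qed.

Lemma pr_addn (f g : S -> nat) : pr f -> pr g -> pr (fun s => f s + g s).
Proof. exact: pr_op2 primrec2_addn. Qed.

Lemma pr_leq (f g : S -> nat) : pr f -> pr g -> pr (fun s => f s <= g s).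
Proof.
move=> hf hg; apply: pr_code (pr_op2 primrec2_leq hf hg).
by move=> s.
Qed.

Lemma pr_and (b c : S -> bool) : pr b -> pr c -> pr (fun s => b s && c s).
Proof. by move=> hb hc; apply: pr_if => //; apply: pr_const. Qed.

Lemma pr_not (b : S -> bool) : pr b -> pr (fun s => ~~ b s).
Proof. by move=> hb; apply: (@pr_if _ _ b (fun=> false)) => //; apply: pr_const. Qed.

Lemma pr_eqn (f g : S -> nat) : pr f -> pr g -> pr (fun s => f s == g s).
Proof.
move=> hf hg; apply: pr_ext (pr_and (pr_leq hf hg) (pr_leq hg hf)).
by move=> s; rewrite eqn_leq.
Qed.

Lemma pr_codeE T {cT : coded T} (f : S -> T) : pr f -> pr (fun s => code (f s)).
Proof. exact: pr_code. Qed.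

Lemma pr_nat_case T {cT : coded T} (n : S -> nat) (a : S -> T) (b : S -> nat -> T) :
  pr n -> pr a -> pr (fun y : S * nat => b y.1 y.2) ->
  pr (fun s => if n s is i.+1 then b s i else a s).
Proof.
move=> [n' hn en] [a' ha ea] [b' hb eb].
exists (fun x => if n' x is 0 then a' x else b' (cpair x (n' x).-1)).
  apply: primrec1_if => //; apply: primrec1_comp => //.
  apply: primrec1_comp2 primrec2_cpair primrec1_id _.
  exact: primrec1_comp primrec1_pred hn.
move=> x; rewrite en ea; case: (n x) => //= i.
exact: (eb (x, i)).
Qed.

(** A nonempty list is coded by the successor of a pair, so this is case analysis on a number
    followed by projections. *)
Lemma pr_list_case X T {cX : coded X} {cT : coded T} (l : S -> seq X)
  (a : S -> T) (b : S -> X -> seq X -> T) :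
  pr l -> pr a -> pr (fun y : S * (X * seq X) => b y.1 y.2.1 y.2.2) ->
  pr (fun s => if l s is x :: l' then b s x l' else a s).
Proof.
move=> [n' hn en] [a' ha ea] [b' hb eb].
exists (fun x => if n' x is 0 then a' x else b' (cpair x (n' x).-1)).
  apply: primrec1_if => //; apply: primrec1_comp => //.
  apply: primrec1_comp2 primrec2_cpair primrec1_id _.
  exact: primrec1_comp primrec1_pred hn.
move=> x; rewrite en ea; case: (l x) => //= i l'.
exact: (eb (x, (i, l'))).
Qed.

Lemma pr_iter T {cT : coded T} (n : S -> nat) (a : S -> T) (g : S -> T -> T) :
  pr n -> pr a -> pr (fun y : S * T => g y.1 y.2) ->
  pr (fun s => iter (n s) (g s) (a s)).
Proof.
move=> [n' hn en] [a' ha ea] [g' hg eg].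
have hstep : primrec1 (fun y => g' (cpair (unpair2 (unpair2 y)) (unpair1 (unpair2 y)))).
  apply: primrec1_comp hg _; apply: primrec1_comp2 primrec2_cpair _ _.
    exact: primrec1_comp primrec1_unpair2 primrec1_unpair2.
  exact: primrec1_comp primrec1_unpair1 primrec1_unpair2.
have hrec := primrec1_comp (primrec1_rec ha hstep)
  (primrec1_comp2 primrec2_cpair hn primrec1_id).
eexists; first exact: hrec.
move=> x /=; rewrite unpair1K unpair2K en ea.
have -> : code (n x) = n x by [].
elim: (n x) => //= i ->.
by rewrite unpair2K unpair2K unpair1K; apply: (eg (x, _)).
Qed.

End Pr.

Section PrList.
Context {S : Type} {cS : coded S}.

(** The step acts on the pair of the accumulator and the remaining list, and idles once the list is
    exhausted; hence it may be iterated [code (l s)] times, the code of a list being at least its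
    length. *)
Lemma pr_foldl X T {cX : coded X} {cT : coded T} (l : S -> seq X) (a : S -> T)
  (g : S -> T -> X -> T) :
  pr l -> pr a -> pr (fun y : S * T * X => g y.1.1 y.1.2 y.2) ->
  pr (fun s => foldl (g s) (a s) (l s)).
Proof.
move=> hl ha hg.
pose step s (st : T * seq X) :=
  if st.2 is x :: l' then (g s st.1 x, l') else (st.1, [::]).
have hstep : pr (fun y : S * (T * seq X) => step y.1 y.2).
  apply: pr_list_case.
  - exact: pr_snd (pr_snd pr_id).
  - by apply: pr_pair (pr_const _); exact: pr_fst (pr_snd pr_id).
  - apply: pr_pair; last exact: pr_snd (pr_snd pr_id).
    apply: pr_comp3 hg _ _ _; first exact: pr_fst (pr_fst pr_id).
      exact: pr_fst (pr_snd (pr_fst pr_id)).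
    exact: pr_fst (pr_snd pr_id).
have := pr_fst (pr_iter (pr_codeE hl) (pr_pair ha hl) hstep).
apply: pr_ext => s.
have: size (l s) <= code (l s).
  elim: (l s) => //= x l' IH; rewrite ltnS; apply: leq_trans IH _.
  exact: leq_cpair_r.
move: (code (l s)) => n.
suff H m (b : T) r : size r <= m -> (iter m (step s) (b, r)).1 = foldl (g s) b r by exact: H.
elim: m b r => [|m IH] b r; first by case: r.
rewrite iterSr; case: r => [|x r] /=; first by move=> _; rewrite IH.
by rewrite ltnS => /IH ->.
Qed.

Lemma pr_cons X {cX : coded X} (x : S -> X) (l : S -> seq X) :
  pr x -> pr l -> pr (fun s => x s :: l s).
Proof.
move=> hx hl.
exact: pr_code (pr_succ (pr_codeE (pr_pair hx hl))).
Qed.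

End PrList.

Section PrSeq.
Context {S : Type} {cS : coded S}.

Lemma pr_rev X {cX : coded X} (l : S -> seq X) : pr l -> pr (fun s => rev (l s)).
Proof.
move=> hl.
have hg : pr (fun y : S * seq X * X => y.2 :: y.1.2).
  apply: pr_cons; first exact: pr_snd pr_id.
  exact: pr_snd (pr_fst pr_id).
apply: pr_ext (pr_foldl (g := fun _ r x => x :: r) hl (pr_const [::]) hg) => s.
rewrite -[RHS]cats0 -catrevE; move: [::].
by elim: (l s) => //= x l' IH r; rewrite IH.
Qed.

Lemma pr_foldr X T {cX : coded X} {cT : coded T} (l : S -> seq X) (a : S -> T)
  (g : S -> X -> T -> T) :
  pr l -> pr a -> pr (fun y : S * X * T => g y.1.1 y.1.2 y.2) ->
  pr (fun s => foldr (g s) (a s) (l s)).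
Proof.
move=> hl ha hg.
apply: (@pr_ext _ _ _ _ (fun s => foldl (fun t x => g s x t) (a s) (rev (l s)))).
  by move=> s; rewrite foldl_rev.
apply: (pr_foldl (g := fun s t x => g s x t)) (pr_rev hl) ha _.
apply: pr_comp3 hg _ _ _; first exact: pr_fst (pr_fst pr_id).
  exact: pr_snd pr_id.
exact: pr_snd (pr_fst pr_id).
Qed.

Lemma pr_cat X {cX : coded X} (l r : S -> seq X) :
  pr l -> pr r -> pr (fun s => l s ++ r s).
Proof.
move=> hl hr.
apply: (@pr_ext _ _ _ _ (fun s => foldr cons (r s) (l s))).
  by move=> s; elim: (l s) => //= x l' ->.
apply: (pr_foldr (g := fun _ => cons)) hl hr _.
by apply: pr_cons; [exact: pr_snd (pr_fst pr_id) | exact: pr_snd pr_id].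
Qed.

Lemma pr_rcons X {cX : coded X} (l : S -> seq X) (x : S -> X) :
  pr l -> pr x -> pr (fun s => rcons (l s) (x s)).
Proof.
move=> hl hx; apply: pr_ext (pr_cat hl (pr_cons hx (pr_const [::]))).
by move=> s; rewrite cats1.
Qed.

Lemma pr_find X {cX : coded X} (b : S -> X -> bool) (l : S -> seq X) :
  pr (fun y : S * X => b y.1 y.2) -> pr l -> pr (fun s => find (b s) (l s)).
Proof.
move=> hb hl.
apply: (@pr_ext _ _ _ _ (fun s => foldr (fun x n => if b s x then 0 else n.+1) 0 (l s))).
  by move=> s; elim: (l s) => //= x l' ->.
apply: (pr_foldr (g := fun s x n => if b s x then 0 else n.+1)) hl (pr_const 0) _.
apply: pr_if (pr_const _) (pr_succ (pr_snd pr_id)).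
exact: (pr_comp hb (pr_fst pr_id)).
Qed.

Lemma pr_size X {cX : coded X} (l : S -> seq X) : pr l -> pr (fun s => size (l s)).
Proof.
move=> hl; apply: pr_ext (pr_find (b := fun _ _ => false) (pr_const _) hl).
by move=> s; rewrite hasNfind ?has_pred0.
Qed.

Lemma pr_has X {cX : coded X} (b : S -> X -> bool) (l : S -> seq X) :
  pr (fun y : S * X => b y.1 y.2) -> pr l -> pr (fun s => has (b s) (l s)).
Proof.
move=> hb hl; apply: pr_ext (pr_leq (pr_succ (pr_find hb hl)) (pr_size hl)).
by move=> s; rewrite has_find.
Qed.

Lemma pr_nth X {cX : coded X} (x0 : X) (l : S -> seq X) (n : S -> nat) :
  pr l -> pr n -> pr (fun s => nth x0 (l s) (n s)).
Proof.
move=> hl hn.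
have hd : pr (fun y : S * seq X => behead y.2).
  apply: (@pr_ext _ _ _ _ (fun y => if y.2 is x :: l then l else [::])).
    by move=> [s []].
  apply: pr_list_case; first exact: pr_snd pr_id.
    exact: pr_const.
  exact: pr_snd (pr_snd pr_id).
have hit := pr_iter (g := fun=> behead) hn hl hd.
apply: pr_ext (pr_list_case (b := fun _ x _ => x) hit (pr_const x0)
  (pr_fst (pr_snd pr_id))) => s.
by elim: (n s) (l s) => [|m IH] [|x r] //=; rewrite -iterS iterSr //= IH // nth_nil.
Qed.

(** The list [r] is fixed, so the induction takes place outside the coded world, and nothing uniform
    is asked of the functions attached to its members. *)
Lemma pr_map_const I X {cX : coded X} (r : seq I) (f : S -> I -> X) :
  (forall i, pr (fun s => f s i)) -> pr (fun s => map (f s) r).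
Proof.
move=> hf; elim: r => [|i r IH] /=; first exact: pr_const.
exact: pr_cons.
Qed.

Lemma pr_primrec k (f : k.-tuple nat -> nat) (g : S -> 'I_k -> nat) :
  primrec f -> (forall i, pr (fun s => g s i)) ->
  pr (fun s => f [tuple g s i | i < k]).
Proof.
move=> hf hg.
(* The unary functions exist index by index; choice collects them into the family that composition
   expects. *)
have [g' hg'] : exists g', forall i, primrec1 (g' i) /\ forall s, g' i (code s) = g s i.
  have /choice[g' hg'] i : exists a, primrec1 a /\ forall s, a (code s) = g s i.
    by have [a ha ea] := hg i; exists a.
  by exists g'.
exists (fun x => f [tuple g' i x | i < k]).
  exact: (primrec_comp hf (g := fun i v => g' i (thead v)) (fun i => (hg' i).1)).
move=> s; congr (code (f _)); apply: eq_from_tnth => i.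
by rewrite !tnth_mktuple; case: (hg' i) => _ ->.
Qed.

Lemma pr_prpred k (p : prpred k) (g : S -> 'I_k -> nat) :
  (forall i, pr (fun s => g s i)) -> pr (fun s => p [tuple g s i | i < k]).
Proof. by move=> hg; apply: pr_code (pr_primrec (prpP p) hg). Qed.

End PrSeq.

#[export] Instance coded_player : coded player :=
  fun g => if g is Proponent then 0 else 1.
#[export] Instance coded_par : coded par :=
  fun a => let: Par s k X h := a in code (s, (k, (X, tval h))).
#[export] Instance coded_label : coded label :=
  fun x => match x with Won g => code (0, code g) | Open a => code (1, code a) end.

Lemma code_seq_inj T {cT : coded T} : injective (@code T cT) -> injective (@code_seq T cT).
Proof.
move=> inj; elim=> [|x l IH] [|y r] //= [] /cpair_inj[ex el].
by rewrite (inj _ _ ex) (IH _ el).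
Qed.

(** Parameters carry a tuple of dependent length and are compared through their codes, as in
    [em_ok]; injectivity makes that test exact. *)
Lemma code_par_inj : injective (@code par _).
Proof.
case=> s k X h [s' k' X' h'] /cpair_inj[/= es] /cpair_inj[/= ek] /cpair_inj[/= eX eh].
have {}ek : k = k' := ek; have {}eX : X = X' := eX.
have {}es : s = s' by case: s s' es => [] [].
subst.
have -> // : h = h' by apply: val_inj; apply: code_seq_inj eh.
Qed.

(** * Statuses of positions *)

Lemma pdualK : involutive pdual. Proof. by case. Qed.
Lemma pardualK : involutive pardual.
Proof. by case=> s k X h; rewrite /= negbK. Qed.
Lemma ldualK : involutive ldual.
Proof. by case=> [g|a]; rewrite /= ?pdualK ?pardualK. Qed.

(* A position of a game is described by a status: illegal, a leaf with its
   label, or a non-leaf with the player on turn and one of the legal moves. *)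
Inductive status := Bad | Leaf of label | Node of player & move.

Definition is_bad (st : status) : bool := if st is Bad then true else false.

(** Being a leaf quantifies over all moves. The legal move stored in a [Node] certifies that the
    position is not a leaf and gives strategies a move to fall back on. *)
Definition describes (St : seq move -> status) (G : game) : Prop :=
  forall p, match St p with
  | Bad => ~ supp G p
  | Leaf x => leaf G p /\ win G p = x
  | Node g m => [/\ supp G p, supp G (rcons p m) & turn G p = g]
  end.

Section Describes.
Variables (St : seq move -> status) (G : game).
Hypothesis desc : describes St G.

Lemma describes_supp p : supp G p <-> ~~ is_bad (St p).
Proof.
by move: (desc p); case: (St p) => [|x [[] ]|g m []] /=; split.
Qed.

Lemma describes_leaf p x : St p = Leaf x -> leaf G p /\ win G p = x.
Proof. by move: (desc p) => /[swap] ->. Qed.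

Lemma describes_node p g m : St p = Node g m ->
  [/\ supp G p, supp G (rcons p m) & turn G p = g].
Proof. by move: (desc p) => /[swap] ->. Qed.

Lemma describes_leafE p : leaf G p <-> exists x, St p = Leaf x.
Proof.
split=> [|[x /describes_leaf[]] //] [hp hm].
move: (desc p); case: (St p) => [//|x _|g m []]; first by exists x.
by move=> _ /hm.
Qed.

Lemma describes_nodeE p : supp G p /\ ~ leaf G p <-> exists g m, St p = Node g m.
Proof.
split=> [[/describes_supp hp hl]|[g [m e]]].
  case e : (St p) hp => [|x|g m] // _; last by exists g, m.
  by case: hl; apply/describes_leafE; exists x.
have [h1 h2 _] := describes_node e; split=> // -[_ hl]; exact: hl h2.
Qed.

Lemma supp_nil_eq : (forall m, ~ supp G [:: m]) -> forall p, supp G p <-> p = [::].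
Proof.
move=> h [|m p]; first by split=> // _; exact: tree_nil.
by split=> // /(@tree_prefix _ [:: m] p) /h.
Qed.

Lemma atomicE : atomic G <-> exists x, St [::] = Leaf x.
Proof.
split=> [hG|[x /describes_leaf[[_ h] _]]]; last exact: supp_nil_eq.
apply/describes_leafE; split=> [|m]; first exact: tree_nil.
by rewrite hG.
Qed.

Lemma game_eq_END x : game_eq G (END x) <-> St [::] = Leaf x.
Proof.
split=> [[h1 h2 h3 h4]|e].
  have hl : leaf G [::].
    by split=> [|m]; [exact: tree_nil | rewrite h1].
  have /describes_leafE[y ey] := hl; rewrite ey; congr Leaf.
  by have [_ <-] := describes_leaf ey; rewrite h3.
have hat : forall p, supp G p <-> p = [::] by apply/atomicE; exists x.
have [hl hw] := describes_leaf e.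
split=> //.
- by move=> p /hat -> [].
- by move=> p [/hat -> _].
- by move=> b /(_ 1) /hat.
Qed.

Lemma describes_subgame m : supp G [:: m] ->
  describes (fun r => St (m :: r)) (subgame G [:: m]).
Proof.
move=> hm p.
have es q : supp (subgame G [:: m]) q <-> supp G (m :: q).
  by split=> [[->|]|]; [ | | right].
case e : (St (m :: p)) => [|x|g m'].
- by rewrite es; apply/describes_supp; rewrite e.
- have [[h1 h2] h3] := describes_leaf e; split=> //; split=> [|m']; first exact/es.
  by move/es/h2.
- have [h1 h2 h3] := describes_node e.
  by split=> //; exact/es.
Qed.

End Describes.

Lemma describes_ext St St' G : St =1 St' -> describes St G -> describes St' G.
Proof. by move=> e h p; rewrite -e; exact: h. Qed.

Lemma describes_END x :
  describes (fun p => if p is [::] then Leaf x else Bad) (END x).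
Proof. by case=> [|m p]. Qed.

Definition sdual (st : status) : status :=
  match st with Bad => Bad | Leaf x => Leaf (ldual x) | Node g m => Node (pdual g) m end.

Lemma describes_gdual St G : describes St G ->
  describes (fun p => sdual (St p)) (gdual G).
Proof.
move=> h p; have := h p; case: (St p) => [|x|g m] //=.
- by case=> h1 <-.
- by case=> h1 h2 <-.
Qed.

Lemma describes_bigwedge (K : set move) H (kb : pred move) St m0 :
  (forall j, kb j <-> K j) -> K m0 ->
  (forall j, K j -> describes (St j) (H j)) ->
  describes (fun p => if p is j :: q then if kb j then St j q else Bad
                      else Node Opponent m0) (bigwedge K H).
Proof.
move=> hK K0 hSt [|j q] /=.
  by split=> //; split=> //; exact: tree_nil.
case: ifPn => hj; last by case=> /hK; rewrite (negPf hj).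
have {}hj : K j by apply/hK.
have es r : supp (bigwedge K H) (j :: r) <-> supp (H j) r.
  by split=> [[]|].
have := hSt j hj q; case: (St j q) => [|x|g m].
- by move=> h /es.
- case=> -[h1 h2] <-; split; last by rewrite /= ldualK.
  by split=> [|m]; [exact/es | move/es/h2].
- case=> h1 h2 <-; split; [exact/es|exact/es|].
  by rewrite /= pdualK.
Qed.

Definition and_st S1 S2 (p : seq move) : status :=
  match p with
  | [::] => Node Opponent (NTH 1)
  | NTH 1 :: q => S1 q
  | NTH 2 :: q => S2 q
  | _ => Bad
  end.

Definition all_st (S : nat -> seq move -> status) (p : seq move) : status :=
  match p with
  | [::] => Node Opponent (NTH 1)
  | NTH m :: q => S m q
  | _ => Bad
  end.

Lemma describes_and S1 S2 G1 G2 : describes S1 G1 -> describes S2 G2 ->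
  describes (and_st S1 S2) (and_game G1 G2).
Proof.
move=> h1 h2.
pose kb m := match m with NTH 1 | NTH 2 => true | _ => false end.
pose St m := if m is NTH 1 then S1 else S2.
apply: (describes_ext _ (describes_bigwedge (kb := kb) (St := St) (m0 := NTH 1) _ _ _)).
- by case=> [|[| | | |[|[|[|j]]]] q].
- case=> [?|? ?|?|? ?|[|[|[|j]]]]; split=> //=; try (by case); by [left|right].
- by left.
- by move=> j [->|->].
Qed.

Lemma describes_all S H : (forall m, describes (S m) (H m)) ->
  describes (all_st S) (all_game H).
Proof.
move=> h.
pose kb m := if m is NTH _ then true else false.
pose St m := if m is NTH k then S k else fun=> Bad.
apply: (describes_ext _ (describes_bigwedge (kb := kb) (St := St) (m0 := NTH 1) _ _ _)).
- by case=> [|[| | | |m] q].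
- by move=> j; split=> [|[m ->]//]; case: j => // m; exists m.
- by exists 1.
- by move=> j [m ->]; exact: h.
Qed.

(** * Positions of quantified games as states of a fold *)

Section ForallStatus.
Variables (inI : par -> bool) (St : nat -> seq move -> status) (n : nat).

(* A local position is named by the initial game it comes from and by its
   position in that game. *)
Notation hist := (nat * seq move)%type.

Definition lst (h : hist) : status := St h.1 h.2.
Definition ext (h : hist) (m : move) : hist := (h.1, rcons h.2 m).
Definition h0 : hist := (0, [::]).

Definition em_ok (h h' : hist) : bool :=
  match lst h, lst h' with
  | Leaf (Open a), Leaf (Open b) => inI a && (code b == code (pardual a))
  | _, _ => false
  end.

Definition stoppable (x : label) : bool := if x is Open a then ~~ inI a else true.

(* The local positions; 0, or i.+1 after a pending move [JUST i _]; the status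
   of the current position. *)
Definition fstate := (seq hist * nat * status)%type.

Definition mainst (hs : seq hist) : fstate :=
  (hs, 0, Node Proponent (DROP (size hs))).
Definition deadst (hs : seq hist) : fstate := (hs, 0, Bad).

(** After [JUST i _] the turn and the stored move are those of the [i]-th local position: its first
    player is the one to move next. A local position is non-atomic exactly when its status is a
    [Node]. *)
Definition main_step (hs : seq hist) (m : move) : fstate :=
  match m with
  | DROP d => if d == size hs then (hs, 0, Leaf (Won Opponent)) else deadst hs
  | Defs.EM i j =>
      if (i < size hs) && ((j < size hs) && em_ok (nth h0 hs i) (nth h0 hs j))
      then (hs, 0, Leaf (Won Proponent)) else deadst hs
  | STOP i =>
      if i < size hs then
        match lst (nth h0 hs i) with
        | Bad => deadst hs
        | Leaf x => if stoppable x then (hs, 0, Leaf x) else deadst hs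
        | Node _ _ => deadst hs
        end
      else deadst hs
  | JUST i d =>
      if (i < size hs) && (d == size hs) then
        match lst (nth h0 hs i) with
        | Bad => deadst hs
        | Leaf _ => deadst hs
        | Node g m => (hs, i.+1, Node g m)
        end
      else deadst hs
  | NTH _ => deadst hs
  end.

Definition just_step (hs : seq hist) (i : nat) (m : move) : fstate :=
  if is_bad (lst (ext (nth h0 hs i) m)) then deadst hs
  else mainst (rcons hs (ext (nth h0 hs i) m)).

Definition fstep (s : fstate) (m : move) : fstate :=
  match s.2 with
  | Bad => deadst s.1.1
  | Leaf _ => deadst s.1.1
  | Node _ _ => if s.1.2 is i.+1 then just_step s.1.1 i m else main_step s.1.1 m
  end.

Definition inits : seq hist := [seq (i, [::]) | i <- iota 0 n].

Definition frun (p : seq move) : fstate := foldl fstep (mainst inits) p.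

Definition forall_st (p : seq move) : status := (frun p).2.

Lemma size_inits : size inits = n.
Proof. by rewrite size_map size_iota. Qed.

Lemma nth_inits i : i < n -> nth h0 inits i = (i, [::]).
Proof. by move=> h; rewrite (nth_map 0) ?size_iota // nth_iota. Qed.

Lemma frun_rcons p m : frun (rcons p m) = fstep (frun p) m.
Proof. by rewrite /frun foldl_rcons. Qed.

(** Accounts for the clauses [p' = [::]] of [forall_mem]: a move after the end of the play is
    illegal, and illegality persists. *)
Lemma foldl_dead s p : ~ (exists g m, s.2 = Node g m) -> p <> [::] ->
  is_bad (foldl fstep s p).2.
Proof.
case: p => // m p h _ /=.
have : is_bad (fstep s m).2.
  by rewrite /fstep; case: (s.2) h => //= g k []; exists g, k.
move: (fstep s m) => {h}s.
elim: p s => //= m' p IH s hs; apply: IH.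
by rewrite /fstep; case: (s.2) hs.
Qed.

(** The last clause ties the stored status to the pending index; it is what makes the recorded move
    legal, and [DROP] is legal whenever no local move is pending. *)
Definition wf (s : fstate) : Prop :=
  [/\ forall i, i < size s.1.1 -> (nth h0 s.1.1 i).1 < n,
      forall i, i < size s.1.1 -> ~~ is_bad (lst (nth h0 s.1.1 i)) &
      match s.2 with
      | Node g m =>
          if s.1.2 is i.+1 then i < size s.1.1 /\ lst (nth h0 s.1.1 i) = Node g m
          else g = Proponent /\ m = DROP (size s.1.1)
      | _ => s.1.2 = 0
      end].

Hypothesis St_nil : forall i, i < n -> ~~ is_bad (St i [::]).

Lemma wf_init : wf (mainst inits).
Proof. by split=> //= i; rewrite size_inits => hi; rewrite nth_inits //= St_nil. Qed.

Lemma wf_step s m : wf s -> wf (fstep s m).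
Proof.
case: s => [[hs pd] st] [/= h1 h1' h2]; rewrite /fstep /=.
have hdead : wf (deadst hs) by [].
case: st h2 => [|x|g k] //; case: pd => [|i] [h2 h3].
  case: m => [d|i j|i|i d|j] //=.
  - by case: ifP.
  - by case: ifP.
  - case: ifP => // _; case: (lst _) => // x; by case: ifP.
  - case: ifP => // /andP[hi _]; case e : (lst _) => //.
rewrite /just_step; case: ifPn => //= hb; split=> //= j;
  rewrite size_rcons ltnS nth_rcons => hj; case: (ltngtP j (size hs)) hj => // hj _.
- exact: h1.
- exact: h1.
- exact: h1'.
Qed.

Lemma frun_wf p : wf (frun p).
Proof.
by elim/last_ind: p => [|p m IH]; [exact: wf_init | rewrite frun_rcons; exact: wf_step].
Qed.

End ForallStatus.

Section ForallDescribes.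
Variables (inI : par -> bool) (St : nat -> seq move -> status).
Variables (I : set par) (L0 : seq game).
Let n := size L0.
Hypothesis desc : forall i, i < n -> describes (St i) (local L0 i).
Hypothesis inIP : forall i q a, i < n -> St i q = Leaf (Open a) -> (inI a <-> I a).

Let F := FVs L0.
Notation step := (fstep inI St).
Notation lst := (lst St).

(** Supplies the side condition [F a] of the [STOP] clause: a parameter met at a leaf of an initial
    game is free in that game. *)
Lemma FVs_label i q a : i < n -> St i q = Leaf (Open a) -> F a.
Proof.
move=> hi e; have [hl hw] := describes_leaf (desc hi) e.
rewrite /F /FVs /mkset.
have : FV (local L0 i) a by move=> J _; apply; [exact: hl | exact: hw].
rewrite /local; move: hi {hl hw e}; rewrite /n.
elim: L0 i => // G L IH [|i] /= h1 h2; first by left.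
by right; exact: IH h1 h2.
Qed.

Definition matches (L : seq game) (hs : seq (nat * seq move)) : Prop :=
  size L = size hs /\ forall i, i < size hs ->
    (nth h0 hs i).1 < n /\
    describes (fun r => St (nth h0 hs i).1 ((nth h0 hs i).2 ++ r)) (local L i).

Lemma em_okP h h' : h.1 < n -> h'.1 < n -> em_ok inI St h h' <->
  exists a, [/\ I a, lst h = Leaf (Open a) & lst h' = Leaf (Open (pardual a))].
Proof.
move=> hn hn'; rewrite /em_ok; case e : (lst h) => [|[g|a]|g m].
- by split=> // -[a []].
- by split=> // -[a []].
- case e' : (lst h') => [|[g|b]|g m]; try by split=> // -[? []].
  have hI := inIP hn e; split=> [/andP[/hI Ia /eqP/code_par_inj ->]|]; first by exists a.
  by case=> _ [] /[swap] -[<-] /hI -> [->]; rewrite eqxx.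
- by split=> // -[a []].
Qed.

Lemma matches_rcons L hs i m : matches L hs -> i < size hs ->
  supp (local L i) [:: m] ->
  matches (rcons L (subgame (local L i) [:: m])) (rcons hs (ext (nth h0 hs i) m)).
Proof.
move=> [hs1 hs2] hi hm; split=> [|j]; first by rewrite !size_rcons hs1.
rewrite size_rcons ltnS /local !nth_rcons hs1 => hj.
case: (ltngtP j (size hs)) hj => // hj _; first exact: hs2.
have [h1 h2] := hs2 i hi; split=> //=.
apply: describes_ext (describes_subgame h2 hm) => r.
by rewrite cat_rcons.
Qed.

(** The recursions of [forall_mem], [forall_win] and [forall_turn] consume two moves at each [JUST]
    and change [L]; hence the induction on a bound of the length, with [L] and [hs] general. *)
Lemma foldl_fstep_sound p L hs : matches L hs ->
  let st := (foldl step (mainst hs) p).2 in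
  [/\ forall_mem I F L p <-> ~~ is_bad st,
      forall x, st = Leaf x -> forall_win L p = x &
      forall g m, st = Node g m -> forall_turn L p = g].
Proof.
have [k] := ubnP (size p); elim: k p L hs => // k IH [|m p] L hs hk hm.
  by split=> // g m /= [<-].
have [hs1 hs2] := hm.
have dead s P : ~ (exists g m, s.2 = Node g m) -> p <> [::] ->
    let st := (foldl step s p).2 in
    (p = [::] /\ P <-> ~~ is_bad st) /\
    (forall x, st <> Leaf x) /\ (forall g m, st <> Node g m).
  move=> h1 h2; have := @foldl_dead inI St s p h1 h2.
  by case: (foldl step s p).2 => //= _; split=> //; split=> // -[].
have deadb : let st := (foldl step (deadst hs) p).2 in st = Bad.
  have [->//|hp] := EM (p = [::]).
  have := @foldl_dead inI St (deadst hs) p _ hp.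
  by case: (foldl step (deadst hs) p).2 => //= [?|??] h; have /h : ~ (exists g m, Bad = Node g m) by case=> ? [].
rewrite [foldl _ _ _]/= {2}/fstep.
have lst0 i : i < size hs -> lst (nth h0 hs i) = St (nth h0 hs i).1 ((nth h0 hs i).2 ++ [::]).
  by rewrite cats0.
case: m hk => [d|i j|i|i d|j] hk.
- rewrite /main_step; case: eqP => hd; last first.
    by rewrite deadb /=; split=> //; split=> // -[_]; rewrite hs1.
  have [->|hp] := EM (p = [::]).
    by split=> //=; [split=> // _; rewrite hs1|move=> x []].
  have := dead _ (d = size L) _ hp; case/(_ (hs, 0, Leaf (Won Opponent)))=> [[g [m]]//|].
  by move=> h1 [h2 h3]; split=> // [x /h2|g m /h3].
- rewrite /main_step /=; case: ifPn => hc; last first.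
    rewrite deadb /=; split=> //; split=> // -[_ [hi hj [a [Ia ei ej]]]].
    rewrite hs1 in hi hj; have [hi1 hi2] := hs2 i hi; have [hj1 hj2] := hs2 j hj.
    case/negP: hc; rewrite hi hj /=; apply/(em_okP hi1 hj1); exists a.
    by split=> //; rewrite lst0 //; [apply/(game_eq_END hi2)|apply/(game_eq_END hj2)].
  have [ep|hp] := EM (p = [::]); last first.
    have [] := dead (hs, 0, Leaf (Won Proponent)) ([/\ i < size L, j < size L &
      exists a, [/\ I a, game_eq (local L i) (END (Open a)) &
                    game_eq (local L j) (END (Open (pardual a)))]]) _ hp.
      by case=> g [m].
    by move=> h1 [h2 h3]; split=> // [x /h2|g m /h3].
  rewrite ep; split=> //= [|x []//]; split=> // _; split=> //.
  have /and3P[hi hj] := hc.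
  have [hi1 hi2] := hs2 i hi; have [hj1 hj2] := hs2 j hj.
  case/(em_okP hi1 hj1) => a [Ia]; rewrite !lst0 // => ei ej.
  rewrite hs1; split=> //; exists a.
  by split=> //; [apply/(game_eq_END hi2)|apply/(game_eq_END hj2)].
- rewrite /main_step /=; case: (ltnP i (size hs)) => hi; last first.
    by rewrite deadb /=; split=> //; split=> // -[_ []]; rewrite hs1 ltnNge hi.
  have [hi1 hi2] := hs2 i hi.
  have bad x : ~ (lst (nth h0 hs i) = Leaf x /\ stoppable inI x) ->
     ~ (game_eq (local L i) (END x) /\
                match x with Won _ => True | Open a => F a /\ ~ I a end).
    move=> h [/(game_eq_END hi2)]; rewrite -lst0 // => e hx; apply: h; split=> //.
    case: x e hx => //= a e [_]; rewrite -(inIP hi1 e) => /negP //.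
  case e : (lst _) bad => [|x|g m] bad.
  + rewrite deadb; split=> //; split=> // -[_ [_ [x]]] /bad; case=> // -[]//.
  + case: ifPn => hx; last first.
      rewrite deadb; split=> //; split=> // -[_ [_ [y]]] /bad; case=> // -[[<-]].
      by rewrite (negPf hx).
    have [ep|hp] := EM (p = [::]); last first.
      have [] := dead (hs, 0, Leaf x) (i < size L /\
      exists x, game_eq (local L i) (END x) /\
                match x with Won _ => True | Open a => F a /\ ~ I a end) _ hp.
        by case=> g [m].
      by move=> h1 [h2 h3]; split=> // [y /h2|g m /h3].
    rewrite ep /=.
    have e' := e; rewrite lst0 // in e'.
    have [_ hw] := describes_leaf hi2 e'.
    split=> // [|y [<-]//]; split=> // _; split=> //; rewrite hs1; split=> //.
    exists x; split; first exact/(game_eq_END hi2).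
    case: x e hx {bad dead e' hw} => //= a e hx; split; first exact: FVs_label hi1 e.
    by move=> Ia; move: hx; rewrite (inIP hi1 e).2.
  + rewrite deadb; split=> //; split=> // -[_ [_ [x]]] /bad; case=> // -[]//.
- rewrite /main_step /=; case: ifPn => [/andP[hi /eqP hd]|hc]; last first.
    rewrite deadb; split=> //; split=> // -[h1 h2 _ _]; case/negP: hc.
    by rewrite -hs1 h1 h2 /=.
  have [hi1 hi2] := hs2 i hi.
  have hat := atomicE hi2; rewrite -lst0 // in hat.
  have hsup := describes_supp hi2 [::]; rewrite -lst0 // in hsup.
  have nil_in : supp (local L i) [::] by exact: tree_nil.
  case e : (lst _) hat hsup => [|x|g m] hat hsup.
  + by move/hsup: nil_in.
  + rewrite deadb; split=> //; split=> // -[_ _]; case.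
    by apply/hat; exists x.
  + have nat_ : ~ atomic (local L i) by case/hat.
    case: p IH hk {dead deadb} => [|m' p] IH hk.
      split=> //=; first by split=> // _; rewrite hs1; split.
      move=> g' m' [<- _]; rewrite lst0 // in e.
      by have [_ _] := describes_node hi2 e.
    rewrite /= /fstep /= /just_step.
    have hsm : supp (local L i) [:: m'] <-> ~~ is_bad (lst (ext (nth h0 hs i) m')).
      by rewrite /lst /= -cats1; exact: (describes_supp hi2 [:: m']).
    case: ifPn => hb.
      have deadb' : (foldl step (deadst hs) p).2 = Bad.
        have [->//|hp] := EM (p = [::]).
        have := @foldl_dead inI St (deadst hs) p _ hp.
        case: (foldl step (deadst hs) p).2 => //= [?|??] h;
        by have /h : ~ (exists g m, Bad = Node g m) by case=> ? [].
      rewrite deadb'; split=> //; split=> // -[_ _ _ [/hsm]].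
      by rewrite hb.
    have {}hsm : supp (local L i) [:: m'] by apply/hsm.
    have [|r1 r2 r3] := IH p _ _ _ (matches_rcons hm hi hsm).
      by rewrite /= ltnS in hk; apply: ltnW.
    split=> //; rewrite -r1; split=> [[]|] //; first by move=> _ _ _ [].
    by rewrite hs1.
- by rewrite /main_step deadb /=; split.
Qed.

Lemma describes_St_nil i : i < n -> ~~ is_bad (St i [::]).
Proof. by move=> hi; apply/(describes_supp (desc hi)); exact: tree_nil. Qed.

(** Legality, label and turn come from the soundness of the fold; the invariant [wf] adds that the
    recorded move is legal. *)
Lemma describes_forall : describes (forall_st inI St n) (forall_game I L0).
Proof.
have hm0 : matches L0 (inits n).
  split; first by rewrite size_inits.
  move=> i; rewrite size_inits => hi; rewrite nth_inits //; split=> //.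
  by apply: describes_ext (desc hi) => r.
have hs p := foldl_fstep_sound p hm0.
have hmem p : supp (forall_game I L0) p <-> ~~ is_bad (forall_st inI St n p).
  by have [] := hs p.
move=> p; have [h1 h2 h3] := hs p; rewrite -/(frun _ _ _ _) -/(forall_st _ _ _ _) in h1 h2 h3.
have hwf := frun_wf inI describes_St_nil p.
case e : (forall_st inI St n p) => [|x|g m].
- by rewrite hmem e.
- split; last exact: h2.
  split=> [|m]; first by rewrite hmem e.
  rewrite hmem /forall_st frun_rcons /fstep -/(forall_st _ _ _ _) e.
  by [].
- split; [by rewrite hmem e| |exact: h3 e].
  rewrite hmem /forall_st frun_rcons.
  case: hwf; move: e; rewrite /forall_st; case: (frun _ _ _ _) => [[hs' pd] st] /= -> w1 _.
  rewrite /fstep /=; case: pd => [[_ ->]|i [w2 w3]].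
    by rewrite /= eqxx.
  rewrite /just_step.
  have [_ /(describes_supp (desc (w1 i w2))) + _] := describes_node (desc (w1 i w2)) w3.
  by rewrite /lst /ext /= => /negPf ->.
Qed.

End ForallDescribes.

(** * Interpretation under an environment *)

Definition upd (e : nat -> nat) (x n : nat) : nat -> nat :=
  fun y => if y == x then n else e y.

(* The interpretation of A, or of its negation when s is false, with the free
   first order variables read in e; unlike [interp] it is structural. *)
Fixpoint ginterp (s : bool) (e : nat -> nat) (A : formula) : game :=
  let flip (b : bool) G := if b then G else gdual G in
  match A with
  | FPred s' k p ts =>
      let v := p [tuple teval e (ts i) | i < k] in
      END (Won (if (if (if s then s' else ~~ s') then v else ~~ v)
                then Proponent else Opponent))
  | FVar s' k X ts =>
      END (Open (Par (if s then s' else ~~ s') X [tuple teval e (ts i) | i < k]))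
  | And B C => flip s (and_game (ginterp true e B) (ginterp true e C))
  | Or B C => flip (~~ s) (and_game (ginterp false e B) (ginterp false e C))
  | All x B => flip s (all_game (fun m => ginterp true (upd e x m) B))
  | Ex x B => flip (~~ s) (all_game (fun m => ginterp false (upd e x m) B))
  | All2 k X B => flip s (forall_game (VarOf k X) [:: ginterp true e B])
  | Ex2 k X B => flip (~~ s) (forall_game (VarOf k X) [:: ginterp false e B])
  end.

Lemma teval_tsubst e x n t : teval e (tsubst x n t) = teval (upd e x n) t.
Proof.
elim: t => [y|m|k f ts IH] //=; first by rewrite /upd; case: eqP.
by congr (prf f _); apply: eq_from_tnth => i; rewrite !tnth_mktuple.
Qed.

Lemma upd_upd e x n m : upd (upd e x n) x m = upd e x m.
Proof. by apply: funext => y; rewrite /upd; case: eqP. Qed.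

Lemma upd_comm e x y n m : y <> x -> upd (upd e x n) y m = upd (upd e y m) x n.
Proof.
move=> ne; apply: funext => z; rewrite /upd.
by case: eqP => // ->; case: eqP.
Qed.

(** Substituting a numeral captures nothing: a quantifier on [x] itself overwrites the update, and
    updates at distinct variables commute. *)
Lemma ginterp_subst s e x n A :
  ginterp s e (subst x n A) = ginterp s (upd e x n) A.
Proof.
have tupleE k (ts : 'I_k -> term) e' : [tuple teval e' (tsubst x n (ts i)) | i < k]
    = [tuple teval (upd e' x n) (ts i) | i < k].
  by apply: eq_from_tnth => i; rewrite !tnth_mktuple teval_tsubst.
elim: A s e => [s' k p ts|s' k X ts|A IHA B IHB|A IHA B IHB|y A IH|y A IH|k X A IH|k X A IH] s e /=;
  rewrite ?tupleE ?IHA ?IHB ?IH //.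
- rewrite (_ : (fun m => _) = fun m => ginterp true (upd (upd e x n) y m) A) //.
  apply: funext => m; case: eqP => [->|ne]; first by rewrite upd_upd.
  by rewrite IH (upd_comm _ _ _ ne).
- rewrite (_ : (fun m => _) = fun m => ginterp false (upd (upd e x n) y m) A) //.
  apply: funext => m; case: eqP => [->|ne]; first by rewrite upd_upd.
  by rewrite IH (upd_comm _ _ _ ne).
Qed.

Lemma ginterp_neg s e A : ginterp s e (neg A) = ginterp (~~ s) e A.
Proof.
elim: A s e => [s' k p ts|s' k X ts|A IHA B IHB|A IHA B IHB|y A IH|y A IH|k X A IH|k X A IH] s e /=;
  rewrite ?IHA ?IHB ?IH ?negbK //.
- by case: s s' => [] [].
- by case: s s' => [] [].
- rewrite (_ : (fun m => _) = fun m => ginterp true (upd e y m) A) //.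
  by apply: funext => m; rewrite IH.
- rewrite (_ : (fun m => _) = fun m => ginterp false (upd e y m) A) //.
  by apply: funext => m; rewrite IH.
Qed.

(** All substitution instances of a formula become one family indexed by environments, so later
    proofs can use structural induction. The induction here is on the height, as [interp] unfolds
    through substitution and negation. *)
Lemma interpE A : interp A = ginterp true (fun=> 0) A.
Proof.
have [n] := ubnP (height A).
have nd B : height (neg B) <= n -> height B <= n by rewrite height_neg.
elim: n A {nd} => // n IH [s k p ts|s k X ts|B C|B C|x B|x B|k X B|k X B] /=;
  rewrite ltnS ?geq_max //.
- by rewrite gtn_max => /andP[hB hC]; rewrite interp_And !IH.
- rewrite gtn_max => /andP[hB hC]; rewrite interp_disjunctive //= interp_And.
  by rewrite !IH ?height_neg // !ginterp_neg.
- move=> h; rewrite interp_All; congr all_game; apply: funext => m.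
  by rewrite IH ?height_subst // ginterp_subst.
- move=> h; rewrite interp_disjunctive //= interp_All; congr (gdual (all_game _)).
  by apply: funext => m; rewrite IH ?height_subst ?height_neg // ginterp_subst ginterp_neg.
- by move=> h; rewrite interp_All2 IH.
- move=> h; rewrite interp_disjunctive //= interp_All2.
  by rewrite IH ?height_neg // ginterp_neg.
Qed.

Definition in_var (k X : nat) (a : par) : bool :=
  let: Par _ k' X' _ := a in (k' == k) && (X' == X).

Lemma in_varP k X a : in_var k X a <-> VarOf k X a.
Proof.
case: a => s k' X' h; split=> [/andP[/eqP ek /eqP eX]|[ek eX]]; first by split.
by apply/andP; split; apply/eqP.
Qed.

Fixpoint fstatus (s : bool) (e : nat -> nat) (A : formula) : seq move -> status :=
  let flip (b : bool) st := if b then st else sdual st in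
  match A with
  | FPred s' k p ts => fun q =>
      let v := p [tuple teval e (ts i) | i < k] in
      if q is [::] then
        Leaf (Won (if (if (if s then s' else ~~ s') then v else ~~ v)
                then Proponent else Opponent))
      else Bad
  | FVar s' k X ts => fun q =>
      if q is [::] then
        Leaf (Open (Par (if s then s' else ~~ s') X [tuple teval e (ts i) | i < k]))
      else Bad
  | And B C => fun q => flip s (and_st (fstatus true e B) (fstatus true e C) q)
  | Or B C => fun q => flip (~~ s) (and_st (fstatus false e B) (fstatus false e C) q)
  | All x B => fun q => flip s (all_st (fun m => fstatus true (upd e x m) B) q)
  | Ex x B => fun q => flip (~~ s) (all_st (fun m => fstatus false (upd e x m) B) q)
  | All2 k X B => fun q =>
      flip s (forall_st (in_var k X) (fun=> fstatus true e B) 1 q)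
  | Ex2 k X B => fun q =>
      flip (~~ s) (forall_st (in_var k X) (fun=> fstatus false e B) 1 q)
  end.

Lemma fstatusP s e A : describes (fstatus s e A) (ginterp s e A).
Proof.
have hflip (b : bool) St G : describes St G ->
    describes (fun q => if b then St q else sdual (St q)) (if b then G else gdual G).
  by case: b => // /describes_gdual.
have hall k X St G : describes St G ->
    describes (forall_st (in_var k X) (fun=> St) 1) (forall_game (VarOf k X) [:: G]).
  move=> h; apply: (@describes_forall _ _ _ [:: G]) => [[]//|_ q a _ _].
  exact: in_varP.
elim: A s e => [s' k p ts|s' k X ts|A IHA B IHB|A IHA B IHB|y A IH|y A IH|k X A IH|k X A IH] s e /=.
- exact: describes_END.
- exact: describes_END.
- by apply: hflip; exact: describes_and.
- by apply: hflip; exact: describes_and.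
- by apply: hflip; exact: describes_all.
- by apply: hflip; exact: describes_all.
- by apply: hflip; exact: hall.
- by apply: hflip; exact: hall.
Qed.

(** An open label can only surface through a [STOP], which copies the label of a local leaf and
    refuses the parameters of [I]. *)
Lemma forall_st_label inI St n p a :
  (forall i, i < n -> ~~ is_bad (St i [::])) ->
  forall_st inI St n p = Leaf (Open a) ->
  ~~ inI a /\ exists i q, i < n /\ St i q = Leaf (Open a).
Proof.
move=> hSt; case/lastP: p => [//|p m]; rewrite /forall_st frun_rcons.
have [w1 _ _] := frun_wf inI hSt p.
case: (frun _ _ _ _) w1 => [[hs pd] st] /= w1.
rewrite /fstep /=; case: st => // g k; case: pd => [|i]; last first.
  by rewrite /just_step; case: ifP.
case: m => [d|i j|i|i d|j] //=.
- by case: ifP.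
- by case: ifP.
- case: ifP => // hi; case e : (lst _ _) => [//|x|//]; case: ifP => //= hx [ex].
  by subst x; split=> //; exists (nth h0 hs i).1, (nth h0 hs i).2; split=> //; apply: w1.
- by case: ifP => // _; case: (lst _ _).
Qed.

Definition par_free (a : par) (A : formula) : Prop :=
  let: Par _ k X _ := a in free2 k X A.

(** For sequents: every open label of a formula is an instance of one of its free predicate
    variables, so all these labels lie in the set quantified by [interp_sequent], and its membership
    test can be constantly true. *)
Lemma fstatus_label s e A p a : fstatus s e A p = Leaf (Open a) -> par_free a A.
Proof.
have hflip (b : bool) st x : (if b then st else sdual st) = Leaf (Open x) ->
    exists y, st = Leaf (Open y) /\ forall B, par_free y B -> par_free x B.
  case: b => [->|]; first by exists x.
  by case: st => // -[//|y] /= [<-]; exists y; split=> // B; case: y.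
have hand S1 S2 q x : and_st S1 S2 q = Leaf (Open x) ->
    exists r, S1 r = Leaf (Open x) \/ S2 r = Leaf (Open x).
  by case: q => [//|[| | | |[|[|[|m]]]] q] //= h; exists q; [left|right].
have hall S q x : all_st S q = Leaf (Open x) ->
    exists m r, S m r = Leaf (Open x).
  by case: q => [//|[| | | |m] q] //= h; exists m, q.
have hquant t f B k X q x :
    forall_st (in_var k X) (fun=> fstatus t f B) 1 q = Leaf (Open x) ->
    ~~ in_var k X x /\ exists r, fstatus t f B r = Leaf (Open x).
  move=> h; have [_ _|h1 [_ [r [_ h2]]]] := forall_st_label _ h.
    by apply/(describes_supp (@fstatusP t f B)); exact: tree_nil.
  by split=> //; exists r.
elim: A s e p a => [s' k q ts|s' k X ts|A IHA B IHB|A IHA B IHB|y A IH|y A IH|k X A IH|k X A IH] s e p a /=.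
- by case: p.
- by case: p => // -[<-].
- move=> /hflip[b [/hand[r [/IHA hr|/IHB hr]] h]]; apply: h; case: b hr => ? ? ? ? h;
    by [left|right].
- move=> /hflip[b [/hand[r [/IHA hr|/IHB hr]] h]]; apply: h; case: b hr => ? ? ? ? h;
    by [left|right].
- by move=> /hflip[b [/hall[m [r /IH hr]] h]]; apply: h; case: b hr.
- by move=> /hflip[b [/hall[m [r /IH hr]] h]]; apply: h; case: b hr.
- move=> /hflip[b [/hquant[hb [r /IH hr]] h]]; apply: h; case: b hr hb => t l Y w /= hr hb.
  by split=> // -[el eX]; rewrite el eX !eqxx in hb.
- move=> /hflip[b [/hquant[hb [r /IH hr]] h]]; apply: h; case: b hr hb => t l Y w /= hr hb.
  by split=> // -[el eX]; rewrite el eX !eqxx in hb.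
Qed.

(** * Strategies for quantified games *)

Definition decode_move (c : nat) : move :=
  match c %% 5 with
  | 0 => DROP (c %/ 5)
  | 1 => Defs.EM (unpair1 (c %/ 5)) (unpair2 (c %/ 5))
  | 2 => STOP (c %/ 5)
  | 3 => JUST (unpair1 (c %/ 5)) (unpair2 (c %/ 5))
  | _ => NTH (c %/ 5)
  end.

Lemma code_decode_move c : code_move (decode_move c) = c.
Proof.
rewrite [RHS](divn_eq c 5) /decode_move.
have : c %% 5 < 5 by rewrite ltn_mod.
by move: (c %% 5) (c %/ 5) => [|[|[|[|[|m]]]]] a //= _;
  rewrite /code_move /= ?unpairK.
Qed.

Lemma code_moveK : cancel code_move decode_move.
Proof. by move=> m; apply: code_move_inj; rewrite code_decode_move. Qed.

Definition plabel (v : par -> player) (x : label) : player :=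
  match x with Won g => g | Open a => v a end.

(** Unlike in [instance], the valuation is total, so it can be modified without tracking a
    domain. *)
Definition ginst (v : par -> player) (G : game) : game :=
  Game (supp G) (turn G) (fun p => Won (plabel v (win G p))) (iwin G).

Definition dual_val (v : par -> player) : Prop :=
  forall a, v (pardual a) = pdual (v a).

(** Strategies below are defined by the state reached at the end of a position, for which removing
    the last move is the natural closure condition. *)
Lemma tree_rcons (P : seq move -> Prop) : P [::] ->
  (forall p m, P (rcons p m) -> P p) -> exists T : tree, tmem T = P.
Proof.
move=> h0 hr; suff hp p q : P (p ++ q) -> P p by exists (Tree h0 hp).
by elim/last_ind: q => [|q m IH]; rewrite ?cats0 // -rcons_cat => /hr.
Qed.

(** The strategies are played against each other: the player on turn follows its own, the other one
    must accept the move. The resulting play would be won by both players. *)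
Lemma not_both_win G sigma tau :
  winning Proponent G sigma -> winning Opponent G tau -> False.
Proof.
move=> [s1 s2 s3 s4 s5] [t1 t2 t3 t4 t5].
have next p : exists m, sigma p -> tau p -> sigma (rcons p m) /\ tau (rcons p m).
  (* Outside the common part of the two strategies the move is a dummy. *)
  have [[hs ht]|h] := pselect (sigma p /\ tau p); last by exists (DROP 0) => ? ?; case: h.
  have [hl|hl] := pselect (leaf G p).
    by have := s4 p hs hl; rewrite (t4 p ht hl).
  case e : (turn G p).
    have [m hm] := s3 p hs hl e; exists m => _ _; split=> //.
    exact: t2 ht hl e _ (s1 _ hm).
  have [m hm] := t3 p ht hl e; exists m => _ _; split=> //.
  exact: s2 hs hl e _ (t1 _ hm).
have [f hf] := choice next.
pose pos := fix pos n := if n is n'.+1 then rcons (pos n') (f (pos n')) else [::].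
pose b n := f (pos n).
have eb n : mkseq b n = pos n.
  by elim: n => // n IH; rewrite mkseqS IH.
have hb n : sigma (mkseq b n) /\ tau (mkseq b n).
  rewrite eb; elim: n => [|n [h1 h2]]; first by split; exact: tree_nil.
  exact: hf.
have [_] := s5 b (fun n => (hb n).1).
by have [_ ->] := t5 b (fun n => (hb n).2).
Qed.

(** * The fair strategy *)

Section Fair.
Variables (inI : par -> bool) (St : nat -> seq move -> status) (n : nat).
Variable pw : label -> bool.
Notation lst := (lst St).
Notation hist := (nat * seq move)%type.

Definition is_node (st : status) : bool := if st is Node _ _ then true else false.

Definition stop_ok (h : hist) : bool :=
  if lst h is Leaf x then stoppable inI x && pw x else false.

(* At stage k = cpair i c, the [just_move] below explores the child coded by c
   of the i-th local position. *)
Definition just_target (hs : seq hist) : nat :=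
  if is_node (lst (nth h0 hs (unpair1 (size hs - n)))) then unpair1 (size hs - n)
  else find (fun h => is_node (lst h)) hs.

(** [DROP] loses at once; it is prescribed only if all local positions are leaves and neither [STOP]
    nor [EM] wins, which [not_saturated_atomic] excludes. *)
Definition main_move (hs : seq hist) : move :=
  if has stop_ok hs then STOP (find stop_ok hs)
  else if has (fun h => has (em_ok inI St h) hs) hs then
    let i := find (fun h => has (em_ok inI St h) hs) hs in
    Defs.EM i (find (em_ok inI St (nth h0 hs i)) hs)
  else if has (fun h => is_node (lst h)) hs then JUST (just_target hs) (size hs)
  else DROP (size hs).

(** A stage whose number codes no legal move is wasted on the stored legal move [m]; the play goes
    on in any case. *)
Definition just_move (hs : seq hist) (i : nat) (m : move) : move :=
  let c := decode_move (unpair2 (size hs - n)) in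
  if is_bad (lst (ext (nth h0 hs i) c)) then m else c.

Definition fair_move (s : fstate) : move :=
  if s.2 is Node _ m then
    if s.1.2 is i.+1 then just_move s.1.1 i m else main_move s.1.1
  else DROP 0.

(** The boolean records whether all moves of P so far were the prescribed ones. Carried along with
    the state, it makes membership in the strategy a single fold. *)
Definition sstep (s : fstate * bool) (m : move) : fstate * bool :=
  (fstep inI St s.1 m,
   s.2 && (if s.1.2 is Node Proponent _ then code (fair_move s.1) == code m else true)).

Definition srun (p : seq move) : fstate * bool := foldl sstep (mainst (inits n), true) p.

Definition fair_strategy (p : seq move) : bool :=
  (srun p).2 && ~~ is_bad (srun p).1.2.

Lemma srun1 p : (srun p).1 = frun inI St n p.
Proof.
elim/last_ind: p => // p m IH.
by rewrite /srun foldl_rcons frun_rcons -IH.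
Qed.

Lemma fair_strategy_rcons p m : fair_strategy (rcons p m) ->
  [/\ fair_strategy p, ~~ is_bad (frun inI St n (rcons p m)).2 &
      forall k, (frun inI St n p).2 = Node Proponent k -> fair_move (frun inI St n p) = m].
Proof.
rewrite /fair_strategy -(srun1 (rcons p m)) => /andP[].
rewrite {1}/srun foldl_rcons -/(srun p) /= => /andP[h1 h2] h3.
split=> //; first rewrite h1 /=.
  move: h3; rewrite /srun foldl_rcons -/(srun p) /= /fstep.
  by case: (srun p).1.2.
by move=> k; rewrite -srun1 => e; move: h2; rewrite e => /eqP/code_move_inj.
Qed.

Lemma fair_strategyS p m : fair_strategy p ->
  ~~ is_bad (frun inI St n (rcons p m)).2 ->
  (forall k, (frun inI St n p).2 = Node Proponent k -> fair_move (frun inI St n p) = m) ->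
  fair_strategy (rcons p m).
Proof.
move=> /andP[h1 _] h2 h3; rewrite /fair_strategy (srun1 (rcons p m)) h2 andbT.
rewrite /srun foldl_rcons -/(srun p) /= h1 srun1 /=.
by case e : (frun _ _ _ _).2 => [|x|[] k] //; rewrite (h3 k e).
Qed.

Lemma main_moveP hs : 0 < n -> n <= size hs ->
  [\/ exists i, [/\ i < size hs, stop_ok (nth h0 hs i) & main_move hs = STOP i],
      exists i j, [/\ i < size hs, j < size hs,
        em_ok inI St (nth h0 hs i) (nth h0 hs j) & main_move hs = Defs.EM i j] |
      [/\ forall i, i < size hs -> ~~ stop_ok (nth h0 hs i),
         forall i j, i < size hs -> j < size hs -> ~~ em_ok inI St (nth h0 hs i) (nth h0 hs j) &
         (exists i, [/\ i < size hs, is_node (lst (nth h0 hs i)),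
            main_move hs = JUST i (size hs) &
            is_node (lst (nth h0 hs (unpair1 (size hs - n)))) -> i = unpair1 (size hs - n)])
         \/ ((forall i, i < size hs -> ~~ is_node (lst (nth h0 hs i))) /\
             main_move hs = DROP (size hs)) ] ].
Proof.
move=> n0 hn; rewrite /main_move; case: ifPn => [h|/has_nthP hs1].
  by constructor 1; exists (find stop_ok hs); rewrite -has_find nth_find.
have {}hs1 i : i < size hs -> ~~ stop_ok (nth h0 hs i).
  by move=> hi; apply/negP => h; apply: hs1; exists i; [|exact: h].
case: ifPn => [h|/has_nthP hs2].
  constructor 2; set i := find _ _; exists i.
  have hi := nth_find h0 h; rewrite -/i in hi.
  exists (find (em_ok inI St (nth h0 hs i)) hs).
  by rewrite -!has_find h nth_find.
have {}hs2 i j : i < size hs -> j < size hs -> ~~ em_ok inI St (nth h0 hs i) (nth h0 hs j).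
  move=> hi hj; apply/negP => h; apply: hs2; exists i; first exact: hi.
  by apply/has_nthP; exists j; [|exact: h].
constructor 3; split=> //.
case: ifPn => [h|/has_nthP hs3].
  left; rewrite /just_target; case: ifPn => hu.
    exists (unpair1 (size hs - n)); split=> //.
    (* Since [n] is positive, the stage is smaller than the number of local positions, and its first
       component is a valid index. *)
    have : unpair1 (size hs - n) <= size hs - n.
      by rewrite -{2}(unpairK (size hs - n)) leq_cpair_l.
    move=> /leq_ltn_trans; apply.
    by rewrite -subn_gt0 subKn.
  exists (find (fun h => is_node (lst h)) hs).
  by split=> //; [rewrite -has_find|exact: (nth_find h0 h)].
right; split=> // i hi; apply/negP => h; apply: hs3.
by exists i; [|exact: h].
Qed.

End Fair.

(** * Winning strategies of both players in quantified games *)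

Section ForallWin.
Variables (inI : par -> bool) (St : nat -> seq move -> status).
Variables (I : set par) (L : seq game).
Let n := size L.
Hypothesis desc : forall i, i < n -> describes (St i) (local L i).
Hypothesis inIP : forall i q a, i < n -> St i q = Leaf (Open a) -> (inI a <-> I a).

Notation G := (forall_game I L).
Notation run := (frun inI St n).
Notation step := (fstep inI St).
Notation lst := (lst St).
Notation hist := (nat * seq move)%type.

Let descG : describes (forall_st inI St n) G := describes_forall desc inIP.

Let wfr p := frun_wf inI (describes_St_nil desc) p.

Lemma suppE p : supp G p <-> ~~ is_bad (run p).2.
Proof. exact: describes_supp descG p. Qed.

Lemma nodeE p : supp G p /\ ~ leaf G p <-> exists g m, (run p).2 = Node g m.
Proof. exact: describes_nodeE descG p. Qed.

Lemma node_turn p g m : (run p).2 = Node g m -> turn G p = g.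
Proof. by case/(describes_node descG). Qed.

Lemma leafE p : leaf G p <-> exists x, (run p).2 = Leaf x.
Proof. exact: describes_leafE descG p. Qed.

Lemma leaf_win p x : (run p).2 = Leaf x -> win G p = x.
Proof. by case/(describes_leaf descG). Qed.

Lemma main_step_hs hs m : (main_step inI St hs m).1.1 = hs.
Proof.
case: m => [d|i j|i|i d|j] //=; try by case: ifP.
- by case: ifP => // _; case: (lst _) => // x; case: ifP.
- by case: ifP => // _; case: (lst _).
Qed.

Lemma step_hs s m : (step s m).1.1 = s.1.1 \/ exists h, (step s m).1.1 = rcons s.1.1 h.
Proof.
case: s => [[hs pd] st]; rewrite /fstep /=.
case: st => [|x|g k]; [by left|by left|].
case: pd => [|i]; first by left; rewrite main_step_hs.
by rewrite /just_step; case: ifP => _; [left|right; exists (ext (nth h0 hs i) m)].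
Qed.

Lemma step_nth s m i : i < size s.1.1 ->
  i < size (step s m).1.1 /\ nth h0 (step s m).1.1 i = nth h0 s.1.1 i.
Proof.
case: (step_hs s m) => [->//|[h ->]] hi.
by rewrite size_rcons nth_rcons hi; split=> //; exact: ltnW.
Qed.

Lemma run_inits p i : i < n -> i < size (run p).1.1 /\ nth h0 (run p).1.1 i = (i, [::]).
Proof.
move=> hi; elim/last_ind: p => [|p m [h1 h2]].
  by rewrite /= size_inits nth_inits.
by rewrite frun_rcons -{}h2; exact: step_nth.
Qed.

Lemma step_leaf s m x : (step s m).2 = Leaf x ->
  s.1.2 = 0 /\ [\/ x = Won Opponent /\ m = DROP (size s.1.1),
   exists i j, [/\ m = Defs.EM i j, i < size s.1.1, j < size s.1.1,
     em_ok inI St (nth h0 s.1.1 i) (nth h0 s.1.1 j) & x = Won Proponent] |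
   exists i, [/\ m = STOP i, i < size s.1.1, lst (nth h0 s.1.1 i) = Leaf x &
     stoppable inI x] ].
Proof.
case: s => [[hs pd] st]; rewrite /fstep /=; case: st => // g k.
case: pd => [|i]; last by rewrite /just_step; case: ifP.
split=> //; case: m H => [d|i j|i|i d|j] //=.
- by case: eqP => // -> [<-]; constructor 1.
- case: ifP => // /andP[hi /andP[hj he]] [<-].
  by constructor 2; exists i, j.
- case: ifP => // hi; case e : (lst _) => [//|y|//]; case: ifP => // hy [<-].
  by constructor 3; exists i.
- by case: ifP => // _; case: (lst _).
Qed.

Lemma main_step_node hs m g k : (main_step inI St hs m).2 = Node g k ->
  exists i, [/\ m = JUST i (size hs), i < size hs, lst (nth h0 hs i) = Node g k &
   main_step inI St hs m = (hs, i.+1, Node g k)].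
Proof.
case: m => [d|i j|i|i d|j] //=; try by case: ifP.
- by case: ifP => // _; case: (lst _) => // x; case: ifP.
- case: ifP => // /andP[hi /eqP->]; case e : (lst _) => [//|//|g' k'] [<- <-].
  by exists i.
Qed.

Lemma just_step_node hs i m : ~~ is_bad (just_step St hs i m).2 ->
  ~~ is_bad (lst (ext (nth h0 hs i) m)) /\
  just_step St hs i m = mainst (rcons hs (ext (nth h0 hs i) m)).
Proof. by rewrite /just_step; case: ifP. Qed.

(* The local positions of an infinite play, each with its history. *)
Lemma branch_hist b : branch (supp G) b -> exists H : nat -> hist,
  (forall i, i < n -> H i = (i, [::])) /\
  forall k, run (mkseq b (2 * k)) = mainst (mkseq H (n + k)) /\
    exists i g m, [/\ i < n + k, b (2 * k) = JUST i (n + k), lst (H i) = Node g m,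
      run (mkseq b (2 * k + 1)) = (mkseq H (n + k), i.+1, Node g m) &
      H (n + k) = ext (H i) (b (2 * k + 1))].
Proof.
move=> hb.
have hbS k : ~~ is_bad (run (mkseq b k)).2 by apply/suppE; exact: hb.
(* The local position [n + k] is created by the moves [2k] and [2k + 1], so it is the last one after
   [2k + 2] moves. *)
pose H d := if d < n then (d, [::])
  else last h0 (run (mkseq b (2 * (d - n) + 2))).1.1.
have Hlt i : i < n -> H i = (i, [::]) by rewrite /H => ->.
have node k : exists g m, (run (mkseq b k)).2 = Node g m.
  have := hbS k.+1; rewrite mkseqS frun_rcons /fstep.
  by case: (run _).2 => //= g m _; exists g, m.
have one k : run (mkseq b (2 * k)) = mainst (mkseq H (n + k)) ->
    exists i g m, [/\ i < n + k, b (2 * k) = JUST i (n + k), lst (H i) = Node g m,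
      run (mkseq b (2 * k + 1)) = (mkseq H (n + k), i.+1, Node g m) &
      H (n + k) = ext (H i) (b (2 * k + 1))] /\
      run (mkseq b (2 * k.+1)) = mainst (mkseq H (n + k.+1)).
  move=> e; have [g [m hgm]] := node (2 * k).+1.
  have [i [h1 h2 h3 h4]] : exists i, [/\ b (2 * k) = JUST i (n + k), i < n + k,
      lst (nth h0 (mkseq H (n + k)) i) = Node g m &
      main_step inI St (mkseq H (n + k)) (b (2 * k)) = (mkseq H (n + k), i.+1, Node g m)].
    by rewrite mkseqS frun_rcons e in hgm; have := main_step_node hgm; rewrite size_mkseq.
  exists i, g, m; rewrite addn1.
  have e1 : run (mkseq b (2 * k).+1) = (mkseq H (n + k), i.+1, Node g m).
    by rewrite mkseqS frun_rcons e.
  have e2 : ~~ is_bad (just_step St (mkseq H (n + k)) i (b (2 * k).+1)).2.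
    by have := hbS (2 * k).+2; rewrite mkseqS frun_rcons e1.
  have {e2}[_ e2] := just_step_node e2.
  have e3 : run (mkseq b (2 * k.+1)) = mainst (rcons (mkseq H (n + k)) (ext (H i) (b (2 * k).+1))).
    by rewrite mulnS addnC addn2 mkseqS frun_rcons e1 /fstep /= e2 nth_mkseq.
  have e4 : H (n + k) = ext (H i) (b (2 * k).+1).
    rewrite {1}/H ltnNge leq_addr /= addKn addnC -mulnS e3 /=.
    by rewrite last_rcons.
  rewrite nth_mkseq // in h3.
  by rewrite e3 addnS (mkseqS H) e4.
exists H; split=> // k.
have e : run (mkseq b (2 * k)) = mainst (mkseq H (n + k)).
  elim: k => [|k IH]; last by have [i [g [m []]]] := one k IH.
  rewrite addn0 muln0 /frun /=; congr mainst; apply: (@eq_from_nth _ h0).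
    by rewrite size_inits size_mkseq.
  by move=> i; rewrite size_inits => hi; rewrite nth_inits // nth_mkseq // Hlt.
by split=> //; have [i [g [m []]]] := one k e; exists i, g, m.
Qed.

(** Each link of a chain extends the history by the corresponding move of [q], so a thread in the
    play is a branch of the initial game [i]. *)
Lemma thread_hist b H i q (j : nat -> nat) :
  (forall i, i < n -> H i = (i, [::])) ->
  (forall k, exists i, b (2 * k) = JUST i (n + k) /\ H (n + k) = ext (H i) (b (2 * k + 1))) ->
  i < n -> j 0 = i -> (forall s, justifies n b (j s) (q s) (j s.+1)) ->
  forall s, H (j s) = (i, mkseq q s).
Proof.
move=> h1 h2 hi j0 hj; elim=> [|s IH]; first by rewrite j0 h1.
have [k [-> e1 e2]] := hj s.
have [i' [e3 ->]] := h2 k.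
by move: e3; rewrite e1 => -[<-]; rewrite IH e2 /ext mkseqS.
Qed.

(** O keeps every local position inside the chosen strategy for its initial game. [EM] is never
    available to P, since dual parameters cannot both be lost under [v']; [STOP] shows only labels
    on which [v] and [v'] agree. *)
Lemma forall_opponent_win v v' :
  dual_val v' -> (forall a, ~ I a -> v' a = v a) ->
  (forall i, i < n -> winner (ginst v' (local L i)) Opponent) ->
  winner (ginst v G) Opponent.
Proof.
move=> dv' vv' hw.
have {hw} [tau htau] : exists tau : nat -> tree, forall i, i < n ->
    winning Opponent (ginst v' (local L i)) (tau i).
  have : forall i, exists t : tree, i < n -> winning Opponent (ginst v' (local L i)) t.
    move=> i; have [hi|hi] := pselect (i < n); last by exists tree1.
    by have [t] := hw i hi; exists t.
  by move/choice => [t]; exists t.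
pose ok (hs : seq hist) := forall i, i < size hs -> tau (nth h0 hs i).1 (nth h0 hs i).2.
have [|p m|T eT] := @tree_rcons (fun p => supp G p /\ ok (run p).1.1).
- split; first exact: tree_nil.
  by move=> i; rewrite /= size_inits => hi; rewrite nth_inits //=; exact: tree_nil.
- move=> [h1 h2]; split; first by apply: (@tree_prefix _ _ [:: m]); rewrite cats1.
  move=> i hi; have := step_nth m hi; rewrite -frun_rcons => -[h3 <-].
  exact: h2.
have leaf_lost p i x : ok (run p).1.1 -> i < size (run p).1.1 ->
    lst (nth h0 (run p).1.1 i) = Leaf x -> plabel v' x = Opponent.
  move=> hok hi e; have [w1 _ _] := wfr p.
  have [hl hwin] := describes_leaf (desc (w1 _ hi)) e.
  have [_ _ _ t4 _] := htau _ (w1 _ hi).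
  by have [<-] := t4 _ (hok _ hi) hl; rewrite hwin.
exists T; rewrite /winning /branch eT; split.
- by move=> p [].
- move=> p [hp hok] hl e m hm; split=> //.
  have [g [k hst]] := (nodeE p).1 (conj hp hl).
  have eg := node_turn hst; rewrite e in eg; subst g.
  have [w1 _] := wfr p; rewrite hst.
  move/suppE: hm; rewrite frun_rcons /fstep hst.
  case epd : (run p).1.2 => [|i]; first by rewrite main_step_hs.
  move=> /just_step_node[hb ->] [w2 w3] /= d.
  rewrite size_rcons ltnS nth_rcons => hd.
  case: (ltngtP d (size (run p).1.1)) hd => // hd _; first exact: hok.
  have [t1 t2 _ _ _] := htau _ (w1 _ w2).
  have [d1 d2 d3] := describes_node (desc (w1 _ w2)) w3.
  apply: t2 => //=; first exact: hok.
    by case=> _ /(_ k).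
  by apply/(describes_supp (desc (w1 _ w2))).
- move=> p [hp hok] hl e.
  have [g [k hst]] := (nodeE p).1 (conj hp hl).
  have eg := node_turn hst; rewrite e in eg; subst g.
  have [w1 _] := wfr p; rewrite hst.
  case epd : (run p).1.2 => [|i] [w2 w3] //.
  have [t1 _ t3 _ _] := htau _ (w1 _ w2).
  have [d1 d2 d3] := describes_node (desc (w1 _ w2)) w3.
  have [||m hm] := t3 _ (hok _ w2).
  + by case=> _ /(_ k).
  + by [].
  have hb : ~~ is_bad (lst (ext (nth h0 (run p).1.1 i) m)).
    by apply/(describes_supp (desc (w1 _ w2))); exact: t1.
  exists m; rewrite suppE frun_rcons /fstep hst epd /just_step (negPf hb); split=> //.
  move=> d /=; rewrite size_rcons ltnS nth_rcons => hd.
  case: (ltngtP d (size (run p).1.1)) hd => // hd _; exact: hok.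
- move=> p [hp hok] /leafE[x hst]; have /= hwin := leaf_win hst.
  rewrite /= hwin; congr Won; clear hwin.
  case/lastP: p hp hok hst => [//|p m] hp hok; rewrite frun_rcons => /step_leaf[e0 hc].
  have hs_eq : (run (rcons p m)).1.1 = (run p).1.1.
    rewrite frun_rcons /fstep e0; case: (run p).2 => //= g k.
    by rewrite main_step_hs.
  have hokp : ok (run p).1.1 by rewrite -hs_eq.
  have [w1 _ _] := wfr p.
  case: hc => [[-> _]//|[i [j [_ hi hj he _]]]|[i [_ hi e hx]]].
  + have /(em_okP inIP (w1 _ hi) (w1 _ hj))[a [_ ei ej]] := he.
    have := leaf_lost _ _ _ hokp hj ej; rewrite /= dv'.
    by have /= -> := leaf_lost _ _ _ hokp hi ei.
  + have := leaf_lost _ _ _ hokp hi e; case: x e hx => //= a e /negP hx.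
    by rewrite vv' // => /(inIP (w1 _ hi) e).
(* A thread won by P would be an infinite branch of [tau i], which is won by O. *)
- move=> b hb; have hbr : branch (supp G) b by move=> k; case: (hb k).
  split=> //=; rewrite /forall_iwin; case: asboolP => // -[i [hi [q [[j [j0 hj]] [hq hqw]]]]].
  have [H [H1 H2]] := branch_hist hbr.
  have hH := @thread_hist b H i q j H1 _ hi j0 (fun s => (hj s).2).
  have {}hH s : H (j s) = (i, mkseq q s).
    by apply: hH => k; have [_ [i' [g [m []]]]] := H2 k; exists i'.
  have [_ _ _ _ t5] := htau i hi.
  have [|_ /=] := t5 q; last by rewrite hqw.
  move=> s; have [_ hok] := hb (2 * (j s).+1).
  have [e _] := H2 (j s).+1; rewrite e in hok.
  have lt_j : j s < n + (j s).+1 by rewrite addnS ltnS leq_addl.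
  by have := hok (j s); rewrite /= size_mkseq nth_mkseq // hH; apply.
Qed.

Hypothesis dualI : selfdual I.

(** At most one member of each dual pair in [I] occurs: it becomes false and its dual true. Pairs
    that do not occur keep their values under [v]. *)
Lemma refuting_val v (Occ : par -> Prop) : dual_val v ->
  (forall a, I a -> Occ a -> Occ (pardual a) -> False) ->
  exists v', [/\ dual_val v', forall a, ~ I a -> v' a = v a &
    forall a, I a -> Occ a -> v' a = Opponent].
Proof.
move=> dv hO.
exists (fun a => if `[< I a >] then
    if `[< Occ a >] then Opponent
    else if `[< Occ (pardual a) >] then Proponent else v a
  else v a); split.
- move=> a; have -> : `[< I (pardual a) >] = `[< I a >].
    by apply: asbool_equiv_eq; exact: dualI.
  case: asboolP => // Ia; rewrite pardualK.
  case: asboolP => h1; case: asboolP => h2 //.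
  by case: (hO a).
- by move=> a Ia; case: asboolP.
- by move=> a Ia Oa; case: asboolP => // _; case: asboolP.
Qed.

Variables (pw : label -> bool) (v : par -> player).
Hypothesis dual_v : dual_val v.
Hypothesis pwP : forall x, stoppable inI x -> (pw x <-> plabel v x = Proponent).
Hypothesis prem : forall v', dual_val v' -> (forall a, ~ I a -> v' a = v a) ->
  exists2 i, i < n & winner (ginst v' (local L i)) Proponent.

Notation stop_ok := (stop_ok inI St pw).
Notation em_ok := (em_ok inI St).

Lemma prem_gt0 : 0 < n.
Proof. by have [//|i hi _] := prem dual_v; apply: leq_trans hi. Qed.

(** No two leaves of a saturated set form an [EM] pair, so its leaves labelled in [I] can all be
    falsified at once. Its other leaves are stoppable, and already lost under [v] as no [STOP]
    wins. *)
Lemma saturated_val (Hd : hist -> Prop) :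
  (forall h, Hd h -> h.1 < n) ->
  (forall h, Hd h -> ~~ stop_ok h) ->
  (forall h h', Hd h -> Hd h' -> ~~ em_ok h h') ->
  exists v', [/\ dual_val v', forall a, ~ I a -> v' a = v a &
    forall h x, Hd h -> lst h = Leaf x -> plabel v' x = Opponent].
Proof.
move=> hn hs he.
have [|v' [d1 d2 d3]] := @refuting_val v (fun a => exists2 h, Hd h & lst h = Leaf (Open a)) dual_v.
  move=> a Ia [h hh ea] [h' hh' ea'].
  by case/negP: (he h h' hh hh'); apply/(em_okP inIP (hn _ hh) (hn _ hh')); exists a.
exists v'; split=> // h x hh e.
have stop_lost : stoppable inI x -> plabel v x = Opponent.
  move=> hx; have := hs h hh; rewrite /stop_ok e hx /= => /negP hpw.
  by case ep : (plabel v x) => //; case: hpw; apply/pwP.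
case: x e stop_lost => [g|a] e stop_lost; first exact: stop_lost.
have [Ia|nIa] := pselect (I a); first by apply: d3 => //; exists h.
rewrite /= d2 //; apply: stop_lost; apply/negP => /=.
by move/(inIP (hn _ hh) e).
Qed.

(** If all local positions are leaves, then so are the roots of the initial games, and the refuting
    valuation makes all of these lost, against the premise. *)
Lemma not_saturated_atomic (hs : seq hist) :
  (forall i, i < size hs -> (nth h0 hs i).1 < n) ->
  (forall i, i < n -> i < size hs /\ nth h0 hs i = (i, [::])) ->
  (forall i, i < size hs -> ~~ is_bad (lst (nth h0 hs i))) ->
  (forall i, i < size hs -> ~~ stop_ok (nth h0 hs i)) ->
  (forall i j, i < size hs -> j < size hs -> ~~ em_ok (nth h0 hs i) (nth h0 hs j)) ->
  (forall i, i < size hs -> ~~ is_node (lst (nth h0 hs i))) -> False.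
Proof.
move=> h1 h2 h3 h4 h5 h6.
have [|||v' [d1 d2 d3]] := @saturated_val (fun h => exists2 i, i < size hs & h = nth h0 hs i).
- by move=> _ [i hi ->]; exact: h1.
- by move=> _ [i hi ->]; exact: h4.
- by move=> _ _ [i hi ->] [j hj ->]; exact: h5.
have [i hi [sigma hw]] := prem d1 d2.
have [hi' ei] := h2 i hi.
have : exists x, St i [::] = Leaf x.
  by have := h3 i hi'; have := h6 i hi'; rewrite ei /lst /=; case: (St _ _) => // x; exists x.
case=> x e.
have lost : plabel v' x = Opponent by apply: (d3 (i, [::]) x _ e); exists i.
have hat : forall p, supp (local L i) p <-> p = [::].
  by apply/(atomicE (desc hi)); exists x.
have [hl hwi] := describes_leaf (desc hi) e.
have [_ _ _ s4 _] := hw.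
have := s4 [::] (tree_nil _) hl; rewrite /= hwi lost.
by [].
Qed.

(** Legality and finite plays are read off [main_moveP]. For an infinite play without a thread won
    by P, the play itself provides the valuation [v']; the premise then gives P a strategy [sigma]
    in some initial game [i], and the play yields a strategy [tau] of O for that game under the same
    [v']. *)
Lemma fair_strategy_wins : exists T : tree,
  (forall p, T p <-> fair_strategy inI St n pw p) /\ winning Proponent (ginst v G) T.
Proof.
have n0 := prem_gt0.
have [|p m|T eT] := @tree_rcons (fair_strategy inI St n pw).
- by [].
- by case/fair_strategy_rcons.
exists T; split=> [p|]; first by rewrite eT.
have hsupp p : fair_strategy inI St n pw p -> supp G p.
  by move/andP=> [_]; rewrite srun1 => /suppE.
have size_run p : n <= (size (run p).1.1).
  have : n.-1 < n by rewrite ltn_predL.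
  by move/(run_inits p) => [h _]; move: h; rewrite (prednK n0).
have hmain p := @main_moveP inI St n pw (run p).1.1 n0 (size_run p).
rewrite /winning /branch eT; split.
- exact: hsupp.
- move=> p hp hl e m hm; apply: fair_strategyS => //; first exact/suppE.
  move=> k hk; have := node_turn hk; rewrite /= in e *.
  by rewrite e.
- move=> p hp hl e.
  have [g [k hst]] := (nodeE p).1 (conj (hsupp _ hp) hl).
  have eg := node_turn hst; rewrite /= in e eg; rewrite e in eg; subst g.
  exists (fair_move inI St n pw (run p)); apply: fair_strategyS => //.
  have [w1 w1' w2] := wfr p; rewrite hst in w2.
  rewrite frun_rcons /fstep hst /fair_move hst.
  case epd : (run p).1.2 w2 => [|i] [w2 w3]; last first.
    rewrite /just_step ifF //; apply/negbTE; rewrite /just_move; case: ifPn => // _.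
    apply/(describes_supp (desc (w1 _ w2))).
    by have [] := describes_node (desc (w1 _ w2)) w3.
  case: (hmain p) => [[i [hi hs ->]]|[i [j [hi hj he ->]]]|[_ _ [[i [hi hnode -> _]]|[_ ->]]]] /=.
  + by rewrite hi; move: hs; rewrite /stop_ok; case: (lst _) => // x /andP[-> _].
  + by rewrite hi hj he.
  + by rewrite hi eqxx /=; move: hnode; case: (lst _).
  + by rewrite eqxx.
- move=> p hp /leafE[x hst]; have /= hwin := leaf_win hst; rewrite /= hwin; congr Won.
  clear hwin; case/lastP: p hp hst => [//|p m] /fair_strategy_rcons[hp _ hm].
  have [w1 w1' w2] := wfr p.
  have : ~~ is_bad (run p).2 by apply/suppE; exact: hsupp.
  case est : (run p).2 w2 => [//|y|g k] w2 _.
    by rewrite frun_rcons /fstep est.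
  rewrite frun_rcons => /step_leaf[epd hc]; rewrite epd in w2.
  have {}hm : m = main_move inI St n pw (run p).1.1.
    by rewrite -(hm k); [rewrite /fair_move est epd|rewrite w2.1 in est].
  case: (hmain p) => [[i [hi hs e]]|[i [j [hi hj he e]]]|[h1 h2 [[i [hi hnode e _]]|[h3 e]]]];
    rewrite e in hm; subst m.
  + case: hc => [[_ //]|[i' [j' [//]]]|[i' [[<-] _ e' hx]]].
    by move: hs; rewrite /stop_ok e' => /andP[_]; move/pwP; apply.
  + by case: hc => [[_ //]|[i' [j' [_ _ _ _ ->]]] //|[i' [//]]].
  + by case: hc => [[_ //]|[i' [j' [//]]]|[i' [//]]].
  + exfalso; apply: (@not_saturated_atomic (run p).1.1) => // i hi.
    exact: run_inits.
- move=> b hb; have hbr : branch (supp G) b by move=> k; apply: hsupp; exact: hb.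
  split=> //=; rewrite /forall_iwin; case: asboolP => // nothread; exfalso.
  have [H [H1 H2]] := branch_hist hbr.
  have hfollow k g : (run (mkseq b k)).2 = Node Proponent g ->
      b k = fair_move inI St n pw (run (mkseq b k)).
    by have := hb k.+1; rewrite /mkset mkseqS => /fair_strategy_rcons[_ _ h] /h.
  have hsize k : n + k - n = k by rewrite addKn.
  have nthH k d : d < n + k -> nth h0 (mkseq H (n + k)) d = H d.
    by move=> hd; rewrite nth_mkseq.
  have Hlt d : d < n + d.+1 by rewrite addnS ltnS leq_addl.
  have Hn d : (H d).1 < n.
    have [e _] := H2 d.+1; have [w1 _ _] := wfr (mkseq b (2 * d.+1)).
    by have := w1 d; rewrite e /= size_mkseq nthH //; apply.
  have Hbad d : ~~ is_bad (lst (H d)).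
    have [e _] := H2 d.+1; have [_ w1 _] := wfr (mkseq b (2 * d.+1)).
    by have := w1 d; rewrite e /= size_mkseq nthH //; apply.
  (* The play continues with a [JUST] at stage [k], so the first two alternatives of [main_moveP]
     fail for the local positions present at that stage. *)
  have hstage k :
     [/\ forall d, d < n + k -> ~~ stop_ok (H d),
        forall d d', d < n + k -> d' < n + k -> ~~ em_ok (H d) (H d') &
        forall d c, k = cpair d c -> is_node (lst (H d)) -> b (2 * k) = JUST d (n + k)].
    have [e [i [g [m [hi ei _ _ _]]]]] := H2 k.
    have e2 : b (2 * k) = main_move inI St n pw (mkseq H (n + k)).
      by rewrite (hfollow (2 * k) (DROP (n + k))) e /= ?size_mkseq.
    have := hmain (mkseq b (2 * k)); rewrite e /= size_mkseq -e2 ei hsize.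
    case=> [[? [//]]|[? [? [//]]]|[h1 h2 h3]]; split.
    - by move=> d hd; have := h1 d hd; rewrite nthH.
    - by move=> d d' hd hd'; have := h2 d d' hd hd'; rewrite !nthH.
    - move=> d c ek hd; case: h3 => [[i' [_ _ [->] h]]|[_ //]].
      rewrite h // ek unpair1K // nthH //.
      by rewrite (leq_ltn_trans (leq_cpair_l d c)) // -[ltnLHS]add0n ltn_add2r.
  (* The pair of [d] and [c] fixes in advance the stage of the exploration and hence the index
     [n + cpair d c] of the new local position. If P is on turn there and [c] codes a legal move,
     that move was played. *)
  have hchild d c : is_node (lst (H d)) -> exists m,
      [/\ H (n + cpair d c) = ext (H d) m,
          b (2 * cpair d c) = JUST d (n + cpair d c), b (2 * cpair d c + 1) = m &
          forall k m', lst (H d) = Node Proponent k -> c = code_move m' ->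
            ~~ is_bad (lst (ext (H d) m')) -> m = m'].
    move=> hd; have [_ _ /(_ d c erefl hd) e] := hstage (cpair d c).
    have [_ [i [g [k [hi ei enode erun eH]]]]] := H2 (cpair d c).
    have eid : i = d by move: ei; rewrite e => -[].
    subst i; exists (b (2 * cpair d c + 1)); split=> // k' m' ek ec hm'.
    have eg : g = Proponent by move: enode; rewrite ek => -[].
    subst g; have -> := hfollow _ k (congr1 snd erun).
    rewrite erun /fair_move /= /just_move.
    by rewrite size_mkseq hsize unpair2K ec code_moveK nthH -?ec // (negPf hm').
  have [|||v' [d1 d2 d3]] := @saturated_val (fun h => exists d, h = H d).
  + by move=> _ [d ->].
  + by move=> _ [d ->]; have [h _ _] := hstage d.+1; apply: h.
  (* At stage [d + d' + 1] both positions are present. *)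
  + move=> _ _ [d ->] [d' ->]; have [_ h _] := hstage (d + d').+1.
    apply: h; rewrite addnS ltnS; apply: leq_trans (leq_addl n _);
      [exact: leq_addr | exact: leq_addl].
  have [i hi [sigma hw]] := prem d1 d2.
  (* The canonical occurrence of a local position among its repetitions. *)
  pose next d m := n + cpair d
    (if lst (H d) is Node Proponent _ then code_move m else 0).
  pose D q := foldl next i q.
  have DS q m : D (rcons q m) = next (D q) m by rewrite /D foldl_rcons.
  (* At a turn of O, [next] ignores the move and takes the stage with child code 0, so the history
     found there records one reply of O. Requiring correct histories along all prefixes keeps this
     reply only and admits all moves of P. *)
  pose ok q := forall r r', q = r ++ r' -> H (D r) = (i, r).
  have okH q : ok q -> H (D q) = (i, q) by move=> h; apply: (h q [::]); rewrite cats0.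
  have okS q m : ok q -> H (D (rcons q m)) = (i, rcons q m) -> ok (rcons q m).
    move=> hq e r r'; case/lastP: r' => [|r' m']; first by rewrite cats0 => <-.
    by rewrite -rcons_cat => /rcons_inj[/hq].
  have [||tau etau] := @tree_rcons ok.
  + by case=> //= r' _; rewrite /D /= H1.
  + by move=> q m h r r' eq; apply: (h r (rcons r' m)); rewrite eq rcons_cat.
  have okSt q : ok q -> lst (H (D q)) = St i q by move/okH => ->.
  have nodeSt q : supp (local L i) q -> ~ leaf (local L i) q ->
      exists m, St i q = Node (turn (local L i) q) m.
    move=> h h'; have [g [m e]] := (describes_nodeE (desc hi) q).1 (conj h h').
    by exists m; have [_ _ ->] := describes_node (desc hi) e.
  have oksupp q : ok q -> supp (local L i) q.
    move=> hq; apply/(describes_supp (desc hi)).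
    by rewrite -(okSt q hq).
  apply: (not_both_win hw (tau := tau)); rewrite /winning /branch etau; split.
  + exact: oksupp.
  + move=> q hq hl e m hm; apply: okS => //.
    have [k ek] := nodeSt q (oksupp q hq) hl; rewrite /= in e; rewrite e /= in ek.
    have ek' : lst (H (D q)) = Node Proponent k by rewrite okSt.
    have [|m' [eH _ _ em]] := hchild (D q) (code_move m); first by rewrite ek'.
    rewrite DS /next ek' eH (em k m) // okH //.
    exact/(describes_supp (desc hi)).
  + move=> q hq hl e.
    have [k ek] := nodeSt q (oksupp q hq) hl; rewrite /= in e; rewrite e /= in ek.
    have ek' : lst (H (D q)) = Node Opponent k by rewrite okSt.
    have [|m' [eH _ _ em]] := hchild (D q) 0; first by rewrite ek'.
    by exists m'; apply: okS => //; rewrite DS /next ek' eH okH.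
  + move=> q hq /(describes_leafE (desc hi))[x e].
    have [_ /= ->] := describes_leaf (desc hi) e; congr Won.
    by apply: (d3 (H (D q)) x); [exists (D q) | rewrite okSt].
  + move=> q hq; split; first by move=> k; apply: oksupp; exact: hq.
    case eq : (iwin (ginst v' (local L i)) q) => //; case: nothread.
    exists i; split=> //; exists q; split; last first.
      by split=> // k; apply: oksupp; exact: hq.
    (* The canonical occurrences along [q] justify one another, so a branch of [tau] won by P would
       be a winning thread of the play. *)
    exists (fun s => D (mkseq q s)); split=> // s.
    have hs := hq s; have hs' := hq s.+1; rewrite /mkset mkseqS in hs'.
    have hl : ~ leaf (local L i) (mkseq q s).
      by case=> _ /(_ (q s)); apply; exact: oksupp.
    have [k ek] := nodeSt _ (oksupp _ hs) hl.
    rewrite mkseqS DS /next.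
    set c := (X in cpair _ X).
    have [|m [eH ej em _]] := hchild (D (mkseq q s)) c; first by rewrite okSt // ek.
    split.
      apply: leq_ltn_trans (leq_cpair_l (D (mkseq q s)) c) _.
      by rewrite -[ltnLHS]add0n ltn_add2r.
    exists (cpair (D (mkseq q s)) c); split=> //; rewrite em.
    have := okH _ hs'; rewrite DS /next -/c eH okH //.
    by case=> /rcons_inj[].
Qed.

End ForallWin.

(** * Primitive recursive statuses and strategies *)

#[export] Instance coded_status : coded status := fun st =>
  match st with
  | Bad => code (0, 0)
  | Leaf x => code (1, code x)
  | Node g m => code (2, code (g, m))
  end.

Section PrCase.
Context {S T : Type} {cS : coded S} {cT : coded T}.

Lemma pr_muln (f g : S -> nat) : pr f -> pr g -> pr (fun s => f s * g s).
Proof. exact: pr_op2 primrec2_muln. Qed.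

Lemma pr_player_case (g : S -> player) (a b : S -> T) :
  pr g -> pr a -> pr b ->
  pr (fun s => match g s with Proponent => a s | Opponent => b s end).
Proof.
move=> hg ha hb.
apply: pr_ext (pr_if (pr_eqn (pr_codeE hg) (pr_const 0)) ha hb) => s.
by case: (g s).
Qed.

Lemma pr_label_case (x : S -> label) (a : S -> player -> T) (b : S -> par -> T) :
  pr x -> pr (fun y : S * player => a y.1 y.2) -> pr (fun y : S * par => b y.1 y.2) ->
  pr (fun s => match x s with Won g => a s g | Open c => b s c end).
Proof.
move=> [x' hx ex] [a' ha ea] [b' hb eb].
have arg : primrec1 (fun c => cpair c (unpair2 (x' c))).
  exact: primrec1_comp2 primrec2_cpair primrec1_id (primrec1_comp primrec1_unpair2 hx).
eexists; first exact: primrec1_if (primrec1_comp primrec1_unpair1 hx)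
  (primrec1_comp ha arg) (primrec1_comp hb arg).
move=> s /=; rewrite ex; case: (x s) => c; rewrite unpair1K unpair2K.
  exact: (ea (s, c)).
exact: (eb (s, c)).
Qed.

Lemma pr_status_case (x : S -> status) (d : S -> T) (a : S -> label -> T)
    (b : S -> player -> move -> T) :
  pr x -> pr d -> pr (fun y : S * label => a y.1 y.2) ->
  pr (fun y : S * (player * move) => b y.1 y.2.1 y.2.2) ->
  pr (fun s => match x s with Bad => d s | Leaf l => a s l | Node g m => b s g m end).
Proof.
move=> [x' hx ex] [d' hd ed] [a' ha ea] [b' hb eb].
have arg : primrec1 (fun c => cpair c (unpair2 (x' c))).
  exact: primrec1_comp2 primrec2_cpair primrec1_id (primrec1_comp primrec1_unpair2 hx).
have tag := primrec1_comp primrec1_unpair1 hx.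
eexists; first exact: primrec1_if tag hd (primrec1_if (primrec1_comp primrec1_pred tag)
  (primrec1_comp ha arg) (primrec1_comp hb arg)).
move=> s /=; rewrite ex ed; case: (x s) => [|l|g m]; rewrite ?unpair1K ?unpair2K //.
  exact: (ea (s, l)).
exact: (eb (s, (g, m))).
Qed.

End PrCase.

(** The base 5 is the number of constructors of [move], as [code_move] adds the tag to five times
    the argument. Counting up quotient and remainder together gives both by iteration. *)
Lemma iter_divmod5 c :
  iter c (fun y : nat * nat => if y.2 == 4 then (y.1.+1, 0) else (y.1, y.2.+1)) (0, 0)
  = (c %/ 5, c %% 5).
Proof.
elim: c => // c IH; rewrite iterS IH /=.
have := divn_eq c 5; have : c %% 5 < 5 by rewrite ltn_mod.
move: (c %/ 5) (c %% 5) => q r hr ->.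
case: eqP => [->|/eqP hr4].
  have -> : (q * 5 + 4).+1 = q.+1 * 5 by rewrite mulSn addnC.
  by rewrite mulnK // modnMl.
have {hr hr4} lt_r : r.+1 < 5 by case: r hr hr4 => [|[|[|[|[]]]]].
by rewrite -addnS divnMDl // modnMDl divn_small // modn_small ?addn0.
Qed.

Section PrMove.
Context {S : Type} {cS : coded S}.

Lemma pr_divmod5 (f : S -> nat) : pr f -> pr (fun s => (f s %/ 5, f s %% 5)).
Proof.
move=> hf.
pose g (_ : S) (y : nat * nat) := if y.2 == 4 then (y.1.+1, 0) else (y.1, y.2.+1).
have hg : pr (fun y : S * (nat * nat) => g y.1 y.2).
  have h1 : pr (fun y : S * (nat * nat) => y.2.1) by exact: pr_fst (pr_snd pr_id).
  have h2 : pr (fun y : S * (nat * nat) => y.2.2) by exact: pr_snd (pr_snd pr_id).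
  apply: pr_if; first exact: pr_eqn h2 (pr_const _).
    exact: pr_pair (pr_succ h1) (pr_const _).
  exact: pr_pair h1 (pr_succ h2).
apply: pr_ext (pr_iter hf (pr_const (0, 0)) hg) => s.
exact: iter_divmod5.
Qed.

Lemma pr_move_tag (m : S -> move) : pr m -> pr (fun s => move_tag (m s)).
Proof.
move=> hm; apply: pr_ext (pr_snd (pr_divmod5 (pr_codeE hm))) => s /=.
by rewrite /code /coded_move /code_move modnMDl modn_small //; case: (m s).
Qed.

Lemma pr_move_arg (m : S -> move) : pr m -> pr (fun s => move_arg (m s)).
Proof.
move=> hm; apply: pr_ext (pr_fst (pr_divmod5 (pr_codeE hm))) => s /=.
by rewrite /code /coded_move /code_move divnMDl // divn_small ?addn0 //; case: (m s).
Qed.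

Lemma pr_unpair1 (f : S -> nat) : pr f -> pr (fun s => unpair1 (f s)).
Proof. exact: pr_primrec1 primrec1_unpair1. Qed.

Lemma pr_unpair2 (f : S -> nat) : pr f -> pr (fun s => unpair2 (f s)).
Proof. exact: pr_primrec1 primrec1_unpair2. Qed.

Lemma pr_move_case T {cT : coded T} (m : S -> move) (a c f : S -> nat -> T)
    (b e : S -> nat -> nat -> T) :
  pr m ->
  pr (fun y : S * nat => a y.1 y.2) ->
  pr (fun y : S * nat * nat => b y.1.1 y.1.2 y.2) ->
  pr (fun y : S * nat => c y.1 y.2) ->
  pr (fun y : S * nat * nat => e y.1.1 y.1.2 y.2) ->
  pr (fun y : S * nat => f y.1 y.2) ->
  pr (fun s => match m s with
    | DROP d => a s d
    | Defs.EM i j => b s i j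
    | STOP i => c s i
    | JUST i d => e s i d
    | NTH j => f s j
    end).
Proof.
move=> hm ha hb hc he hf.
have ht := pr_move_tag hm; have harg := pr_move_arg hm.
have h1 := pr_unpair1 harg; have h2 := pr_unpair2 harg.
have test i : pr (fun s => move_tag (m s) == i) by exact: pr_eqn ht (pr_const i).
have := pr_if (test 0) (pr_comp2 ha pr_id harg)
  (pr_if (test 1) (pr_comp3 hb pr_id h1 h2)
  (pr_if (test 2) (pr_comp2 hc pr_id harg)
  (pr_if (test 3) (pr_comp3 he pr_id h1 h2) (pr_comp2 hf pr_id harg)))).
apply: pr_ext => s; case: (m s) => //= i j; by rewrite unpair1K unpair2K.
Qed.

Lemma pr_move_mk (c : nat -> move) t :
  (forall i, move_arg (c i) = i) -> (forall i, move_tag (c i) = t) ->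
  forall f : S -> nat, pr f -> pr (fun s => c (f s)).
Proof.
move=> h1 h2 f hf.
apply: pr_code (pr_addn (pr_muln hf (pr_const 5)) (pr_const t)) => s.
by rewrite /code /coded_move /code_move h1 h2.
Qed.

Lemma pr_DROP (f : S -> nat) : pr f -> pr (fun s => DROP (f s)).
Proof. exact: (@pr_move_mk DROP 0). Qed.

Lemma pr_STOP (f : S -> nat) : pr f -> pr (fun s => STOP (f s)).
Proof. exact: (@pr_move_mk STOP 2). Qed.

Lemma pr_move_mk2 (c : nat -> nat -> move) t :
  (forall i j, move_arg (c i j) = cpair i j) -> (forall i j, move_tag (c i j) = t) ->
  forall f g : S -> nat, pr f -> pr g -> pr (fun s => c (f s) (g s)).
Proof.
move=> h1 h2 f g hf hg.
apply: pr_code (pr_addn (pr_muln (pr_op2 primrec2_cpair hf hg) (pr_const 5)) (pr_const t)) => s.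
by rewrite /code /coded_move /code_move h1 h2.
Qed.

Lemma pr_EM (f g : S -> nat) : pr f -> pr g -> pr (fun s => Defs.EM (f s) (g s)).
Proof. exact: (@pr_move_mk2 Defs.EM 1). Qed.

Lemma pr_JUST (f g : S -> nat) : pr f -> pr g -> pr (fun s => JUST (f s) (g s)).
Proof. exact: (@pr_move_mk2 JUST 3). Qed.

Lemma pr_decode_move (f : S -> nat) : pr f -> pr (fun s => decode_move (f s)).
Proof. by apply: pr_code => s; rewrite /code /coded_move code_decode_move. Qed.

Lemma pr_eq_code T {cT : coded T} (f g : S -> T) :
  pr f -> pr g -> pr (fun s => code (f s) == code (g s)).
Proof. by move=> hf hg; exact: pr_eqn (pr_codeE hf) (pr_codeE hg). Qed.

Lemma code_parE t k X (h : k.-tuple nat) :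
  code (@Par t k X h) = cpair t (cpair k (cpair X (code (tval h)))).
Proof. by []. Qed.

Lemma pr_pardual (a : S -> par) : pr a -> pr (fun s => pardual (a s)).
Proof.
move=> ha; have hc := pr_codeE ha.
have := pr_op2 primrec2_cpair (pr_subn (pr_const 1) (pr_unpair1 hc)) (pr_unpair2 hc).
apply: pr_code => s; case: (a s) => t k X h.
by rewrite !code_parE unpair1K unpair2K; case: t.
Qed.

Lemma pr_in_var k X (a : S -> par) : pr a -> pr (fun s => in_var k X (a s)).
Proof.
move=> ha; have h1 := pr_unpair2 (pr_codeE ha).
have := pr_and (pr_eqn (pr_unpair1 h1) (pr_const k))
  (pr_eqn (pr_unpair1 (pr_unpair2 h1)) (pr_const X)).
apply: pr_ext => s; case: (a s) => t l Y h.
by rewrite !code_parE !unpair2K !unpair1K.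
Qed.

Lemma pr_Won (g : S -> player) : pr g -> pr (fun s => Won (g s)).
Proof. by move=> hg; apply: pr_code (pr_pair (pr_const 0) (pr_codeE hg)). Qed.

Lemma pr_Open (a : S -> par) : pr a -> pr (fun s => Open (a s)).
Proof. by move=> ha; apply: pr_code (pr_pair (pr_const 1) (pr_codeE ha)). Qed.

Lemma pr_Leaf (x : S -> label) : pr x -> pr (fun s => Leaf (x s)).
Proof. by move=> hx; apply: pr_code (pr_pair (pr_const 1) (pr_codeE hx)). Qed.

Lemma pr_Node (g : S -> player) (m : S -> move) :
  pr g -> pr m -> pr (fun s => Node (g s) (m s)).
Proof.
by move=> hg hm; apply: pr_code (pr_pair (pr_const 2) (pr_codeE (pr_pair hg hm))).
Qed.

End PrMove.

(* Decomposes a goal [pr (fun s => _)] along the head symbol of its body. *)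
Ltac pr_extra := fail.

Ltac pr_step := first [ match goal with |- pr (fun _ => ?c) => exact (pr_const c) end
  | lazymatch goal with
  | H : pr ?f |- pr ?f => exact H
  | |- pr (fun s => s) => exact pr_id
  | |- pr fst => refine (pr_fst pr_id)
  | |- pr snd => refine (pr_snd pr_id)
  | |- pr (fun s => fst (@?f s)) => refine (pr_fst _)
  | |- pr (fun s => snd (@?f s)) => refine (pr_snd _)
  | |- pr (fun s => negb (@?f s)) => refine (pr_not _)
  | |- pr (fun s => S (@?f s)) => refine (pr_succ _)
  | |- pr (fun s => size (@?f s)) => refine (pr_size _)
  | |- pr (fun s => pardual (@?f s)) => refine (pr_pardual _)
  | |- pr (fun s => Won (@?f s)) => refine (pr_Won _)
  | |- pr (fun s => Open (@?f s)) => refine (pr_Open _)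
  | |- pr (fun s => Leaf (@?f s)) => refine (pr_Leaf _)
  | |- pr (fun s => DROP (@?f s)) => refine (pr_DROP _)
  | |- pr (fun s => STOP (@?f s)) => refine (pr_STOP _)
  | |- pr (fun s => decode_move (@?f s)) => refine (pr_decode_move _)
  | |- pr (fun s => unpair1 (@?f s)) => refine (pr_unpair1 _)
  | |- pr (fun s => unpair2 (@?f s)) => refine (pr_unpair2 _)
  | |- pr (fun s => pair (@?f s) (@?g s)) => refine (pr_pair _ _)
  | |- pr (fun s => andb (@?f s) (@?g s)) => refine (pr_and _ _)
  | |- pr (fun s => subn (@?f s) (@?g s)) => refine (pr_subn _ _)
  | |- pr (fun s => rcons (@?f s) (@?g s)) => refine (pr_rcons _ _)
  | |- pr (fun s => Node (@?f s) (@?g s)) => refine (pr_Node _ _)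
  | |- pr (fun s => Defs.EM (@?f s) (@?g s)) => refine (pr_EM _ _)
  | |- pr (fun s => JUST (@?f s) (@?g s)) => refine (pr_JUST _ _)
  | |- pr (fun s => code (@?f s) == code (@?g s)) => refine (pr_eq_code _ _)
  | |- pr (fun s => @?f s == @?g s) => refine (pr_eqn _ _)
  | |- pr (fun s => leq (@?f s) (@?g s)) => refine (pr_leq _ _)
  | |- pr (fun s => nth ?x (@?f s) (@?g s)) => refine (pr_nth _ _ _)
  | |- pr (fun s => match @?x s with _ => _ end) =>
      let T := type of x in
      lazymatch T with
      | _ -> bool => refine (pr_if (b := x) _ _ _)
      | _ -> status => refine (pr_status_case (x := x) _ _ _ _)
      | _ -> label => refine (pr_label_case (x := x) _ _ _)
      | _ -> player => refine (pr_player_case (g := x) _ _ _)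
      | _ -> move => refine (pr_move_case (m := x) _ _ _ _ _ _)
      | _ -> seq _ => refine (pr_list_case (l := x) _ _ _)
      | _ -> nat => refine (pr_nat_case (n := x) _ _ _)
      end
  | H : pr ?f |- pr (fun s => ?f (@?g s)) => refine (pr_comp H _)
  | |- _ => pr_extra
  end ].

Ltac prs := repeat (cbn beta; pr_step).

Section PrStatus.
Context {S : Type} {cS : coded S}.

Lemma pr_is_bad (x : S -> status) : pr x -> pr (fun s => is_bad (x s)).
Proof. move=> hx; rewrite /is_bad; prs. Qed.

Lemma pr_is_node (x : S -> status) : pr x -> pr (fun s => is_node (x s)).
Proof. move=> hx; rewrite /is_node; prs. Qed.

Lemma pr_sdual (x : S -> status) : pr x -> pr (fun s => sdual (x s)).
Proof. move=> hx; rewrite /sdual /ldual /pdual; prs. Qed.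

End PrStatus.

Ltac pr_extra ::= lazymatch goal with
  | |- pr (fun s => is_bad (@?x s)) => refine (pr_is_bad _)
  | |- pr (fun s => is_node (@?x s)) => refine (pr_is_node _)
  end.

(** * Statuses of quantified games, uniformly in a coded parameter *)

Section PrForall.
Context {Z : Type} {cZ : coded Z}.
Variables (inI : par -> bool) (St : Z -> nat -> seq move -> status).
Hypothesis hSt : pr (fun y : Z * nat * seq move => St y.1.1 y.1.2 y.2).
Hypothesis hI : pr inI.
Notation hist := (nat * seq move)%type.

Section Maps.
Context {S : Type} {cS : coded S}.
Variable z : S -> Z.
Hypothesis hz : pr z.

Lemma pr_lst (h : S -> hist) : pr h -> pr (fun s => lst (St (z s)) (h s)).
Proof. move=> hh; apply: pr_comp3 hSt hz _ _; prs. Qed.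

Lemma pr_hist_ext (h : S -> hist) (m : S -> move) :
  pr h -> pr m -> pr (fun s => ext (h s) (m s)).
Proof. by move=> hh hm; rewrite /ext; prs. Qed.

End Maps.

Ltac pr_extra ::= lazymatch goal with
  | |- pr (fun s => is_bad (@?x s)) => refine (pr_is_bad _)
  | |- pr (fun s => is_node (@?x s)) => refine (pr_is_node _)
  | |- pr (fun s => lst (St (@?z s)) (@?h s)) => refine (pr_lst (z := z) _ _)
  | |- pr (fun s => ext (@?h s) (@?m s)) => refine (pr_hist_ext _ _)
  end.

Section Maps2.
Context {S : Type} {cS : coded S}.
Variable z : S -> Z.
Hypothesis hz : pr z.

Lemma pr_stoppable (x : S -> label) : pr x -> pr (fun s => stoppable inI (x s)).
Proof. move=> hx; rewrite /stoppable; prs. Qed.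

Lemma pr_em_ok (h h' : S -> hist) : pr h -> pr h' ->
  pr (fun s => em_ok inI (St (z s)) (h s) (h' s)).
Proof. move=> hh hh'; rewrite /em_ok; prs. Qed.

Lemma pr_mainst (hs : S -> seq hist) : pr hs -> pr (fun s => mainst (hs s)).
Proof. move=> hhs; rewrite /mainst; prs. Qed.

Lemma pr_deadst (hs : S -> seq hist) : pr hs -> pr (fun s => deadst (hs s)).
Proof. move=> hhs; rewrite /deadst; prs. Qed.

End Maps2.

Ltac pr_extra2 := lazymatch goal with
  | |- pr (fun s => is_bad (@?x s)) => refine (pr_is_bad _)
  | |- pr (fun s => is_node (@?x s)) => refine (pr_is_node _)
  | |- pr (fun s => lst (St (@?z s)) (@?h s)) => refine (pr_lst (z := z) _ _)
  | |- pr (fun s => ext (@?h s) (@?m s)) => refine (pr_hist_ext _ _)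
  | |- pr (fun s => stoppable inI (@?x s)) => refine (pr_stoppable _)
  | |- pr (fun s => em_ok inI (St (@?z s)) (@?h s) (@?h' s)) => refine (pr_em_ok (z := z) _ _ _)
  | |- pr (fun s => mainst (@?h s)) => refine (pr_mainst _)
  | |- pr (fun s => deadst (@?h s)) => refine (pr_deadst _)
  end.
Ltac pr_extra ::= pr_extra2.

Section Maps3.
Context {S : Type} {cS : coded S}.
Variable z : S -> Z.
Hypothesis hz : pr z.

Lemma pr_main_step (hs : S -> seq hist) (m : S -> move) : pr hs -> pr m ->
  pr (fun s => main_step inI (St (z s)) (hs s) (m s)).
Proof. move=> hhs hm; rewrite /main_step; prs. Qed.

Lemma pr_just_step (hs : S -> seq hist) (i : S -> nat) (m : S -> move) :
  pr hs -> pr i -> pr m -> pr (fun s => just_step (St (z s)) (hs s) (i s) (m s)).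
Proof. move=> hhs hi hm; rewrite /just_step; prs. Qed.

End Maps3.

Ltac pr_extra ::= lazymatch goal with
  | |- pr (fun s => main_step inI (St (@?z s)) (@?hs s) (@?m s)) => refine (pr_main_step (z := z) _ _ _)
  | |- pr (fun s => just_step (St (@?z s)) (@?hs s) (@?i s) (@?m s)) => refine (pr_just_step (z := z) _ _ _ _)
  | _ => pr_extra2
  end.

Section Maps4.
Context {S : Type} {cS : coded S}.
Variable z : S -> Z.
Hypothesis hz : pr z.

Lemma pr_fstep (t : S -> fstate) (m : S -> move) : pr t -> pr m ->
  pr (fun s => fstep inI (St (z s)) (t s) (m s)).
Proof. move=> ht hm; rewrite /fstep; prs. Qed.

End Maps4.

Lemma pr_frun {S : Type} {cS : coded S} (z : S -> Z) n (p : S -> seq move) :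
  pr z -> pr p -> pr (fun s => frun inI (St (z s)) n (p s)).
Proof.
move=> hz hp; rewrite /frun.
apply: (pr_foldl (g := fun s => fstep inI (St (z s)))) hp (pr_const _) _.
refine (pr_fstep (z := fun y => z y.1.1) _ _ _); prs.
Qed.

Lemma pr_forall_st {S : Type} {cS : coded S} (z : S -> Z) n (p : S -> seq move) :
  pr z -> pr p -> pr (fun s => forall_st inI (St (z s)) n (p s)).
Proof. by move=> hz hp; exact: pr_snd (pr_frun n hz hp). Qed.

End PrForall.

(** * Primitive recursiveness of the fair strategy *)

Section PrFair.
Variables (inI : par -> bool) (St : nat -> seq move -> status) (n : nat).
Variable pw : label -> bool.
Hypothesis hSt : pr (fun y : nat * seq move => St y.1 y.2).
Hypothesis hI : pr inI.
Hypothesis hpw : pr pw.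
Notation hist := (nat * seq move)%type.

Let hSt' : pr (fun y : nat * nat * seq move => St y.1.2 y.2).
Proof. apply: pr_comp2 hSt _ _; prs. Qed.

Section Fair.
Context {S : Type} {cS : coded S}.

Lemma pr_fair_lst (h : S -> hist) : pr h -> pr (fun s => lst St (h s)).
Proof.
by move=> hh; exact: (@pr_lst nat _ (fun _ : nat => St) hSt' S _ (fun=> 0) (pr_const 0) h hh).
Qed.

Lemma pr_fair_em_ok (h h' : S -> hist) : pr h -> pr h' ->
  pr (fun s => em_ok inI St (h s) (h' s)).
Proof.
exact: (@pr_em_ok nat _ inI (fun _ : nat => St) hSt' hI S _ (fun=> 0) (pr_const 0)).
Qed.

Lemma pr_fair_fstep (t : S -> fstate) (m : S -> move) : pr t -> pr m ->
  pr (fun s => fstep inI St (t s) (m s)).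
Proof.
exact: (@pr_fstep nat _ inI (fun _ : nat => St) hSt' hI S _ (fun=> 0) (pr_const 0)).
Qed.

End Fair.

Ltac pr_extra3 := lazymatch goal with
  | |- pr (fun s => is_bad (@?x s)) => refine (pr_is_bad _)
  | |- pr (fun s => is_node (@?x s)) => refine (pr_is_node _)
  | |- pr (fun s => lst St (@?h s)) => refine (pr_fair_lst _)
  | |- pr (fun s => ext (@?h s) (@?m s)) => refine (pr_hist_ext _ _)
  | |- pr (fun s => em_ok inI St (@?h s) (@?h' s)) => refine (pr_fair_em_ok _ _)
  | |- pr (fun s => find (@?f s) (@?l s)) => refine (pr_find (b := f) _ _)
  | |- pr (fun s => has (@?f s) (@?l s)) => refine (pr_has (b := f) _ _)
  | |- pr (fun s => fstep inI St (@?t s) (@?m s)) => refine (pr_fair_fstep _ _)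
  end.
Ltac pr_extra ::= pr_extra3.

Section Fair2.
Context {S : Type} {cS : coded S}.

Lemma pr_stop_ok (h : S -> hist) : pr h -> pr (fun s => stop_ok inI St pw (h s)).
Proof. move=> hh; rewrite /stop_ok /stoppable; prs. Qed.

Lemma pr_just_target (hs : S -> seq hist) : pr hs -> pr (fun s => just_target St n (hs s)).
Proof. move=> hhs; rewrite /just_target; prs. Qed.

Lemma pr_just_move (hs : S -> seq hist) (i : S -> nat) (m : S -> move) :
  pr hs -> pr i -> pr m -> pr (fun s => just_move St n (hs s) (i s) (m s)).
Proof. move=> hhs hi hm; rewrite /just_move; prs. Qed.

End Fair2.

Ltac pr_extra ::= lazymatch goal with
  | |- pr (fun s => stop_ok inI St pw (@?h s)) => refine (pr_stop_ok _)
  | |- pr (fun s => just_target St n (@?h s)) => refine (pr_just_target _)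
  | |- pr (fun s => just_move St n (@?h s) (@?i s) (@?m s)) => refine (pr_just_move _ _ _)
  | _ => pr_extra3
  end.

Lemma pr_main_move {S : Type} {cS : coded S} (hs : S -> seq hist) : pr hs ->
  pr (fun s => main_move inI St n pw (hs s)).
Proof. move=> hhs; rewrite /main_move; prs. Qed.

Lemma pr_fair_move {S : Type} {cS : coded S} (t : S -> fstate) : pr t ->
  pr (fun s => fair_move inI St n pw (t s)).
Proof.
move=> ht; rewrite /fair_move.
refine (pr_status_case (x := fun s => (t s).2) _ _ _ _); try by prs.
refine (pr_nat_case (n := fun y => (t y.1).1.2) _ _ _); prs.
refine (pr_main_move _); prs.
Qed.

Lemma pr_fair_strategy {S : Type} {cS : coded S} (p : S -> seq move) : pr p ->
  pr (fun s => fair_strategy inI St n pw (p s)).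
Proof.
move=> hp; enough (h : pr (fun s => srun inI St n pw (p s))).
  by rewrite /fair_strategy; prs.
rewrite /srun.
refine (pr_foldl (g := fun _ => sstep inI St n pw) hp (pr_const _) _).
rewrite /sstep; cbn beta.
prs; refine (pr_fair_move _); prs.
Qed.

End PrFair.

Lemma pr_teval {Z : Type} {cZ : coded Z} (E : Z -> nat -> nat) t :
  (forall x, pr (fun z => E z x)) -> pr (fun z => teval (E z) t).
Proof.
move=> hE; elim: t => [x|m|k f ts IH] /=; [exact: hE|exact: pr_const|].
exact: (pr_primrec (prfP f)).
Qed.

Lemma pr_Par {S : Type} {cS : coded S} s k X (f : S -> 'I_k -> nat) :
  (forall i, pr (fun z => f z i)) ->
  pr (fun z => @Par s k X [tuple f z i | i < k]).
Proof.
move=> hf.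
have hl := pr_map_const (enum 'I_k) hf.
by apply: pr_code (pr_pair (pr_const s) (pr_pair (pr_const k) (pr_pair (pr_const X) hl))).
Qed.

Ltac pr_extra ::= lazymatch goal with
  | H : pr (fun y => ?F (fst y) (snd y)) |- pr (fun s => ?F (@?a s) (@?b s)) =>
      refine (pr_comp2 H _ _)
  | H : pr (fun y => ?F (fst (fst y)) (snd (fst y)) (snd y))
      |- pr (fun s => ?F (@?a s) (@?b s) (@?c s)) => refine (pr_comp3 H _ _ _)
  end.

Lemma pr_and_st {S : Type} {cS : coded S} (F G : S -> seq move -> status) :
  pr (fun y : S * seq move => F y.1 y.2) -> pr (fun y : S * seq move => G y.1 y.2) ->
  pr (fun y : S * seq move => and_st (F y.1) (G y.1) y.2).
Proof. move=> hF hG; rewrite /and_st; prs. Qed.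

Lemma pr_all_st {S : Type} {cS : coded S} (F : S -> nat -> seq move -> status) :
  pr (fun y : S * nat * seq move => F y.1.1 y.1.2 y.2) ->
  pr (fun y : S * seq move => all_st (F y.1) y.2).
Proof. move=> hF; rewrite /all_st; prs. Qed.

(** The formula is fixed, so the induction is external. The environment is any family [E] over a
    coded type whose values at each variable are primitive recursive; a first order quantifier
    adjoins the instantiating number to that type, hence the generality in [Z] and [E]. *)
Lemma pr_fstatus A {Z : Type} {cZ : coded Z} (E : Z -> nat -> nat) s :
  (forall x, pr (fun z => E z x)) ->
  pr (fun y : Z * seq move => fstatus s (E y.1) A y.2).
Proof.
have flip (b : bool) (S : Type) (cS : coded S) (f : S -> status) : pr f ->
    pr (fun x => if b then f x else sdual (f x)).
  by case: b => // hf; exact: pr_sdual.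
have hquant k X (S : Type) (cS : coded S) (F : S -> seq move -> status) :
    pr (fun y : S * seq move => F y.1 y.2) ->
    pr (fun y : S * seq move => forall_st (in_var k X) (fun=> F y.1) 1 y.2).
  move=> hF; refine (pr_forall_st (St := fun z _ => F z) (z := fst) _ _ _ _ _); prs.
  by refine (pr_in_var _ _ _); prs.
have hE' (S : Type) (cS : coded S) (F : S -> nat -> nat) x :
    (forall y, pr (fun z => F z y)) ->
    forall y, pr (fun z : S * nat => upd (F z.1) x z.2 y).
  move=> hF y; rewrite /upd; case: (y == x); prs.
  exact: pr_comp (hF y) (pr_fst pr_id).
elim: A Z cZ E s => [s' k p ts|s' k X ts|A IHA B IHB|A IHA B IHB|x A IH|x A IH|k X A IH|k X A IH]
  Z cZ E s hE /=.
- refine (pr_list_case (l := snd) _ _ _); try by prs.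
  have hv : pr (fun y : Z * seq move => p [tuple teval (E y.1) (ts i) | i < k]).
    apply: (@pr_prpred _ _ k p (fun (y : Z * seq move) i => teval (E y.1) (ts i))) => i.
    by apply: pr_teval => x; exact: pr_comp (hE x) (pr_fst pr_id).
  by case: (if s then s' else ~~ s'); prs.
- refine (pr_list_case (l := snd) _ _ _); try by prs.
  refine (pr_Leaf (pr_Open _)).
  refine (@pr_Par _ _ _ k X (fun (y : Z * seq move) i => teval (E y.1) (ts i)) _) => i.
  by apply: pr_teval => x; exact: pr_comp (hE x) (pr_fst pr_id).
- apply: flip; refine (pr_and_st (F := fun z => fstatus true (E z) A)
    (G := fun z => fstatus true (E z) B) _ _); [exact: IHA | exact: IHB].
- apply: flip; refine (pr_and_st (F := fun z => fstatus false (E z) A)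
    (G := fun z => fstatus false (E z) B) _ _); [exact: IHA | exact: IHB].
- apply: flip; refine (pr_all_st (F := fun z m => fstatus true (upd (E z) x m) A) _).
  by apply: (IH _ _ (fun y => upd (E y.1) x y.2)); exact: hE'.
- apply: flip; refine (pr_all_st (F := fun z m => fstatus false (upd (E z) x m) A) _).
  by apply: (IH _ _ (fun y => upd (E y.1) x y.2)); exact: hE'.
- by apply: flip; apply: (hquant k X _ _ (fun z => fstatus true (E z) A)); exact: IH.
- by apply: flip; apply: (hquant k X _ _ (fun z => fstatus false (E z) A)); exact: IH.
Qed.

(** * Truth and winning *)

(** The tree is unchanged; [dual_val] ensures that dualising an open label flips its winner. *)
Lemma winning_gdual v G g T : dual_val v ->
  winning (pdual g) (ginst v G) T -> winning g (ginst v (gdual G)) T.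
Proof.
move=> dv [h1 h2 h3 h4 h5]; split=> //.
- move=> p hp hl /= e m hm; apply: h2 => //=.
  by rewrite pdualK; exact: (can_inj pdualK).
- by move=> p hp hl /= e; apply: h3 => //=; rewrite -e pdualK.
- move=> p hp hl; have [e] := h4 p hp hl.
  by rewrite /= -[g]pdualK -e; congr Won; case: (win G p) => //= [g'|a]; rewrite ?pdualK ?dv ?pdualK.
- by move=> b /h5[hb /= e]; split=> //=; rewrite e pdualK.
Qed.

Lemma winner_gdual v G g : dual_val v ->
  winner (ginst v G) (pdual g) -> winner (ginst v (gdual G)) g.
Proof. by move=> dv [T hT]; exists T; exact: winning_gdual. Qed.

Lemma winner_END v x : winner (ginst v (END x)) (plabel v x).
Proof.
exists tree1; split=> // [p -> []//|b /(_ 1)//].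
Qed.

(** * Winners of conjunctions *)

Section BigWedge.
Variables (v : par -> player) (K : set move) (H : move -> game).

Lemma leaf_bigwedge j q : K j -> leaf (bigwedge K H) (j :: q) <-> leaf (H j) q.
Proof. by move=> hj; split=> [[[_ h1] h2]|[h1 h2]]; split=> // m; [move=> h; apply: (h2 m)|case=> _ /h2]. Qed.

Lemma not_leaf_bigwedge_nil j : K j -> ~ leaf (bigwedge K H) [::].
Proof. by move=> hj [_ /(_ j)]; apply; split=> //; exact: tree_nil. Qed.

Lemma mkseqS_cons T (b : nat -> T) n : mkseq b n.+1 = b 0 :: mkseq (fun i => b i.+1) n.
Proof. by rewrite /mkseq /= (iotaDl 1 0 n) -map_comp. Qed.

(* Player g wins by playing tau j in every conjunct j of M, provided that M is
   all of K if the opponent of g moves at the root. *)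
Lemma winning_bigwedge g (M : set move) (tau : move -> tree) j0 :
  M j0 -> (forall j, M j -> K j) -> (g = Proponent -> forall j, K j -> M j) ->
  (forall j, M j -> winning g (ginst v (H j)) (tau j)) ->
  winner (ginst v (bigwedge K H)) g.
Proof.
move=> M0 MK hg hw.
have [//||T eT] := @tree_rcons (fun p => if p is j :: q then M j /\ tau j q else True).
  by move=> [|j q] m //= [h1 h2]; split=> //; apply: (@tree_prefix _ _ [:: m]); rewrite cats1.
exists T; rewrite /winning /branch eT; split.
- move=> [|j q] //= [h1 h2]; split; first exact: MK.
  by have [h _ _ _ _] := hw j h1; apply: h.
- move=> [|j q] /=.
    move=> _ _ e m [hm _]; split; last exact: tree_nil.
    by apply: hg => //; case: g e {hw}.
  rewrite -/(leaf _) => -[h1 h2] hl; rewrite pdualK => e m [hm1 hm2].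
  split=> //; have [_ h _ _ _] := hw j h1; apply: h => //.
  by move=> h; apply: hl; apply/leaf_bigwedge => //; exact: MK.
- move=> [|j q] /=.
    by move=> _ _ _; exists j0; split=> //; exact: tree_nil.
  move=> [h1 h2] hl; rewrite pdualK => e.
  have [_ _ h _ _] := hw j h1; have [|m hm] := h q h2 _ e.
    by move=> h'; apply: hl; apply/leaf_bigwedge => //; exact: MK.
  by exists m.
- move=> [|j q]; first by move=> _ /(not_leaf_bigwedge_nil (MK _ M0)).
  move=> [h1 h2] /(leaf_bigwedge _ (MK _ h1)) hl.
  have [_ _ _ h _] := hw j h1; rewrite -(h q h2 hl).
  by rewrite [LHS]/= ldualK.
- move=> b hb; have hb0 : M (b 0) by have [] := hb 1.
  have hbE : forall n, if mkseq b n is j :: q then M j /\ tau j q else True := hb.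
  have [h1 _ _ _ h5] := hw _ hb0.
  have hb' : forall n, tau (b 0) (mkseq (fun i => b i.+1) n).
    by move=> n; move: (hbE n.+1); rewrite mkseqS_cons => -[].
  have [h6 h7] := h5 _ hb'.
  split; last by rewrite /= pdualK.
  move=> [//|n]; rewrite mkseqS_cons; split; first exact: MK.
  exact: h6.
Qed.

End BigWedge.

Definition pl (b : bool) : player := if b then Proponent else Opponent.

Lemma winner_choice (I : Type) (P : I -> Prop) (G : I -> game) g :
  (forall i, P i -> winner (G i) g) ->
  exists tau : I -> tree, forall i, P i -> winning g (G i) (tau i).
Proof.
move=> h; have : forall i, exists t : tree, P i -> winning g (G i) t.
  move=> i; have [hi|hi] := pselect (P i); last by exists tree1.
  by have [t] := h i hi; exists t.
by move/choice => [t]; exists t.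
Qed.

(** The function [b] names the winners of the conjuncts: if all are won by P, choice collects its
    strategies; otherwise O enters one conjunct that it wins. *)
Lemma winner_bigwedge v K H (b : move -> bool) j0 : K j0 ->
  (forall j, K j -> winner (ginst v (H j)) (pl (b j))) ->
  winner (ginst v (bigwedge K H)) (pl `[< forall j, K j -> b j >]).
Proof.
move=> hK hw; case: asboolP => hb.
  have [j hj|tau ht] := @winner_choice move K (fun j => ginst v (H j)) Proponent.
    by have := hw j hj; rewrite hb.
  exact: (@winning_bigwedge v K H Proponent K tau j0).
have [j [hj bj]] : exists j, K j /\ b j = false.
  apply: contrapT => h; apply: hb => j hj; case e : (b j) => //.
  by case: h; exists j.
have [t ht] := hw j hj; rewrite bj in ht.
by apply: (@winning_bigwedge v K H Opponent [set j]%classic (fun=> t) j) => // i ->.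
Qed.

Lemma winner_and v G1 G2 b1 b2 :
  winner (ginst v G1) (pl b1) -> winner (ginst v G2) (pl b2) ->
  winner (ginst v (and_game G1 G2)) (pl (b1 && b2)).
Proof.
move=> h1 h2.
have := @winner_bigwedge v [set j | j = NTH 1 \/ j = NTH 2]%classic
   (fun j => if j is NTH 1 then G1 else G2) (fun j => if j is NTH 1 then b1 else b2)
   (NTH 1) (or_introl erefl).
have -> : `[< forall j, [set j | j = NTH 1 \/ j = NTH 2]%classic j ->
    (if j is NTH 1 then b1 else b2) >] = b1 && b2.
  apply/asboolP/andP => [h|[e1 e2] j [->|->]//].
  by split; [apply: (h (NTH 1)); left | apply: (h (NTH 2)); right].
by apply=> j [->|->].
Qed.

Lemma winner_all v H (b : nat -> bool) :
  (forall m, winner (ginst v (H m)) (pl (b m))) ->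
  winner (ginst v (all_game H)) (pl `[< forall m, b m >]).
Proof.
move=> h.
have := @winner_bigwedge v [set j | exists m, j = NTH m]%classic
   (fun j => if j is NTH m then H m else END (Won Opponent))
   (fun j => if j is NTH m then b m else false)
   (NTH 1) (ex_intro _ 1 erefl).
rewrite (_ : `[< forall j, _ >] = `[< forall m, b m >]).
  by apply=> j [m ->].
apply: asbool_equiv_eq; split=> [hb m|hb j [m ->] //].
by apply: (hb (NTH m)); exists m.
Qed.

Lemma winner_flip v G s b : dual_val v -> winner (ginst v G) (pl b) ->
  winner (ginst v (if s then G else gdual G)) (pl (b == s)).
Proof.
move=> dv; case: s; first by rewrite eqb_id.
by move=> h; apply: winner_gdual => //; move: h; case: b.
Qed.

(** With [e] fixed, dual valuations correspond bijectively to the second order parts of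
    environments, by [env_of_val_of] and [val_of_env_of]. Changing a valuation on the instances of
    [X] amounts to choosing a new predicate for [X]. *)
Definition env_of (e : nat -> nat) (v : par -> player) : env :=
  Env e (fun k X h => if v (@Par true k X h) is Proponent then true else false).

Definition val_of (th : env) : par -> player :=
  fun a => let: Par s k X h := a in pl (env2 th X h == s).

Lemma dual_val_of th : dual_val (val_of th).
Proof. by case=> s k X h /=; case: s; case: (env2 _ _ _). Qed.

Lemma env_of_val_of th : env_of (env1 th) (val_of th) = th.
Proof.
case: th => e f; rewrite /env_of /=; congr Env.
by apply: functional_extensionality_dep => k; apply: funext => X; apply: funext => h /=; case: (f k X h).
Qed.

Lemma val_of_env_of e v : dual_val v -> val_of (env_of e v) = v.
Proof.
move=> dv; apply: funext => -[s k X h] /=.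
have := dv (Par true X h); rewrite /=.
by case: s; case: (v (Par true X h)) => //= ->.
Qed.

(** The two cases are the two strategy results: the fair strategy if [b] holds at all variants of
    [v], and O's strategy at a variant where it fails. The winner of the local game is known at each
    valuation, so a winner of the quantified game results. *)
Lemma winner_forall k X v G St (b : (par -> player) -> bool) : dual_val v ->
  describes St G ->
  (forall v', dual_val v' -> winner (ginst v' G) (pl (b v'))) ->
  winner (ginst v (forall_game (VarOf k X) [:: G]))
    (pl `[< forall v', dual_val v' -> (forall a, ~ VarOf k X a -> v' a = v a) -> b v' >]).
Proof.
move=> dv hSt hw.
have desc i : i < size [:: G] -> describes ((fun=> St) i) (local [:: G] i) by case: i.
have inIP (i : nat) (q : seq move) a : i < size [:: G] -> St q = Leaf (Open a) ->
  (in_var k X a <-> VarOf k X a) by move=> _ _; exact: in_varP.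
case: asboolP => hb.
  have [|||T [_ hT]] := fair_strategy_wins desc inIP (pw := fun x => `[< plabel v x = Proponent >]) (v := v) _ dv.
  - exact: VarSet_selfdual.
  - by move=> x _; split=> /asboolP.
  - move=> v' dv' vv'; exists 0 => //.
    by have := hw v' dv'; rewrite hb.
  - by exists T.
have [v' [dv' vv' bv']] : exists v', [/\ dual_val v',
    forall a, ~ VarOf k X a -> v' a = v a & b v' = false].
  apply: contrapT => h; apply: hb => v' dv' vv'; case e : (b v') => //.
  by case: h; exists v'.
apply: (forall_opponent_win desc inIP dv' vv') => -[|//] _.
by have := hw v' dv'; rewrite bv'.
Qed.

Lemma upd2_env_of e v v' k X : dual_val v -> dual_val v' ->
  (forall a, ~ VarOf k X a -> v' a = v a) ->
  env_of e v' = upd2 (env_of e v) X (@env2 (env_of e v') k X).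
Proof.
move=> dv dv' h; rewrite [RHS]/upd2 /=; congr Env.
apply: functional_extensionality_dep => k'; apply: funext => X'; apply: funext => w /=.
case: eqP => [ek|nk]; last by rewrite h // => -[].
case: eqP => [->|nX]; first by subst k'; rewrite tcast_id.
by rewrite h // => -[].
Qed.

(** Naming the winner proves determinacy together with truth. The sign [s] keeps the induction
    structural: a disjunctive formula is the dual of a conjunctive game on its parts with negative
    sign. *)
Lemma winner_ginterp A s e v : dual_val v ->
  winner (ginst v (ginterp s e A)) (pl (truth (env_of e v) A == s)).
Proof.
have upd1E f w x m : upd1 (env_of f w) x m = env_of (upd f x m) w by [].
have quant f w k X B t : dual_val w ->
    (forall w', dual_val w' -> winner (ginst w' (ginterp t f B)) (pl (truth (env_of f w') B == t))) ->
    winner (ginst w (forall_game (VarOf k X) [:: ginterp t f B]))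
      (pl `[< forall Z, truth (@upd2 (env_of f w) k X Z) B == t >]).
  move=> dw hw.
  have := winner_forall k X dw (@fstatusP t f B) (b := fun w' => truth (env_of f w') B == t) hw.
  rewrite (_ : `[< forall v' : par -> player, _ >] = `[< forall Z, truth (@upd2 (env_of f w) k X Z) B == t >]) //.
  (* A predicate [Z] gives the valuation of the updated environment, and a variant [w'] gives its
     own values on the instances of [X]. *)
  apply: asbool_equiv_eq; split=> [h Z|h w' dw' ww'].
    rewrite -[upd2 _ _ _]env_of_val_of; apply: h; first exact: dual_val_of.
    case=> s' k' X' h' ne; rewrite -[in RHS](val_of_env_of f dw) /val_of.
    by rewrite env2_upd2_neq.
  by rewrite (upd2_env_of f dw dw' ww').
elim: A s e v => [s' k p ts|s' k X ts|A IHA B IHB|A IHA B IHB|x A IH|x A IH|k X A IH|k X A IH] s e v dv.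
- have := winner_END v (Won (pl (truth (env_of e v) (FPred s' p ts) == s))).
  rewrite /=; case: (p _); by case: s; case: s'.
- have := winner_END v (Open (Par (if s then s' else ~~ s') X [tuple teval e (ts i) | i < k])).
  set h := [tuple _ | _ < _] => /=; rewrite -/h.
  have := dv (Par true X h); rewrite /=.
  by case: s; case: s'; rewrite /=; case: (v (Par true X h)) => /= e'; rewrite ?e'.
- rewrite [truth _ _]/=; apply: winner_flip => //.
  have := winner_and (IHA true e v dv) (IHB true e v dv).
  by rewrite !eqb_id.
(* Both sides are negated to fit the dual of the conjunction of the negations. *)
- rewrite (_ : (truth _ _ == s) = (~~ truth (env_of e v) (Or A B) == ~~ s)); last first.
    by case: (truth _ _); case: s.
  apply: winner_flip => //.
  have := winner_and (IHA false e v dv) (IHB false e v dv).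
  by rewrite !eqbF_neg -negb_or.
- rewrite [truth _ _]/=; apply: winner_flip => //.
  have := winner_all (fun m => IH true (upd e x m) v dv).
  rewrite (_ : `[< forall m, _ >] = `[< forall m, truth (upd1 (env_of e v) x m) A >]) //.
  by apply: asbool_equiv_eq; split=> h m; have := h m; rewrite eqb_id.
- rewrite (_ : (truth _ _ == s) = (~~ truth (env_of e v) (Ex x A) == ~~ s)); last first.
    by case: (truth _ _); case: s.
  apply: winner_flip => //.
  have := winner_all (fun m => IH false (upd e x m) v dv).
  rewrite (_ : `[< forall m, _ >] = ~~ truth (env_of e v) (Ex x A)) //.
  rewrite /= -asbool_neg; apply: asbool_equiv_eq; split=> [h [m hm]|h m].
    by have := h m; rewrite -upd1E hm.
  by rewrite eqbF_neg; apply/negP => hm; apply: h; exists m.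
- rewrite [truth _ _]/=; apply: winner_flip => //.
  have := quant e v k X A true dv (fun w' => IH true e w').
  rewrite (_ : `[< forall Z, _ >] = `[< forall Z, truth (@upd2 (env_of e v) k X Z) A >]) //.
  by apply: asbool_equiv_eq; split=> h m; have := h m; rewrite eqb_id.
- rewrite (_ : (truth _ _ == s) = (~~ truth (env_of e v) (Ex2 k X A) == ~~ s)); last first.
    by case: (truth _ _); case: s.
  apply: winner_flip => //.
  have := quant e v k X A false dv (fun w' => IH false e w').
  rewrite (_ : `[< forall m, _ >] = ~~ truth (env_of e v) (Ex2 k X A)) //.
  rewrite /= -asbool_neg; apply: asbool_equiv_eq; split=> [h [m hm]|h m].
    by have := h m; rewrite hm.
  by rewrite eqbF_neg; apply/negP => hm; apply: h; exists m.
Qed.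

Lemma truth_ext A th th' :
  (forall x, free1 x A -> env1 th x = env1 th' x) ->
  (forall k X, free2 k X A -> @env2 th k X = @env2 th' k X) ->
  truth th A = truth th' A.
Proof.
have tevalE e e' t : (forall x, tfree x t -> e x = e' x) -> teval e t = teval e' t.
  elim: t => [x|n|k f ts IH] /= h; [exact: h|by []|].
  congr (prf f _); apply: eq_from_tnth => i; rewrite !tnth_mktuple.
  by apply: IH => x hx; apply: h; exists i.
have upd1E t t' (B : formula) x n : (forall y, (x <> y /\ free1 y B) -> env1 t y = env1 t' y) ->
    forall y, free1 y B -> env1 (upd1 t x n) y = env1 (upd1 t' x n) y.
  by move=> h y hy /=; case: eqP => // ne; apply: h; split=> // e; apply: ne.
have upd2E t t' (B : formula) k X Z :
    (forall k' X', ~ (k = k' /\ X = X') /\ free2 k' X' B -> @env2 t k' X' = @env2 t' k' X') ->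
    forall k' X', free2 k' X' B -> @env2 (@upd2 t k X Z) k' X' = @env2 (@upd2 t' k X Z) k' X'.
  move=> h k' X' hf; apply: funext => w /=.
  case: eqP => [ek|nk]; last by rewrite h //; split=> // -[] /esym.
  case: eqP => // nX; rewrite h //; split=> // -[_] /esym //.
elim: A th th' => [s k p ts|s k X ts|A IHA B IHB|A IHA B IHB|x A IH|x A IH|k X A IH|k X A IH]
  th th' /= h1 h2.
- rewrite (_ : [tuple _ | i < k] = [tuple teval (env1 th') (ts i) | i < k]) //.
  apply: eq_from_tnth => i; rewrite !tnth_mktuple.
  by apply: tevalE => x hx; apply: h1; exists i.
- rewrite (_ : [tuple _ | i < k] = [tuple teval (env1 th') (ts i) | i < k]); first by rewrite h2.
  apply: eq_from_tnth => i; rewrite !tnth_mktuple.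
  by apply: tevalE => x hx; apply: h1; exists i.
- rewrite (IHA th th') ?(IHB th th') // => *; (apply: h1 || apply: h2); by [left|right].
- rewrite (IHA th th') ?(IHB th th') // => *; (apply: h1 || apply: h2); by [left|right].
- have e n : truth (upd1 th x n) A = truth (upd1 th' x n) A by apply: IH => //; exact: upd1E.
  by apply: asbool_equiv_eq; split=> h n; have := h n; rewrite e.
- have e n : truth (upd1 th x n) A = truth (upd1 th' x n) A by apply: IH => //; exact: upd1E.
  by apply: asbool_equiv_eq; split=> -[n h]; exists n; have := h; rewrite e.
- have e Z : truth (@upd2 th k X Z) A = truth (@upd2 th' k X Z) A by apply: IH => //; exact: upd2E.
  by apply: asbool_equiv_eq; split=> h n; have := h n; rewrite e.
- have e Z : truth (@upd2 th k X Z) A = truth (@upd2 th' k X Z) A by apply: IH => //; exact: upd2E.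
  by apply: asbool_equiv_eq; split=> -[n h]; exists n; have := h; rewrite e.
Qed.

Lemma winner_ginst_ext v v' G g :
  (forall p a, leaf G p -> win G p = Open a -> v a = v' a) ->
  winner (ginst v G) g -> winner (ginst v' G) g.
Proof.
move=> h [T [h1 h2 h3 h4 h5]]; exists T; split=> // p hp hl.
rewrite -(h4 p hp hl) /=; congr Won.
by case e : (win G p) => [//|a] /=; rewrite (h p a hl e).
Qed.

Lemma winner_truth A th rho : closed1 A -> assignment_for rho (interp A) ->
  correspond A rho th -> winner (instance rho (interp A)) (pl (truth th A)).
Proof.
move=> hA hrho hc.
(* rho is completed by th outside of its domain. *)
pose v (a : par) := if `[< adom rho a >] then aval rho a else val_of th a.
have dv : dual_val v.
  move=> a; rewrite /v.
  have -> : `[< adom rho (pardual a) >] = `[< adom rho a >].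
    by apply: asbool_equiv_eq; exact: adom_selfdual.
  by case: asboolP => ha; [exact: aval_dual | exact: dual_val_of].
have -> : truth th A = truth (env_of (fun=> 0) v) A.
  apply: truth_ext => [x /hA//|k X hf]; apply: funext => h /=; rewrite /v.
  case: asboolP => [ha|_]; last by rewrite /= eqb_id; case: (env2 _ _ _).
  have := hc k X h hf ha; case: (aval _ _); case: (env2 _ _ _) => //.
  - by case=> /(_ erefl).
  - by case=> _ /(_ erefl).
have := winner_ginterp A true (fun=> 0) dv.
rewrite eqb_id -interpE; apply: winner_ginst_ext => p a hl e.
rewrite /v; case: asboolP => // -[]; apply: hrho => J _; apply; [exact: hl|exact: e].
Qed.

(** * Sequents *)

Fixpoint seq_status (Gamma : seq formula) (i : nat) : seq move -> status :=
  if Gamma is A :: Gamma' then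
    if i is i'.+1 then seq_status Gamma' i' else fstatus true (fun=> 0) A
  else fun=> Bad.

Lemma pr_seq_status Gamma : pr (fun y : nat * seq move => seq_status Gamma y.1 y.2).
Proof.
elim: Gamma => [|A Gamma IH] /=; first exact: pr_const.
apply: (@pr_ext _ _ _ _ (fun y : nat * seq move =>
    if y.1 is i.+1 then seq_status Gamma i y.2 else fstatus true (fun=> 0) A y.2)).
  by case=> [[|i] p].
apply: (pr_nat_case (n := fst) (b := fun (y : nat * seq move) i => seq_status Gamma i y.2)).
- exact: pr_fst pr_id.
- by apply: (@pr_fstatus A nat _ (fun _ _ => 0) true) => x; exact: pr_const.
- exact: pr_comp2 IH (pr_snd pr_id) (pr_snd (pr_fst pr_id)).
Qed.

Section Sequent.
Variable Gamma : seq formula.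
Let L := [seq interp A | A <- Gamma].
Let FV2 : set par := VarSet (fun k X => List.Exists (free2 k X) Gamma).
Let inI : par -> bool := fun=> true.

Lemma seq_status_describes i : i < size L -> describes (seq_status Gamma i) (local L i).
Proof.
rewrite /L; elim: Gamma i => // A G IH [|i] /= hi; last exact: IH.
by rewrite /local /= interpE; exact: fstatusP.
Qed.

Lemma seq_status_label i q a : i < size L -> seq_status Gamma i q = Leaf (Open a) ->
  (inI a <-> FV2 a).
Proof.
move=> hi e; split=> // _; move: hi e; rewrite /L /FV2.
elim: Gamma i => // A G IH [|i] /= hi e; last first.
  by have := IH i hi e; clear; case: a => s k X h /= ?; right.
by have := fstatus_label e; clear; case: a => s k X h /= ?; left.
Qed.

Let desc := describes_forall seq_status_describes seq_status_label.

(** All parameters met in the local games belong to [FV2], and an open label would have to come from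
    a [STOP] at a parameter outside it. *)
Lemma sequent_label p a : leaf (interp_sequent Gamma) p ->
  win (interp_sequent Gamma) p <> Open a.
Proof.
move=> /(describes_leafE desc)[x e]; have [_ ->] := describes_leaf desc e.
move=> ex; subst x.
have [i hi|//] := forall_st_label _ e.
exact: describes_St_nil seq_status_describes i hi.
Qed.

Lemma sequent_set_theoretical : set_theoretical (interp_sequent Gamma).
Proof.
rewrite /set_theoretical predeqE => a; split=> // /(_ set0); apply=> //.
by move=> p b hl /(sequent_label hl).
Qed.

Lemma sequent_winner : valid_sequent Gamma ->
  exists sigma : tree, winning Proponent (interp_sequent Gamma) sigma /\ primrec_set sigma.
Proof.
move=> hv.
pose v := val_of (Env (fun=> 0) (fun _ _ _ => true)).
(* Here every stoppable label is already won by a player, so this test meets its specification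
   without consulting a valuation. *)
pose pw x := if x is Won Proponent then true else false.
have [|||T [eT hT]] := fair_strategy_wins seq_status_describes seq_status_label
  (pw := pw) (v := v) _ (dual_val_of _).
- exact: VarSet_selfdual.
- by case=> [[]|a] //=.
(* Validity provides a true formula for each environment; the index may vary with [v']. *)
- move=> v' dv' _; have := hv (env_of (fun=> 0) v'); rewrite /L.
  elim: Gamma => [|A G IH] h; first by inversion h.
  have [hA|hG'] : truth (env_of (fun=> 0) v') A = true \/
      List.Exists (fun A => truth (env_of (fun=> 0) v') A = true) G.
    by inversion h; [left|right].
    exists 0 => //=; rewrite /local /= interpE.
    by have := winner_ginterp A true (fun=> 0) dv'; rewrite hA.
  by have [i hi hw] := IH hG'; exists i.+1.
exists T; split.
  have [h1 h2 h3 h4 h5] := hT; split=> // p hp hl.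
  have h : Won (plabel v (win (interp_sequent Gamma) p)) = Won Proponent := h4 p hp hl.
  change (win (interp_sequent Gamma) p = Won Proponent).
  move: h; case e : (win (interp_sequent Gamma) p) => [g|a] //= _.
  by case: (sequent_label hl e).
have hpw : pr pw.
  by refine (pr_label_case (x := fun x => x) (a := fun _ g => if g is Proponent then true
    else false) (b := fun _ _ => false) _ _ _); prs.
have [g hg eg] := pr_fair_strategy (size L) (pr_seq_status Gamma) (pr_const true) hpw
  (@pr_id (seq move) _).
exists (fun c => 1 <= g c); split.
  exact: primrec1_comp2 primrec2_leq (primrec1_const 1) hg.
move=> p; rewrite eT -code_seq_move eg.
by case: (fair_strategy _ _ _ _ _).
Qed.
End Sequent.

Theorem mainTheorem6 (A : formula) (Gamma : seq formula)
  (hA : closed1 A) (hGamma : List.Forall closed1 Gamma)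
  (theta : env) (rho : assignment) (hrho : assignment_for rho (interp A)) :
  determined (instance rho (interp A)) /\
  (correspond A rho theta ->
             (truth theta A = true <-> winner (instance rho (interp A)) Proponent)) /\
  (valid_game (interp A) <-> valid A) /\
  (set_theoretical (interp_sequent Gamma) /\
             (valid_sequent Gamma ->
              exists sigma : tree,
                winning Proponent (interp_sequent Gamma) sigma /\
                primrec_set sigma)).
Proof.
(* [winner_truth] names a winner in either case; that P cannot also win when O does gives the
   converse. *)
have truthP r th : assignment_for r (interp A) -> correspond A r th ->
    truth th A = true <-> winner (instance r (interp A)) Proponent.
  move=> hr hc; have := winner_truth hA hr hc.
  case: (truth th A) => //= -[tau htau]; split=> // -[sigma hsigma].
  by have := not_both_win hsigma htau.
have corr r : correspond A r (env_of (fun=> 0) (aval r)).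
  by move=> k X h _ _ /=; case: (aval r _).
split; last split; last split; last split.
- by eexists; exact: winner_truth hA hrho (corr rho).
- exact: truthP.
- split=> [hv th|hv r hr]; last by apply/(truthP _ _ hr (corr r)); exact: hv.
  (* Every environment [th] has to be tested: it is turned into an assignment defined on all
     parameters, which corresponds to it. *)
  pose r := @Assignment setT (val_of th) (fun=> conj (fun=> Logic.I) (fun=> Logic.I))
    (fun a _ => dual_val_of th a).
  have hr : assignment_for r (interp A) by [].
  apply/(truthP r th hr); last exact: hv.
  by move=> k X h _ _ /=; rewrite eqb_id; case: (env2 _ _ _).
- exact: sequent_set_theoretical.
- exact: sequent_winner.
Qed.
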